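(* Let $-1\le B<A\le 1$ and let $f\in\mathcal{C}(A,B)$. Then the logarithmic coefficients $\gamma_n$ of $f$ satisfy $$|\gamma_1|\le\frac{A-B}{4},$$ $$|\gamma_2|\le\begin{cases}\dfrac{A-B}{12}, & \text{if } |A-5B|\le4,\\[2mm] \dfrac{A-B}{48}|A-5B|, & \text{if } |A-5B|>4,\end{cases}$$ $$|\gamma_3|\le\begin{cases}\dfrac{A-B}{24}, & \text{if } (\mu,\nu)\in D_1\cup D_2,\\[2mm] \dfrac{A-B}{48}|B(A-3B)|, & \text{if } (\mu,\nu)\in D_6,\\[2mm] \dfrac{A-B}{72\sqrt3}\cdot\dfrac{(|A-5B|+2)^{3/2}}{\sqrt{|A-5B|+2+3B^2-AB}}, & \text{if } (\mu,\nu)\in D_8\cup D_9,\end{cases}$$ where $\mu=\frac12(A-5B)$, $\nu=\frac12(3B^2-AB)$, and $$D_1=\left\{(\mu,\nu): |\mu|\le\tfrac12,\ -1<\nu\le1\right\},$$ $$D_2=\left\{(\mu,\nu): \tfrac12\le|\mu|\le2,\ \tfrac{4}{27}(|\mu|+1)^3-(|\mu|+1)\le\nu\le1\right\},$$ $$D_6=\left\{(\mu,\nu): 2\le|\mu|\le4,\ \nu\ge\tfrac1{12}(\mu^2+8)\right\},$$ $$D_8=\left\{(\mu,\nu): \tfrac12\le|\mu|\le2,\ -\tfrac23(|\mu|+1)\le\nu\le\tfrac4{27}(|\mu|+1)^3-(|\mu|+1)\right\},$$ $$D_9=\left\{(\mu,\nu): |\mu|\ge2,\ -\tfrac23(|\mu|+1)\le\nu\le\tfrac{2|\mu|(|\mu|+1)}{\mu^2+2|\mu|+4}\right\}.$$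 All the estimates are sharp, i.e. for each estimate (in each listed case) equality is attained by some function in $\mathcal{C}(A,B)$.
   Context: $\mathbb{D}=\{z\in\mathbb{C}:|z|<1\}$; $\mathcal{A}$ is the class of analytic functions $f$ on $\mathbb{D}$ with $f(0)=0$, $f'(0)=1$. For analytic $F,G$ on $\mathbb{D}$, $F\prec G$ (subordination) means $F=G\circ\omega$ for some analytic $\omega:\mathbb{D}\to\mathbb{D}$ with $\omega(0)=0$. For $-1\le B<A\le1$, $\mathcal{C}(A,B)$ (Janowski convex functions) is the class of $f\in\mathcal{A}$ with $1+\frac{zf''(z)}{f'(z)}\prec\frac{1+Az}{1+Bz}$. The logarithmic coefficients $\gamma_n$ of $f$ are defined by the expansion about the origin $\log\frac{f(z)}{z}=2\sum_{n=1}^{\infty}\gamma_nz^n$, with the branch of the logarithm vanishing at $z=0$. *)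

(* Defs.v *)
From Stdlib Require Import Reals.
From Coquelicot Require Import Coquelicot.
Local Open Scope C_scope.

(** Functions on the unit disc are total functions [C -> C] whose values
    outside the disc are irrelevant. *)
Definition in_disc (z : C) : Prop := (Cmod z < 1)%R.

Definition analytic_at (f : C -> C) (z0 : C) : Prop :=
  exists (a : nat -> C) (r : R), (0 < r)%R /\
    forall z : C, (Cmod (z - z0) < r)%R -> is_pseries a (z - z0) (f z).

Definition analytic_on_disc (f : C -> C) : Prop :=
  forall z : C, in_disc z -> analytic_at f z.

(** The class [A] of normalized analytic functions. *)
Definition class_A (f : C -> C) : Prop :=
  analytic_on_disc f /\ f 0 = 0 /\ C_derive f 0 = 1.

Definition subordinate (F G : C -> C) : Prop :=
  exists w : C -> C,
    analytic_on_disc w /\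
    (forall z : C, in_disc z -> in_disc (w z)) /\
    w 0 = 0 /\
    (forall z : C, in_disc z -> F z = G (w z)).

(** Janowski convex functions [C(A,B)].  Division is total in Coquelicot, so the
    condition [f' <> 0], without which [z f''(z) / f'(z)] is not an analytic
    function on the disc, is made explicit. *)
Definition janowski_convex (A B : R) (f : C -> C) : Prop :=
  class_A f /\
  (forall z : C, in_disc z -> C_derive f z <> 0) /\
  subordinate (fun z : C => 1 + z * C_derive (C_derive f) z / C_derive f z)
              (fun z : C => (1 + A * z) / (1 + B * z)).

Definition Cexp (z : C) : C :=
  (exp (Re z) * cos (Im z), exp (Re z) * sin (Im z))%R.

(** [g] are the logarithmic coefficients of [f]: near the origin,
    [L z = 2 * \sum_(n >= 1) g n * z ^ n] is the branch of [log (f z / z)] with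
    [L 0 = 0] (continuity of [L] comes from the power series).
    The value [g 0] plays no role. *)
Definition log_coefficients (f : C -> C) (g : nat -> C) : Prop :=
  exists (L : C -> C) (r : R), (0 < r)%R /\
    L 0 = 0 /\
    (forall z : C, z <> 0 -> (Cmod z < r)%R -> Cexp (L z) = f z / z) /\
    (forall z : C, (Cmod z < r)%R ->
       is_pseries (fun n : nat => match n return C with O => 0 | S _ => 2 * g n end)
                  z (L z)).

Local Open Scope R_scope.

Definition gamma_bound (A B : R) (n : nat) (M : R) : Prop :=
  forall (f : C -> C) (g : nat -> C),
    janowski_convex A B f -> log_coefficients f g -> Cmod (g n) <= M.

Definition gamma_attained (A B : R) (n : nat) (M : R) : Prop :=
  exists (f : C -> C) (g : nat -> C),
    janowski_convex A B f /\ log_coefficients f g /\ Cmod (g n) = M.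

Definition gamma_sharp_bound (A B : R) (n : nat) (M : R) : Prop :=
  gamma_bound A B n M /\ gamma_attained A B n M.

Definition D1 (mu nu : R) : Prop := Rabs mu <= 1 / 2 /\ -1 < nu <= 1.

Definition D2 (mu nu : R) : Prop :=
  1 / 2 <= Rabs mu <= 2 /\
  4 / 27 * (Rabs mu + 1) ^ 3 - (Rabs mu + 1) <= nu <= 1.

Definition D6 (mu nu : R) : Prop :=
  2 <= Rabs mu <= 4 /\ nu >= 1 / 12 * (mu ^ 2 + 8).

Definition D8 (mu nu : R) : Prop :=
  1 / 2 <= Rabs mu <= 2 /\
  - (2 / 3) * (Rabs mu + 1) <= nu
    <= 4 / 27 * (Rabs mu + 1) ^ 3 - (Rabs mu + 1).

Definition D9 (mu nu : R) : Prop :=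
  Rabs mu >= 2 /\
  - (2 / 3) * (Rabs mu + 1) <= nu
    <= 2 * Rabs mu * (Rabs mu + 1) / (mu ^ 2 + 2 * Rabs mu + 4).

(* Main.v *)
Require Import Defs.
From Stdlib Require Import Reals Lra Lia Psatz ClassicalEpsilon.
From Coquelicot Require Import Coquelicot.
Local Open Scope R_scope.

(** The subordination turns into [z f''(z) / f'(z) = (A - B) w / (1 + B w)] for a
    Schwarz function [w = c1 z + c2 z^2 + ...]. Comparing coefficients there and
    in [L' F = F'], where [F = f(z) / z = exp L], gives
<<
      gamma1 = (A-B)/4  c1,
      gamma2 = (A-B)/12 (c2 + (A-5B)/4 c1^2),
      gamma3 = (A-B)/24 (c3 + mu c1 c2 + nu c1^3),
>>
    so everything is a sharp coefficient problem for Schwarz functions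
    ([gamma_of_schwarz]).

    Upper bounds. Two steps of the Schur algorithm write
<<
      c1 = a,  c2 = (1-|a|^2) b,  c3 = (1-|a|^2) ((1-|b|^2) d - conj(a) b^2)
>>
    with [a], [b], [d] in the closed unit disc ([schwarz_c2], [schwarz_c3]). The
    only analytic input is the maximum principle, which needs no integration: at
    an interior maximum of [|g|^2 + eps |z|^2], averaging over the four points
    [t], [-t], [i t], [-i t] around it gives a strictly larger value
    ([smooth_increase]). After a rotation the third functional
    depends on [|a|], [|b|] and one angle. Since [nu <= mu^2 / 4] for all [A], [B],
    maximizing over the angle has two regimes. Either the extremal [b] is real
    and the bound is a one-variable problem ([real_angle_bound]), or the bound is
    an envelope that increases in [|b|] until [|b| = 1] or the first regime is met
    ([schur_bound]). In the region [D6] the envelope alone decides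
    ([schur_bound_large]).

    Sharpness. The extremal Schwarz functions are [z^3] and the products
    [sg z (z + al) / (1 + al z)], which include [z] and [z^2] up to sign. For a
    given [w] one solves [p' = q p] by power series, with
    [q = (A-B) w / (z (1 + B w))], and takes [f = int p]; then [p = exp (int q)] has
    no zero ([janowski_exists]). The only delicate point is that [q] converges in
    the whole disc, which is an energy estimate for a two-term recurrence
    ([quad_bound]). *)

Local Open Scope C_scope.

(** * Germs with a finite Taylor expansion *)

(** Expansion of [g] at 0 to order [n] with bounded remainder, given by repeated
    division by [h]. The recursive form makes products, inverses and quotients by
    [h] short inductions. The point 0 is excluded, so that [g] need not be defined
    there in a meaningful way. *)
Fixpoint jet (n : nat) (p : nat -> C) (g : C -> C) : Prop :=
  match n with
  | O => exists K d : R, (0 < d)%R /\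
           forall h : C, (0 < Cmod h < d)%R -> (Cmod (g h) <= K)%R
  | S m => exists g' : C -> C, jet m (fun k => p (S k)) g' /\
           exists d : R, (0 < d)%R /\
             forall h : C, (0 < Cmod h < d)%R -> g h = p O + h * g' h
  end.

Fixpoint conv (p q : nat -> C) (n : nat) : C :=
  match n with
  | O => p O * q O
  | S m => p O * q (S m) + conv (fun k => p (S k)) q m
  end.

Definition shift (p : nat -> C) (n : nat) : C :=
  match n with O => 0 | S m => p m end.

Lemma jet_ext n p q f g d :
  (0 < d)%R -> (forall h, (0 < Cmod h < d)%R -> f h = g h) ->
  (forall k, (k < n)%nat -> p k = q k) -> jet n p f -> jet n q g.
Proof.
  revert p q f g d; induction n as [|n IH]; intros p q f g d Hd Hfg Hpq; simpl.
  - intros (K & e & He & H). exists K, (Rmin d e). split.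
    + now apply Rmin_pos.
    + intros h Hh. assert (Rmin d e <= d)%R by apply Rmin_l.
      assert (Rmin d e <= e)%R by apply Rmin_r.
      rewrite <- Hfg by lra. apply H; lra.
  - intros (g' & Hg' & e & He & H). exists g'. split.
    + apply (IH (fun k => p (S k)) _ g' g' d); auto. intros k Hk; apply Hpq; lia.
    + exists (Rmin d e). split. now apply Rmin_pos.
      intros h Hh. assert (Rmin d e <= d)%R by apply Rmin_l.
      assert (Rmin d e <= e)%R by apply Rmin_r.
      rewrite <- Hfg by lra. rewrite H by lra. now rewrite Hpq by lia.
Qed.

Lemma jet_bounded n p g : jet n p g ->
  exists K d : R, (0 < d)%R /\ forall h : C, (0 < Cmod h < d)%R -> (Cmod (g h) <= K)%R.
Proof.
  revert p g; induction n as [|n IH]; intros p g; simpl; auto.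
  intros (g' & Hg' & e & He & H). destruct (IH _ _ Hg') as (K & d & Hd & HK).
  exists (Cmod (p O) + d * K)%R, (Rmin d e). split. now apply Rmin_pos.
  intros h Hh. assert (Rmin d e <= d)%R by apply Rmin_l.
  assert (Rmin d e <= e)%R by apply Rmin_r.
  rewrite H by lra. eapply Rle_trans. apply Cmod_triangle.
  apply Rplus_le_compat_l. rewrite Cmod_mult.
  apply Rmult_le_compat; try apply Cmod_ge_0; try lra. apply HK; lra.
Qed.

Lemma jet_down n p g : jet (S n) p g -> jet n p g.
Proof.
  revert p g; induction n as [|n IH]; intros p g H.
  - exact (jet_bounded 1 p g H).
  - destruct H as (g' & Hg' & H). exists g'. split; auto.
Qed.

Lemma jet_le m n p g : (m <= n)%nat -> jet n p g -> jet m p g.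
Proof. induction 1; auto. intros H1; apply IHle. now apply jet_down. Qed.

Lemma jet_0 n : jet n (fun _ => 0) (fun _ => 0).
Proof.
  induction n as [|n IH]; simpl.
  - exists 0%R, 1%R. split. lra. intros; rewrite Cmod_0; lra.
  - exists (fun _ => 0). split; auto. exists 1%R. split. lra. intros; ring.
Qed.

Definition cst (c : C) (n : nat) : C := match n with O => c | S _ => 0 end.

Lemma jet_const n c : jet n (cst c) (fun _ => c).
Proof.
  destruct n as [|n]; simpl.
  - exists (Cmod c), 1%R. split. lra. intros; lra.
  - exists (fun _ => 0). split. apply jet_0. exists 1%R. split. lra. intros; ring.
Qed.

Lemma jet_plus n p q f g : jet n p f -> jet n q g ->
  jet n (fun k => p k + q k) (fun h => f h + g h).
Proof.
  revert p q f g; induction n as [|n IH]; intros p q f g; simpl.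
  - intros (K & d & Hd & H) (K' & d' & Hd' & H'). exists (K + K')%R, (Rmin d d').
    split. now apply Rmin_pos. intros h Hh.
    assert (Rmin d d' <= d)%R by apply Rmin_l.
    assert (Rmin d d' <= d')%R by apply Rmin_r.
    eapply Rle_trans. apply Cmod_triangle. apply Rplus_le_compat; [apply H|apply H']; lra.
  - intros (f' & Hf & d & Hd & H) (g' & Hg & d' & Hd' & H').
    exists (fun h => f' h + g' h). split. now apply IH.
    exists (Rmin d d'). split. now apply Rmin_pos. intros h Hh.
    assert (Rmin d d' <= d)%R by apply Rmin_l.
    assert (Rmin d d' <= d')%R by apply Rmin_r.
    rewrite H, H' by lra. ring.
Qed.

Lemma jet_scal n c p f : jet n p f -> jet n (fun k => c * p k) (fun h => c * f h).
Proof.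
  revert p f; induction n as [|n IH]; intros p f; simpl.
  - intros (K & d & Hd & H). exists (Cmod c * K)%R, d. split; auto. intros h Hh.
    rewrite Cmod_mult. apply Rmult_le_compat_l. apply Cmod_ge_0. now apply H.
  - intros (f' & Hf & d & Hd & H). exists (fun h => c * f' h). split. now apply IH.
    exists d; split; auto. intros h Hh. rewrite H by auto. ring.
Qed.

Lemma jet_shift n p g : jet n p g -> jet (S n) (shift p) (fun h => h * g h).
Proof.
  intros H. exists g. split. exact H. exists 1%R. split. lra. intros; simpl; ring.
Qed.

Lemma jet_id n : jet n (shift (cst 1)) (fun h => h).
Proof.
  apply (jet_le n (S n)). lia.
  apply (jet_ext _ (shift (cst 1)) _ (fun h => h * 1) _ 1); auto. lra.
  intros; ring. apply jet_shift, jet_const.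
Qed.

Lemma jet_mult n p q f g : jet n p f -> jet n q g -> jet n (conv p q) (fun h => f h * g h).
Proof.
  revert p q f g; induction n as [|n IH]; intros p q f g.
  - intros (K & d & Hd & H) (K' & d' & Hd' & H'). exists (K * K')%R, (Rmin d d').
    split. now apply Rmin_pos. intros h Hh.
    assert (Rmin d d' <= d)%R by apply Rmin_l.
    assert (Rmin d d' <= d')%R by apply Rmin_r.
    rewrite Cmod_mult. apply Rmult_le_compat; try apply Cmod_ge_0; [apply H|apply H']; lra.
  - intros (f' & Hf & d & Hd & H) Hg0. assert (Hg1 := jet_down _ _ _ Hg0).
    destruct Hg0 as (g' & Hg & d' & Hd' & H').
    exists (fun h => p O * g' h + f' h * g h). split.
    + apply (jet_plus n (fun k => p O * q (S k)) (conv (fun k => p (S k)) q)).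
      now apply (jet_scal n (p O) (fun k => q (S k))). now apply IH.
    + exists (Rmin d d'). split. now apply Rmin_pos. intros h Hh.
      assert (Rmin d d' <= d)%R by apply Rmin_l.
      assert (Rmin d d' <= d')%R by apply Rmin_r.
      rewrite (H h) by lra. rewrite (H' h) at 1 by lra. simpl. ring_simplify.
      rewrite (H' h) by lra. ring.
Qed.

(** The increment [h * g' h] is at most half of [p O] for small [h]. *)
Lemma jet_lower n p g : jet (S n) p g -> p O <> 0 ->
  exists d : R, (0 < d)%R /\ forall h, (0 < Cmod h < d)%R -> (Cmod (p O) / 2 <= Cmod (g h))%R.
Proof.
  intros (g' & Hg & e & He & H) Hp.
  destruct (jet_bounded _ _ _ Hg) as (K & d & Hd & HK).
  assert (Hp0 : (0 < Cmod (p O))%R) by now apply Cmod_gt_0.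
  assert (HK0 : (0 <= Rabs K)%R) by apply Rabs_pos.
  exists (Rmin (Rmin d e) (Cmod (p O) / (2 * (Rabs K + 1)))). split.
  { repeat apply Rmin_pos; auto. apply Rdiv_lt_0_compat; lra. }
  intros h Hh.
  assert (Cmod h < Rmin d e)%R by (eapply Rlt_le_trans; [apply Hh|apply Rmin_l]).
  assert (Cmod h < Cmod (p O) / (2 * (Rabs K + 1)))%R by (eapply Rlt_le_trans; [apply Hh|apply Rmin_r]).
  assert (Rmin d e <= d)%R by apply Rmin_l.
  assert (Rmin d e <= e)%R by apply Rmin_r.
  assert (B : (Cmod (g' h) <= Rabs K)%R).
  { eapply Rle_trans. apply HK; lra. apply Rle_abs. }
  assert (T : (Cmod (p O) <= Cmod (g h) + Cmod (- (h * g' h)))%R).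
  { replace (p O) with (g h + - (h * g' h)) by (rewrite H by lra; ring). apply Cmod_triangle. }
  rewrite Cmod_opp, Cmod_mult in T.
  assert (M : (Cmod h * Cmod (g' h) <= Cmod (p O) / (2 * (Rabs K + 1)) * (Rabs K+1))%R).
  { apply Rmult_le_compat; try apply Cmod_ge_0; lra. }
  replace (Cmod (p O) / (2 * (Rabs K + 1)) * (Rabs K+1))%R with (Cmod (p O) / 2)%R in M by (field; lra).
  lra.
Qed.

(** Induction on [1/g = 1/p0 + h * (- g' / (p0 g))]. *)
Lemma jet_inv n p g : jet (S n) p g -> p O <> 0 ->
  exists q, jet (S n) q (fun h => / g h) /\ q O = / p O.
Proof.
  revert p g; induction n as [|n IH]; intros p g Hg Hp;
    assert (Hp0 : (0 < Cmod (p O))%R) by (now apply Cmod_gt_0);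
    destruct (jet_lower _ _ _ Hg Hp) as (d & Hd & Hlow).
  - exists (cst (/ p O)). split; auto.
    destruct Hg as (g' & Hg & e & He & H).
    exists (fun h => - / p O * (g' h * / g h)). split.
    + apply (jet_scal 0 _ (cst 0)), (jet_mult 0 (cst 0) (cst 0)); auto.
      exists (/ (Cmod (p O) / 2))%R, d. split; auto. intros h Hh.
      specialize (Hlow h Hh).
      rewrite Cmod_inv by (apply Cmod_gt_0; lra). apply Rinv_le_contravar; lra.
    + exists (Rmin d e). split. now apply Rmin_pos. intros h Hh.
      assert (Rmin d e <= d)%R by apply Rmin_l.
      assert (Rmin d e <= e)%R by apply Rmin_r.
      assert (N : g h <> 0) by (apply Cmod_gt_0; specialize (Hlow h); lra).
      simpl. rewrite H in * by lra. field. auto.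
  - destruct (IH p g (jet_down _ _ _ Hg) Hp) as (q & Hq & _).
    destruct Hg as (g' & Hg & e & He & H).
    exists (fun k => match k with O => / p O | S k => - / p O * conv (fun k => p (S k)) q k end).
    split; auto.
    exists (fun h => - / p O * (g' h * / g h)). split.
    + apply (jet_scal (S n) (- / p O) (conv (fun k => p (S k)) q)). now apply jet_mult.
    + exists (Rmin d e). split. now apply Rmin_pos. intros h Hh.
      assert (Rmin d e <= d)%R by apply Rmin_l.
      assert (Rmin d e <= e)%R by apply Rmin_r.
      assert (N : g h <> 0) by (apply Cmod_gt_0; specialize (Hlow h); lra).
      rewrite H in * by lra. field. auto.
Qed.

Lemma small_le (x K d : R) : (0 <= x)%R -> (0 < d)%R ->
  (forall t : R, (0 < t < d)%R -> (x <= K * t)%R) -> x = 0%R.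
Proof.
  intros Hx Hd H. destruct (Rle_lt_or_eq_dec 0 x Hx) as [P|]; auto. exfalso.
  assert (HK : (0 <= Rabs K)%R) by apply Rabs_pos.
  set (t := Rmin (d / 2) (x / (2 * (Rabs K + 1)))).
  assert (t <= d/2)%R by apply Rmin_l. assert (t <= x / (2 * (Rabs K + 1)))%R by apply Rmin_r.
  assert (0 < t)%R. { apply Rmin_pos. lra. apply Rdiv_lt_0_compat; lra. }
  assert (H3 := H t ltac:(lra)). assert (K <= Rabs K)%R by apply Rle_abs.
  assert (K * t <= (Rabs K + 1) * (x / (2 * (Rabs K + 1))))%R.
  { apply Rle_trans with ((Rabs K + 1) * t)%R. apply Rmult_le_compat_r; lra.
    apply Rmult_le_compat_l; lra. }
  replace ((Rabs K + 1) * (x / (2 * (Rabs K + 1))))%R with (x/2)%R in H5 by (field; lra). lra.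
Qed.

Lemma Cmod_Rpos (t : R) : (0 <= t)%R -> Cmod (RtoC t) = t.
Proof. intros; rewrite Cmod_R; now apply Rabs_pos_eq. Qed.

Lemma Cminus_eq_0 (x y : C) : Cmod (x - y) = 0%R -> x = y.
Proof. intros H. apply Cmod_eq_0 in H. replace x with (x - y + y) by ring. rewrite H. ring. Qed.

(** The difference of two expansions is [O(t)] along [h = t], so the constant terms
    agree; divide by [h] and repeat. *)
Lemma jet_unique n p q f : jet n p f -> jet n q f -> forall k, (k < n)%nat -> p k = q k.
Proof.
  revert p q f; induction n as [|n IH]; intros p q f Hp Hq k Hk. lia.
  destruct Hp as (f' & Hf' & d & Hd & H). destruct Hq as (g' & Hg' & e & He & H').
  destruct (jet_bounded _ _ _ Hf') as (K & d1 & Hd1 & HK).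
  destruct (jet_bounded _ _ _ Hg') as (K' & e1 & He1 & HK').
  assert (E0 : p O = q O).
  { apply Cminus_eq_0. apply (small_le _ (K + K') (Rmin (Rmin d e) (Rmin d1 e1))).
    apply Cmod_ge_0. repeat apply Rmin_pos; auto.
    intros t Ht. assert (Ct : Cmod (RtoC t) = t) by (apply Cmod_Rpos; lra).
    assert (t < Rmin d e)%R by (eapply Rlt_le_trans; [apply Ht|apply Rmin_l]).
    assert (t < Rmin d1 e1)%R by (eapply Rlt_le_trans; [apply Ht|apply Rmin_r]).
    assert (Rmin d e <= d)%R by apply Rmin_l. assert (Rmin d e <= e)%R by apply Rmin_r.
    assert (Rmin d1 e1 <= d1)%R by apply Rmin_l. assert (Rmin d1 e1 <= e1)%R by apply Rmin_r.
    assert (E := H t ltac:(lra)). rewrite (H' t) in E by lra.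
    replace (p O - q O) with (RtoC t * (g' t + - f' t)).
    2:{ transitivity ((q O + RtoC t * g' t) - RtoC t * f' t - q O). ring. rewrite E. ring. }
    rewrite Cmod_mult, Ct, Rmult_comm. apply Rmult_le_compat_r. lra.
    eapply Rle_trans. apply Cmod_triangle. rewrite Cmod_opp, Rplus_comm.
    apply Rplus_le_compat; [apply HK|apply HK']; lra. }
  destruct k as [|k]; auto.
  apply (IH (fun k => p (S k)) (fun k => q (S k)) f'); [|  |lia]; auto.
  apply (jet_ext n (fun k => q (S k)) _ g' f' (Rmin d e)); auto. now apply Rmin_pos.
  intros h Hh. assert (Rmin d e <= d)%R by apply Rmin_l.
  assert (Rmin d e <= e)%R by apply Rmin_r.
  assert (h <> 0) by (apply Cmod_gt_0; lra).
  assert (E := H h ltac:(lra)). rewrite (H' h) in E by lra.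
  rewrite E0 in E. replace (g' h) with ((q O + h * g' h - q O) / h) by (field; auto).
  rewrite E. field; auto.
Qed.

(** * The maximum principle *)

(** Maximize in [y] for each [x]; by uniform continuity the partial maximum is
    continuous in [x]. *)
Lemma rectangle_max (f : R -> R -> R) (a b c d : R) : (a <= b)%R -> (c <= d)%R ->
  (forall x y, (a <= x <= b)%R -> (c <= y <= d)%R -> continuity_2d_pt f x y) ->
  exists x0 y0, (a <= x0 <= b)%R /\ (c <= y0 <= d)%R /\
    forall x y, (a <= x <= b)%R -> (c <= y <= d)%R -> (f x y <= f x0 y0)%R.
Proof.
  intros Hab Hcd Hf.
  set (cl := fun x => Rmax a (Rmin b x)).
  assert (Hcl : forall x, (a <= cl x <= b)%R).
  { intros x; unfold cl, Rmax, Rmin; repeat destruct Rle_dec; lra. }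
  assert (Hcl2 : forall x, (a <= x <= b)%R -> cl x = x).
  { intros x; unfold cl, Rmax, Rmin; repeat destruct Rle_dec; lra. }
  assert (Hcl3 : forall x y, (Rabs (cl x - cl y) <= Rabs (x - y))%R).
  { intros x y; unfold cl, Rmax, Rmin; repeat destruct Rle_dec;
      unfold Rabs; repeat destruct Rcase_abs; lra. }
  assert (Hy : forall x, exists y, (c <= y <= d)%R /\ forall y', (c <= y' <= d)%R -> (f (cl x) y' <= f (cl x) y)%R).
  { intros x. destruct (continuity_ab_maj (f (cl x)) c d Hcd) as (y & H1 & H2).
    - intros y Hy eps Heps.
      destruct (Hf (cl x) y (Hcl x) Hy (mkposreal eps Heps)) as (del & Hdel).
      exists del. split. apply cond_pos. intros v Hv. simpl. unfold R_dist.
      apply Hdel. rewrite Rminus_diag, Rabs_R0. apply cond_pos. apply Hv.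
    - exists y; split; auto. }
  destruct (choice _ Hy) as (my & Hmy).
  set (m := fun x => f (cl x) (my x)).
  destruct (continuity_ab_maj m a b Hab) as (x0 & H1 & H2).
  - intros x Hx eps Heps.
    assert (He2 : (0 < eps / 2)%R) by lra.
    destruct (uniform_continuity_2d f a b c d Hf (mkposreal _ He2)) as (del & Hdel).
    exists del. split. apply cond_pos. intros v [_ Hv]. simpl in *. unfold R_dist in *.
    assert (A1 := Hdel (cl x) (my x) (cl v) (my x) (Hcl x) (proj1 (Hmy x)) (Hcl v) (proj1 (Hmy x))).
    assert (A2 := Hdel (cl v) (my v) (cl x) (my v) (Hcl v) (proj1 (Hmy v)) (Hcl x) (proj1 (Hmy v))).
    rewrite Rminus_diag, Rabs_R0 in A1, A2.
    assert (B1 := Hcl3 v x). assert (B2 := Hcl3 x v). rewrite (Rabs_minus_sym x v) in B2.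
    specialize (A1 ltac:(lra) (cond_pos _)). specialize (A2 ltac:(lra) (cond_pos _)).
    apply Rabs_def2 in A1. apply Rabs_def2 in A2.
    assert (C1 := proj2 (Hmy v) (my x) (proj1 (Hmy x))).
    assert (C2 := proj2 (Hmy x) (my v) (proj1 (Hmy v))).
    unfold m. apply Rabs_def1; simpl in *; lra.
  - exists x0, (my x0). split; auto. split. apply (proj1 (Hmy x0)).
    intros x y Hx Hyy. apply Rle_trans with (m x).
    + unfold m. assert (H3 := proj2 (Hmy x) y Hyy). rewrite (Hcl2 x Hx) in *. exact H3.
    + replace (f x0 (my x0)) with (m x0). now apply H1. unfold m. now rewrite Hcl2.
Qed.

Definition continuous_at (F : C -> R) (z : C) : Prop :=
  forall eps : R, (0 < eps)%R -> exists d : R, (0 < d)%R /\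
    forall h : C, (Cmod h < d)%R -> (Rabs (F (z + h)%C - F z) < eps)%R.

Lemma Cmod_le_Rabs (x y : R) : (Cmod (x, y) <= Rabs x + Rabs y)%R.
Proof.
  replace (x, y)%R with (RtoC x + Ci * RtoC y).
  eapply Rle_trans. apply Cmod_triangle. rewrite Cmod_mult, !Cmod_R, Cmod_Ci. lra.
  unfold Ci, RtoC, Cplus, Cmult; simpl. f_equal; ring.
Qed.

Lemma Cmod_sqr (x y : R) : (Cmod (x, y) ^ 2 = x ^ 2 + y ^ 2)%R.
Proof. now rewrite Cmod2_alt. Qed.

(** The disc is the image of a rectangle under [(x, y) |-> x + i y sqrt (r^2 - x^2)]. *)
Lemma disc_max (F : C -> R) (r : R) : (0 <= r)%R ->
  (forall z, (Cmod z <= r)%R -> continuous_at F z) ->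
  exists z0, (Cmod z0 <= r)%R /\ forall z, (Cmod z <= r)%R -> (F z <= F z0)%R.
Proof.
  intros Hr HF.
  set (par := fun x y : R => (x, y * sqrt (r ^ 2 - x ^ 2))%R).
  assert (Hpar : forall x y, (-r <= x <= r)%R -> (-1 <= y <= 1)%R -> (Cmod (par x y) <= r)%R).
  { intros x y Hx Hy.
    apply Rsqr_incr_0_var; auto. rewrite !Rsqr_pow2. unfold par. rewrite Cmod_sqr.
    rewrite Rpow_mult_distr, pow2_sqrt by nra.
    assert (0 <= r ^ 2 - x ^ 2)%R by nra. assert (y ^ 2 <= 1)%R by nra. nra. }
  assert (Hsur : forall z, (Cmod z <= r)%R -> exists x y, (-r <= x <= r)%R /\ (-1 <= y <= 1)%R /\ z = par x y).
  { intros [x v] Hz.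
    assert (H2 : (x ^ 2 + v ^ 2 <= r ^ 2)%R).
    { rewrite <- Cmod_sqr. apply pow_incr. split; auto. apply Cmod_ge_0. }
    assert (Hx : (-r <= x <= r)%R).
    { assert (Hv := pow2_ge_0 v). split; [|nra]. apply Rnot_lt_le; intros HH. nra. }
    unfold par. set (s := sqrt (r ^ 2 - x ^ 2)).
    assert (Hs : (s ^ 2 = r ^ 2 - x ^ 2)%R).
    { unfold s. apply pow2_sqrt. nra. }
    assert (Hs0 : (0 <= s)%R) by apply sqrt_pos.
    destruct (Req_dec s 0) as [E|E].
    - exists x, 0%R. split; auto. split. lra. fold s. f_equal. rewrite E in Hs. nra.
    - exists x, (v / s)%R. split; auto. fold s. split.
      + assert (Hq : (v / s * s = v)%R) by (field; auto). set (q := (v / s)%R) in *.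
        assert (q ^ 2 * s ^ 2 <= s ^ 2)%R. { rewrite <- Rpow_mult_distr, Hq. lra. }
        assert (0 < s ^ 2)%R by nra. assert (q ^ 2 <= 1)%R by nra. nra.
      + f_equal. field; auto. }
  destruct (rectangle_max (fun x y => F (par x y)) (-r) r (-1) 1) as (x0 & y0 & Hx & Hy & H); try lra.
  - intros x y Hx Hy eps.
    destruct (HF (par x y) (Hpar x y Hx Hy) eps (cond_pos eps)) as (d & Hd & Hc).
    assert (Hs : continuity_2d_pt (fun u v => v * sqrt (r ^ 2 - u ^ 2))%R x y).
    { apply continuity_2d_pt_mult. apply continuity_2d_pt_id2.
      apply (continuity_1d_2d_pt_comp (fun u => sqrt (r ^ 2 - u ^ 2)) (fun u v => u) x y).
      2: apply continuity_2d_pt_id1.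
      apply continuity_pt_filterlim.
      apply (continuous_comp (fun u => r ^ 2 - u ^ 2)%R sqrt).
      - apply (continuous_minus (V := R_NormedModule) (fun _ => r ^ 2)%R (fun u => u ^ 2)%R).
        apply continuous_const.
        apply (ex_derive_continuous (fun u => u ^ 2)%R). auto_derive. auto.
      - apply continuous_sqrt. }
    assert (Hd2 : (0 < d / 2)%R) by lra.
    destruct (Hs (mkposreal _ Hd2)) as (d1 & Hd1). simpl in Hd1.
    assert (Hm : (0 < Rmin (d / 2) d1)%R). { apply Rmin_pos; auto. apply cond_pos. }
    exists (mkposreal _ Hm). intros u v Hu Hv. simpl in Hu, Hv.
    assert (Rmin (d / 2) d1 <= d / 2)%R by apply Rmin_l.
    assert (Rmin (d / 2) d1 <= d1)%R by apply Rmin_r.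
    replace (par u v) with (par x y + (par u v - par x y)) by ring.
    apply Hc. specialize (Hd1 u v ltac:(lra) ltac:(lra)).
    unfold par in *. unfold Cminus, Cplus, Copp; simpl.
    eapply Rle_lt_trans. apply Cmod_le_Rabs. unfold Rminus in *. simpl in *. lra.
  - exists (par x0 y0). split. now apply Hpar. intros z Hz.
    destruct (Hsur z Hz) as (x & y & Hx' & Hy' & ->). now apply H.
Qed.

(** An error of third order is what the four-point averaging argument needs:
    the gain [eps t^2] has to dominate it. *)
Definition smooth_at (g : C -> C) (z : C) : Prop :=
  exists p, jet 3 p (fun h => g (z + h)%C) /\ g z = p O.

Lemma smooth_expand g z : smooth_at g z -> exists b0 b1 b2 K d, (0 < d <= 1)%R /\ (0 <= K)%R /\ g z = b0 /\
  forall h, (Cmod h < d)%R -> exists e, (Cmod e <= K * Cmod h ^ 3)%R /\ g (z + h)%C = b0 + b1 * h + b2 * h ^ 2 + e.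
Proof.
  intros (p & (g1 & (g2 & (g3 & (K & d3 & Hd3 & H3) & d2 & Hd2 & H2) & d1 & Hd1 & H1) & d0 & Hd0 & H0) & E).
  exists (p 0%nat), (p 1%nat), (p 2%nat), (Rabs K), (Rmin (Rmin d3 d2) (Rmin 1 (Rmin d1 d0))).
  set (A := Rmin d3 d2). set (B := Rmin d1 d0). set (D := Rmin 1 B).
  assert (A <= d3)%R by apply Rmin_l. assert (A <= d2)%R by apply Rmin_r.
  assert (B <= d1)%R by apply Rmin_l. assert (B <= d0)%R by apply Rmin_r.
  assert (D <= 1)%R by apply Rmin_l. assert (D <= B)%R by apply Rmin_r.
  assert (Rmin A D <= A)%R by apply Rmin_l. assert (Rmin A D <= D)%R by apply Rmin_r.
  split; [split|split; [|split]]; auto; try lra.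
  - unfold A, D, B; repeat apply Rmin_pos; auto; lra.
  - apply Rabs_pos.
  - intros h Hh. destruct (Req_dec (Cmod h) 0) as [Z|Z].
    + apply Cmod_eq_0 in Z. subst h. exists 0. split.
      rewrite Cmod_0. simpl. rewrite Rmult_0_l, Rmult_0_r. lra.
      replace (z + 0) with z by ring. rewrite E. ring.
    + assert (0 < Cmod h)%R. { assert (0 <= Cmod h)%R by apply Cmod_ge_0. lra. }
      exists (h ^ 3 * g3 h). split.
      * rewrite Cmod_mult, Cmod_pow, Rmult_comm. apply Rmult_le_compat_r.
        apply pow_le; lra. eapply Rle_trans. apply H3; lra. apply Rle_abs.
      * rewrite H0, H1, H2 by lra. ring.
Qed.

Lemma smooth_continuous g z : smooth_at g z -> exists K d, (0 < d)%R /\ (0 <= K)%R /\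
  forall h, (Cmod h < d)%R -> (Cmod (g (z + h)%C - g z) <= K * Cmod h)%R.
Proof.
  intros H. destruct (smooth_expand g z H) as (b0 & b1 & b2 & K & d & Hd & HK & E & Hex).
  exists (Cmod b1 + Cmod b2 + K)%R, d. split; [lra|split].
  - assert (X := Cmod_ge_0 b1). assert (Y := Cmod_ge_0 b2). lra.
  - intros h Hh. destruct (Hex h Hh) as (e & He & ->). rewrite E.
    replace (b0 + b1 * h + b2 * h ^ 2 + e - b0) with (b1 * h + (b2 * h ^ 2 + e)) by ring.
    assert (X := Cmod_ge_0 h).
    eapply Rle_trans. apply Cmod_triangle. rewrite Cmod_mult.
    assert (Cmod (b2 * h ^ 2 + e) <= Cmod b2 * Cmod h + K * Cmod h)%R.
    { eapply Rle_trans. apply Cmod_triangle. rewrite Cmod_mult, Cmod_pow.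
      assert (Y := Cmod_ge_0 b2). apply Rplus_le_compat.
      apply Rmult_le_compat_l; auto. nra.
      eapply Rle_trans. apply He. apply Rmult_le_compat_l; auto. nra. }
    lra.
Qed.

(** [|g|^2 + eps |z|^2] has no local maximum: the average of [|g|^2] over the
    four points [z +- t], [z +- i t] is at least [|g z|^2 - O(t^3)], that of
    [eps |z|^2] grows by [eps t^2]. *)
Lemma smooth_increase g z eps delta : smooth_at g z -> (0 < eps)%R -> (0 < delta)%R ->
  exists h, (Cmod h < delta)%R /\
   (Cmod (g z) ^ 2 + eps * Cmod z ^ 2 < Cmod (g (z + h)%C) ^ 2 + eps * Cmod (z + h) ^ 2)%R.
Proof.
  intros Hg Heps Hdel. destruct (smooth_expand g z Hg) as (b0 & b1 & b2 & K & d & Hd & HK & E & Hex).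
  apply NNPP. intros Hno.
  assert (Hle : forall h, (Cmod h < delta)%R -> (Cmod (g (z + h)%C) ^ 2 + eps * Cmod (z + h) ^ 2 <= Cmod (g z) ^ 2 + eps * Cmod z ^ 2)%R).
  { intros h Hh. apply Rnot_lt_le. intros Hlt. apply Hno. exists h; auto. }
  set (P := fun h => b0 + b1 * h + b2 * h ^ 2).
  set (S := (Cmod b0 + Cmod b1 + Cmod b2)%R).
  assert (S0 := Cmod_ge_0 b0). assert (S1 := Cmod_ge_0 b1). assert (S2 := Cmod_ge_0 b2).
  assert (HSK : (0 <= S * K)%R) by (unfold S; apply Rmult_le_pos; lra).
  set (t := Rmin (Rmin (d / 2) (delta / 2)) (eps / (2 * (2 * S * K + 1)))).
  assert (T1 : (t <= eps / (2 * (2 * S * K + 1)))%R) by apply Rmin_r.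
  assert (T2 : (t <= Rmin (d / 2) (delta / 2))%R) by apply Rmin_l.
  assert (T3 : (Rmin (d / 2) (delta / 2) <= d / 2)%R) by apply Rmin_l.
  assert (T4 : (Rmin (d / 2) (delta / 2) <= delta / 2)%R) by apply Rmin_r.
  assert (T0 : (0 < t)%R). { unfold t; repeat apply Rmin_pos; try lra. apply Rdiv_lt_0_compat; nra. }
  assert (T5 : (2 * S * K * t < eps)%R).
  { assert (t * (2 * (2 * S * K + 1)) <= eps)%R.
    { apply Rle_trans with (eps / (2 * (2 * S * K + 1)) * (2 * (2 * S * K + 1)))%R.
      apply Rmult_le_compat_r; nra. right. field. nra. }
    nra. }
  assert (Hlow : forall h, Cmod h = t -> (Cmod (P h) ^ 2 - 2 * S * K * t ^ 3 <= Cmod (g (z + h)%C) ^ 2)%R).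
  { intros h Hh. destruct (Hex h ltac:(lra)) as (e & He & Eg). fold (P h) in Eg.
    assert (HP : (Cmod (P h) <= S)%R).
    { unfold P, S. eapply Rle_trans. apply Cmod_triangle.
      apply Rplus_le_compat. eapply Rle_trans. apply Cmod_triangle. apply Rplus_le_compat_l.
      rewrite Cmod_mult, Hh. nra.
      rewrite Cmod_mult, Cmod_pow, Hh. rewrite <- (Rmult_1_r (Cmod b2)) at 2.
      apply Rmult_le_compat_l; auto. nra. }
    assert (HT : (Cmod (P h) <= Cmod (g (z + h)%C) + Cmod e)%R).
    { replace (P h) with (g (z + h)%C + - e) by (rewrite Eg; ring).
      rewrite <- (Cmod_opp e). apply Cmod_triangle. }
    rewrite Hh in He. assert (G0 := Cmod_ge_0 (g (z + h)%C)). assert (G1 := Cmod_ge_0 (P h)). assert (G2 := Cmod_ge_0 e).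
    assert (Cmod (P h) * Cmod e <= S * (K * t ^ 3))%R.
    { apply Rmult_le_compat; auto. }
    destruct (Rle_dec (Cmod e) (Cmod (P h))) as [L|L].
    - assert ((Cmod (P h) - Cmod e) ^ 2 <= Cmod (g (z + h)%C) ^ 2)%R.
      { apply pow_incr. lra. }
      nra.
    - assert (Cmod (P h) ^ 2 <= Cmod (P h) * Cmod e)%R by nra.
      assert (0 <= Cmod (g (z + h)%C) ^ 2)%R by apply pow2_ge_0.
      assert (0 <= S * K * t ^ 3)%R. { apply Rmult_le_pos; auto. apply pow_le; lra. }
      lra. }
  assert (C1 : Cmod (RtoC t) = t) by (apply Cmod_Rpos; lra).
  assert (C2 : Cmod (- RtoC t) = t) by (rewrite Cmod_opp; auto).
  assert (C3 : Cmod (Ci * RtoC t) = t) by (rewrite Cmod_mult, Cmod_Ci, C1; ring).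
  assert (C4 : Cmod (- (Ci * RtoC t)) = t) by (rewrite Cmod_opp; auto).
  assert (L1 := Hlow _ C1). assert (L2 := Hlow _ C2). assert (L3 := Hlow _ C3). assert (L4 := Hlow _ C4).
  assert (M1 := Hle (RtoC t) ltac:(lra)). assert (M2 := Hle (- RtoC t) ltac:(lra)).
  assert (M3 := Hle (Ci * RtoC t) ltac:(lra)). assert (M4 := Hle (- (Ci * RtoC t)) ltac:(lra)).
  (* Parseval for the fourth roots of unity: the cross terms cancel. *)
  assert (Q : (Cmod (P (RtoC t)) ^ 2 + Cmod (P (- RtoC t)%C) ^ 2 + Cmod (P (Ci * RtoC t)%C) ^ 2 + Cmod (P (- (Ci * RtoC t))%C) ^ 2 =
     4 * (Cmod b0 ^ 2 + Cmod b1 ^ 2 * t ^ 2 + Cmod b2 ^ 2 * t ^ 4))%R).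
  { unfold P. rewrite !Cmod2_alt. destruct b0, b1, b2. simpl. ring. }
  assert (Q2 : (Cmod (z + RtoC t) ^ 2 + Cmod (z + - RtoC t) ^ 2 + Cmod (z + Ci * RtoC t) ^ 2 + Cmod (z + - (Ci * RtoC t)) ^ 2 =
     4 * (Cmod z ^ 2 + t ^ 2))%R).
  { rewrite !Cmod2_alt. destruct z. simpl. ring. }
  rewrite E in *.
  assert (0 <= Cmod b1 ^ 2 * t ^ 2)%R by (apply Rmult_le_pos; apply pow2_ge_0).
  assert (0 <= Cmod b2 ^ 2 * t ^ 4)%R. { apply Rmult_le_pos. apply pow2_ge_0. apply pow_le; lra. }
  assert (2 * S * K * t ^ 3 < eps * t ^ 2)%R.
  { replace (2 * S * K * t ^ 3)%R with (2 * S * K * t * t ^ 2)%R by ring.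
    apply Rmult_lt_compat_r; auto. apply pow_lt; auto. }
  nra.
Qed.

(** With [eps] so small that [eps r^2] is below the gap, the maximum of
    [|g|^2 + eps |z|^2] on the closed disc would be interior. *)
Lemma max_principle g r K : (0 <= r)%R -> (0 <= K)%R ->
  (forall z, (Cmod z <= r)%R -> smooth_at g z) ->
  (forall z, Cmod z = r -> (Cmod (g z) <= K)%R) ->
  forall z, (Cmod z <= r)%R -> (Cmod (g z) <= K)%R.
Proof.
  intros Hr HK Hg Hb z0 Hz0. apply Rnot_lt_le. intros Hlt.
  set (gap := (Cmod (g z0) ^ 2 - K ^ 2)%R).
  assert (Hgap : (0 < gap)%R) by (unfold gap; nra).
  set (eps := (gap / (2 * (r ^ 2 + 1)))%R).
  assert (Hr2 := pow2_ge_0 r).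
  assert (Heps : (0 < eps)%R) by (apply Rdiv_lt_0_compat; lra).
  assert (Heps2 : (eps * r ^ 2 < gap)%R).
  { assert (eps * (2 * (r ^ 2 + 1)) = gap)%R by (unfold eps; field; lra). nra. }
  set (F := fun z => (Cmod (g z) ^ 2 + eps * Cmod z ^ 2)%R).
  destruct (disc_max F r Hr) as (z1 & Hz1 & Hmax).
  - intros z Hz e He.
    destruct (smooth_continuous g z (Hg z Hz)) as (L & d & Hd & HL & Hc).
    set (A := (2 * Cmod (g z) + L)%R). set (B := (2 * Cmod z + 1)%R).
    assert (G0 := Cmod_ge_0 (g z)). assert (Z0 := Cmod_ge_0 z).
    set (M := (L * A + eps * B + 1)%R).
    assert (HA : (0 <= A)%R) by (unfold A; lra). assert (HB : (0 <= B)%R) by (unfold B; lra).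
    assert (HM : (0 < M)%R). { unfold M. nra. }
    exists (Rmin (Rmin d 1) (e / M)). split.
    { repeat apply Rmin_pos; try lra. now apply Rdiv_lt_0_compat. }
    intros h Hh.
    assert (U1 : (Cmod h < Rmin d 1)%R) by (eapply Rlt_le_trans; [apply Hh|apply Rmin_l]).
    assert (U2 : (Cmod h < e / M)%R) by (eapply Rlt_le_trans; [apply Hh|apply Rmin_r]).
    assert (U3 := Rmin_l d 1). assert (U4 := Rmin_r d 1).
    specialize (Hc h ltac:(lra)). assert (H0 := Cmod_ge_0 h).
    assert (sqd : forall x y : C, (Rabs (Cmod x ^ 2 - Cmod y ^ 2) <= Cmod (x - y) * (2 * Cmod y + Cmod (x - y)))%R).
    { intros x y. assert (V1 : (Cmod x <= Cmod y + Cmod (x - y))%R).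
      { replace x with (y + (x - y)) at 1 by ring. apply Cmod_triangle. }
      assert (V2 : (Cmod y <= Cmod x + Cmod (x - y))%R).
      { replace y with (x + - (x - y)) at 1 by ring. rewrite <- (Cmod_opp (x - y)). apply Cmod_triangle. }
      assert (X0 := Cmod_ge_0 x). assert (Y0 := Cmod_ge_0 y). assert (XY := Cmod_ge_0 (x - y)).
      apply Rabs_le. split; nra. }
    assert (W1 := sqd (g (z + h)%C) (g z)). assert (W2 := sqd (z + h) z).
    replace (z + h - z) with h in W2 by ring.
    assert (W3 : (Cmod (g (z + h)%C - g z) * (2 * Cmod (g z) + Cmod (g (z + h)%C - g z)) <= (L * Cmod h) * A)%R).
    { apply Rmult_le_compat; try apply Cmod_ge_0; auto.
      assert (X := Cmod_ge_0 (g (z + h)%C - g z)). lra. unfold A. nra. }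
    assert (W4 : (Cmod h * (2 * Cmod z + Cmod h) <= Cmod h * B)%R).
    { apply Rmult_le_compat_l; auto. unfold B; lra. }
    unfold F.
    replace (Cmod (g (z + h)%C) ^ 2 + eps * Cmod (z + h) ^ 2 - (Cmod (g z) ^ 2 + eps * Cmod z ^ 2))%R
      with ((Cmod (g (z + h)%C) ^ 2 - Cmod (g z) ^ 2) + eps * (Cmod (z + h) ^ 2 - Cmod z ^ 2))%R by ring.
    eapply Rle_lt_trans. apply Rabs_triang. rewrite Rabs_mult, (Rabs_pos_eq eps) by lra.
    assert (W5 : (eps * Rabs (Cmod (z + h) ^ 2 - Cmod z ^ 2) <= eps * (Cmod h * B))%R).
    { apply Rmult_le_compat_l; lra. }
    assert (W6 : (Cmod h * M < e)%R).
    { apply Rlt_le_trans with (e / M * M)%R. apply Rmult_lt_compat_r; auto. right; field; lra. }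
    unfold M in W6. nra.
  - assert (H1 := Hmax z0 Hz0). unfold F in H1.
    assert (Z0 : (0 <= eps * Cmod z0 ^ 2)%R). { apply Rmult_le_pos. lra. apply pow2_ge_0. }
    assert (Hin : (Cmod z1 < r)%R).
    { destruct Hz1 as [|Heq]; auto. exfalso. specialize (Hb z1 Heq). rewrite Heq in H1.
      assert (Cmod (g z1) ^ 2 <= K ^ 2)%R by (apply pow_incr; split; auto; apply Cmod_ge_0).
      unfold gap in *. lra. }
    destruct (smooth_increase g z1 eps (r - Cmod z1)) as (h & Hh & Hi); auto. lra.
    assert (H2 := Hmax (z1 + h)). unfold F in H2.
    assert (Cmod (z1 + h) <= r)%R. { eapply Rle_trans. apply Cmod_triangle. lra. }
    specialize (H2 H). lra.
Qed.

(** * The Schur algorithm *)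

Lemma smooth_of_jet n p g : (3 <= n)%nat -> jet n p g -> g 0 = p O -> smooth_at g 0.
Proof.
  intros Hn H E. exists p. split; auto. apply (jet_le 3) in H; auto.
  apply (jet_ext 3 p p g _ 1); auto. lra. intros h _. now rewrite Cplus_0_l.
Qed.

Lemma smooth_ext g h z d : (0 < d)%R -> (forall k, (Cmod k < d)%R -> g (z + k) = h (z + k)) ->
  smooth_at g z -> smooth_at h z.
Proof.
  intros Hd E (p & H & H0). exists p. split.
  - apply (jet_ext 3 p p (fun k => g (z + k)) _ d); auto. intros k Hk; apply E; lra.
  - rewrite <- H0. specialize (E 0). rewrite Cplus_0_r in E. symmetry; apply E. now rewrite Cmod_0.
Qed.

Lemma smooth_const c z : smooth_at (fun _ => c) z.
Proof. exists (cst c). split; auto. apply jet_const. Qed.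

Lemma smooth_plus f g z : smooth_at f z -> smooth_at g z -> smooth_at (fun x => f x + g x) z.
Proof.
  intros (p & H & E) (q & H' & E'). exists (fun k => p k + q k). split.
  - now apply (jet_plus 3 p q (fun h => f (z + h)) (fun h => g (z + h))).
  - now rewrite E, E'.
Qed.

Lemma smooth_mult f g z : smooth_at f z -> smooth_at g z -> smooth_at (fun x => f x * g x) z.
Proof.
  intros (p & H & E) (q & H' & E'). exists (conv p q). split.
  - now apply (jet_mult 3 p q (fun h => f (z + h)) (fun h => g (z + h))).
  - simpl. now rewrite E, E'.
Qed.

Lemma smooth_inv f z : smooth_at f z -> f z <> 0 -> smooth_at (fun x => / f x) z.
Proof.
  intros (p & H & E) N. rewrite E in N.
  destruct (jet_inv 2 p (fun h => f (z + h)) H N) as (q & Hq & E').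
  exists q. split; auto. now rewrite E, E'.
Qed.

Lemma smooth_id z : smooth_at (fun x => x) z.
Proof.
  exists (fun k => cst z k + shift (cst 1) k). split.
  - apply (jet_plus 3 (cst z) (shift (cst 1)) (fun _ => z) (fun h => h)).
    apply jet_const. apply jet_id.
  - simpl. ring.
Qed.

Definition smooth_on_disc (g : C -> C) : Prop := forall z, in_disc z -> smooth_at g z.

(** The maximum principle on [|z| = r] gives the bound [1 / r]; let [r] tend to 1. *)
Lemma schwarz_bound h : smooth_on_disc h ->
  (forall z, in_disc z -> z <> 0 -> (Cmod z * Cmod (h z) <= 1)%R) ->
  forall z, in_disc z -> (Cmod (h z) <= 1)%R.
Proof.
  intros Hh Hb z Hz. unfold in_disc in *. apply Rnot_lt_le. intros Hlt.
  assert (Z0 := Cmod_ge_0 z). set (m := Cmod (h z)) in *.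
  assert (Hi : (0 < / m < 1)%R).
  { split. apply Rinv_0_lt_compat; lra. rewrite <- Rinv_1. apply Rinv_lt_contravar; lra. }
  set (s := Rmax (/ m) (Cmod z)).
  assert (s < 1)%R by (unfold s; apply Rmax_lub_lt; lra).
  assert (/ m <= s)%R by apply Rmax_l. assert (Cmod z <= s)%R by apply Rmax_r.
  set (r := ((1 + s) / 2)%R).
  assert (Hr : (0 < r < 1)%R /\ (Cmod z <= r)%R /\ (/ m < 1)%R) by (unfold r; lra).
  assert (Hm : (m <= / r)%R).
  {
    apply (max_principle h r (/ r)); try lra.
    - left. apply Rinv_0_lt_compat; lra.
    - intros y Hy. apply Hh. unfold in_disc. lra.
    - intros y Hy. assert (y <> 0) by (apply Cmod_gt_0; lra).
      specialize (Hb y ltac:(lra) H2). rewrite Hy in Hb.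
      apply Rmult_le_reg_l with r. lra. rewrite Rinv_r by lra. lra. }
  assert (m * r <= 1)%R.
  { apply Rle_trans with (/ r * r)%R. apply Rmult_le_compat_r; lra. rewrite Rinv_l; lra. }
  assert (1 <= m * s)%R.
  { apply Rle_trans with (m * / m)%R. rewrite Rinv_r; lra. apply Rmult_le_compat_l; lra. }
  unfold r in *. nra.
Qed.

(** The quotients of the Schur algorithm are only given off the origin; [v] is the
    value that makes them smooth there. *)
Definition fill (v : C) (h : C -> C) (z : C) : C :=
  if excluded_middle_informative (z = 0) then v else h z.

Lemma fill_0 v h : fill v h 0 = v.
Proof. unfold fill. destruct excluded_middle_informative; [reflexivity|congruence]. Qed.

Lemma fill_n0 v h (z : C) : z <> 0 -> fill v h z = h z.
Proof. intros H. unfold fill. destruct excluded_middle_informative; [contradiction|reflexivity]. Qed.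

Lemma fill_jet n p h : jet n p h -> jet n p (fill (p O) h).
Proof.
  apply (jet_ext n p p h _ 1); auto. lra. intros k Hk.
  rewrite fill_n0; auto. apply Cmod_gt_0; lra.
Qed.

Lemma fill_smooth n p h : (3 <= n)%nat -> jet n p h ->
  (forall z, in_disc z -> z <> 0 -> smooth_at h z) -> smooth_on_disc (fill (p O) h).
Proof.
  intros Hn Hj Hh z Hz. destruct (excluded_middle_informative (z = 0)) as [->|N].
  - apply (smooth_of_jet n p); auto. now apply fill_jet. apply fill_0.
  - apply (smooth_ext h _ z (Cmod z)); auto. now apply Cmod_gt_0.
    intros k Hk. rewrite fill_n0; auto. intros E.
    assert (k = - z). { transitivity (z + k - z). ring. rewrite E. ring. }
    subst k. rewrite Cmod_opp in Hk. lra.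
Qed.

Lemma moebius_bound (x y : C) : (Cmod x <= 1)%R -> (Cmod y <= 1)%R ->
  (Cmod (x - y) <= Cmod (1 - Cconj y * x))%R.
Proof.
  intros Hx Hy.
  assert (Hx2 : (Cmod x ^ 2 <= 1)%R) by (assert (X := Cmod_ge_0 x); nra).
  assert (Hy2 : (Cmod y ^ 2 <= 1)%R) by (assert (X := Cmod_ge_0 y); nra).
  apply Rsqr_incr_0_var; [|apply Cmod_ge_0]. rewrite !Rsqr_pow2.
  assert (E : (Cmod (1 - Cconj y * x) ^ 2 - Cmod (x - y) ^ 2 = (1 - Cmod x ^ 2) * (1 - Cmod y ^ 2))%R).
  { rewrite !Cmod2_alt. destruct x, y; simpl. ring. }
  assert (0 <= (1 - Cmod x ^ 2) * (1 - Cmod y ^ 2))%R by (apply Rmult_le_pos; lra).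
  lra.
Qed.

Lemma one_minus_neq (x y : C) k : (k < 1)%R -> (Cmod x <= k)%R -> (Cmod y <= k)%R -> 1 - Cconj y * x <> 0.
Proof.
  intros Hk Hx Hy E. assert (X := Cmod_ge_0 x). assert (Y := Cmod_ge_0 y).
  assert (E1 : (Cmod 1 = Cmod y * Cmod x)%R).
  { rewrite <- (Cmod_conj y), <- Cmod_mult. f_equal.
    replace (Cconj y * x) with (1 - (1 - Cconj y * x)) by ring. rewrite E. ring. }
  rewrite Cmod_1 in E1. nra.
Qed.

(** The Schur quotient [h = (g - g 0) / (z (1 - conj (g 0) g))] is again bounded by 1,
    and the relation [g - g 0 = z h (1 - conj (g 0) g)] expresses the coefficients of
    [g] through those of [h]. *)
Lemma schur_step g p n k : (3 <= n)%nat -> (k < 1)%R -> smooth_on_disc g -> jet (S n) p g -> g 0 = p O ->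
  (forall z, in_disc z -> (Cmod (g z) <= k)%R) ->
  exists h s, smooth_on_disc h /\ jet n s h /\ h 0 = s O /\
    (forall z, in_disc z -> (Cmod (h z) <= 1)%R) /\
    p 1%nat = s O * (1 - Cconj (p O) * p O) /\
    p 2%nat = s 1%nat * (1 - Cconj (p O) * p O) - Cconj (p O) * s O * p 1%nat.
Proof.
  intros Hn Hk Hg Hj E0 Hb.
  assert (D0 : in_disc 0) by (unfold in_disc; rewrite Cmod_0; lra).
  assert (Hp0 : (Cmod (p O) <= k)%R) by (rewrite <- E0; now apply Hb).
  assert (Hden : forall z, in_disc z -> 1 - Cconj (p O) * g z <> 0).
  { intros z Hz. apply (one_minus_neq _ _ k); auto. }
  set (den := fun z => 1 + - Cconj (p O) * g z).
  assert (Hden' : forall z, in_disc z -> den z <> 0).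
  { intros z Hz. unfold den. replace (1 + - Cconj (p O) * g z) with (1 - Cconj (p O) * g z) by ring. auto. }
  set (dp := fun k => cst 1 k + - Cconj (p O) * p k).
  assert (Jd : jet n dp den).
  { apply (jet_plus n (cst 1) (fun k => - Cconj (p O) * p k)).
    apply jet_const. apply jet_scal. now apply jet_down. }
  assert (Hd0 : dp O <> 0).
  { unfold dp. simpl. specialize (Hden' 0 D0). unfold den in Hden'. now rewrite E0 in Hden'. }
  destruct n as [|n]; [lia|].
  destruct (jet_inv n dp den Jd Hd0) as (q & Jq & Eq).
  assert (Jg := Hj).
  destruct Hj as (g' & Jg' & d & Hd & Eg).
  set (s := conv (fun k => p (S k)) q).
  set (h0 := fun z => (g z + - p O) * / z * / den z).
  assert (Jh : jet (S n) s h0).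
  { apply (jet_ext (S n) s s (fun z => g' z * / den z) _ (Rmin d 1)); auto.
    - apply Rmin_pos; lra.
    - intros z Hz. assert (Rmin d 1 <= d)%R by apply Rmin_l. assert (Rmin d 1 <= 1)%R by apply Rmin_r.
      unfold h0. rewrite (Eg z) by lra. field. split. apply Hden'. unfold in_disc; lra.
      apply Cmod_gt_0; lra.
    - now apply jet_mult. }
  exists (fill (s O) h0), s.
  assert (Hh : smooth_on_disc (fill (s O) h0)).
  { apply (fill_smooth (S n)); auto. intros z Hz Nz. unfold h0.
    apply smooth_mult. apply smooth_mult. apply smooth_plus; auto. apply smooth_const.
    apply smooth_inv; auto. apply smooth_id. apply smooth_inv; auto.
    unfold den. apply smooth_plus. apply smooth_const. apply smooth_mult; auto. apply smooth_const. }
  assert (Jh' := fill_jet _ _ _ Jh).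
  assert (U : forall j, (j < S n)%nat ->
     (fun k => p k + cst (- p O) k) j = shift (conv s dp) j).
  { apply (jet_unique (S n) _ _ (fun z => g z + - p O)).
    - apply (jet_plus (S n) p (cst (- p O))). now apply jet_down. apply jet_const.
    - apply (jet_ext (S n) (shift (conv s dp)) _ (fun z => z * (h0 z * den z)) _ 1); auto. lra.
      + intros z Hz. unfold h0. field. split. apply Hden'. unfold in_disc; lra. apply Cmod_gt_0; lra.
      + apply jet_down, jet_shift, jet_mult; auto. }
  split; auto. split; auto. split. apply fill_0. split; [|split].
  - apply schwarz_bound; auto. intros z Hz Nz. rewrite fill_n0 by auto. unfold h0.
    assert (P1 : (0 < Cmod z)%R) by now apply Cmod_gt_0.
    assert (P2 : (0 < Cmod (den z))%R) by (apply Cmod_gt_0; auto).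
    rewrite !Cmod_mult, !Cmod_inv by auto.
    replace (Cmod z * (Cmod (g z + - p O) * / Cmod z * / Cmod (den z)))%R with
      (Cmod (g z + - p O) * / Cmod (den z))%R by (field; lra).
    apply Rmult_le_reg_r with (Cmod (den z)); auto.
    rewrite Rmult_assoc, Rinv_l, Rmult_1_l, Rmult_1_r by lra.
    unfold den. replace (1 + - Cconj (p O) * g z) with (1 - Cconj (p O) * g z) by ring.
    apply moebius_bound. specialize (Hb z Hz). lra. lra.
  - specialize (U 1%nat ltac:(lia)). unfold dp in U. simpl in U. simpl.
    rewrite Cplus_0_r in U. rewrite U. simpl. ring.
  - assert (U2 := U 2%nat ltac:(lia)). unfold dp in U2. cbn [shift conv cst] in U2.
    rewrite !Cplus_0_r, Cplus_0_l in U2. rewrite U2. ring.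
Qed.

(** Schwarz--Pick at the origin: the next Schur quotient is at most 1 at the
    origin. That quotient is only defined for a bound [t < 1], hence the scaling by
    [t] and the limit [t -> 1], which also covers [|p 0| = 1]. *)
Lemma schwarz_pick g p n : (4 <= n)%nat -> smooth_on_disc g -> jet n p g -> g 0 = p O ->
  (forall z, in_disc z -> (Cmod (g z) <= 1)%R) -> (Cmod (p 1%nat) <= 1 - Cmod (p O) ^ 2)%R.
Proof.
  intros Hn Hg Hj E0 Hb.
  assert (D0 : in_disc 0) by (unfold in_disc; rewrite Cmod_0; lra).
  assert (Ht : forall t : R, (0 < t < 1)%R -> (t * Cmod (p 1%nat) <= 1 - t ^ 2 * Cmod (p O) ^ 2)%R).
  { intros t Ht. destruct n as [|n]; [lia|].
    assert (Ct : Cmod (RtoC t) = t) by (apply Cmod_Rpos; lra).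
    destruct (schur_step (fun z => RtoC t * g z) (fun k => RtoC t * p k) n t) as (h & s & _ & _ & H0 & Hs & E & _); try lia; try lra.
    - intros z Hz. apply smooth_mult; auto. apply smooth_const.
    - now apply jet_scal.
    - now rewrite E0.
    - intros z Hz. rewrite Cmod_mult, Ct. specialize (Hb z Hz). nra.
    - specialize (Hs 0 D0). rewrite H0 in Hs.
      assert (E2 : 1 - Cconj (RtoC t * p O) * (RtoC t * p O) = RtoC (1 - t ^ 2 * Cmod (p O) ^ 2)).
      { rewrite Cmod2_alt. destruct (p O) as [x y]. unfold RtoC, Cconj, Cminus, Cplus, Copp, Cmult; simpl. f_equal; ring. }
      assert (P0 : (Cmod (p O) <= 1)%R) by (rewrite <- E0; now apply Hb).
      assert (P1 := Cmod_ge_0 (p O)).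
      assert (H : (0 <= 1 - t ^ 2 * Cmod (p O) ^ 2)%R).
      { assert (t ^ 2 <= 1)%R by nra. assert (0 <= t ^ 2)%R by nra. assert (Cmod (p O) ^ 2 <= 1)%R by nra. nra. }
      apply (f_equal Cmod) in E. rewrite E2, !Cmod_mult, Ct, (Cmod_Rpos _ H) in E.
      rewrite E. assert (S0 := Cmod_ge_0 (s O)). nra. }
  assert (P1 := Cmod_ge_0 (p 1%nat)). assert (P0 := Cmod_ge_0 (p O)).
  apply Rnot_lt_le. intros Hlt.
  set (x := Cmod (p 1%nat)) in *. set (y := Cmod (p O)) in *.
  set (D := (x - (1 - y ^ 2))%R).
  set (K := (x + 2 * y ^ 2 + 1)%R).
  assert (HK : (0 < K)%R) by (unfold K; nra).
  set (e := Rmin (1/2) (D / (2 * K))).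
  assert (e <= 1/2)%R by apply Rmin_l. assert (e <= D / (2 * K))%R by apply Rmin_r.
  assert (HD : (0 < D)%R) by (unfold D; lra).
  assert (0 < e)%R. { apply Rmin_pos. lra. apply Rdiv_lt_0_compat; lra. }
  specialize (Ht (1 - e)%R ltac:(lra)).
  assert (e * K <= D / 2)%R.
  { apply Rle_trans with (D / (2 * K) * K)%R. apply Rmult_le_compat_r; lra. right; field; lra. }
  unfold K, D in *. nra.
Qed.

Lemma limit_one (x M K : R) : (forall t : R, (0 < t < 1)%R -> (x <= M + K * (1 - t))%R) -> (x <= M)%R.
Proof.
  intros H. apply Rnot_lt_le. intros Hlt.
  assert (HK : (0 <= Rabs K)%R) by apply Rabs_pos. assert (K <= Rabs K)%R by apply Rle_abs.
  set (e := Rmin (1/2) ((x - M) / (2 * (Rabs K + 1)))).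
  assert (e <= 1/2)%R by apply Rmin_l. assert (e <= (x - M) / (2 * (Rabs K + 1)))%R by apply Rmin_r.
  assert (0 < e)%R. { apply Rmin_pos. lra. apply Rdiv_lt_0_compat; lra. }
  specialize (H (1 - e)%R ltac:(lra)).
  assert (e * (Rabs K + 1) <= (x - M) / 2)%R.
  { apply Rle_trans with ((x - M) / (2 * (Rabs K + 1)) * (Rabs K + 1))%R.
    apply Rmult_le_compat_r; lra. right; field; lra. }
  nra.
Qed.

Definition schwarz (w : C -> C) (c : nat -> C) : Prop :=
  smooth_on_disc w /\ (forall n, jet n c w) /\ (forall z, in_disc z -> in_disc (w z)) /\ w 0 = 0 /\ c O = 0.

Lemma schwarz_quotient w c : schwarz w c -> exists g, smooth_on_disc g /\
  (forall n, jet n (fun k => c (S k)) g) /\ g 0 = c 1%nat /\ (forall z, in_disc z -> (Cmod (g z) <= 1)%R).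
Proof.
  intros (Hw & Hj & Hb & E0 & Ec).
  assert (J : forall n, jet n (fun k => c (S k)) (fun z => w z * / z)).
  { intros n. destruct (Hj (S n)) as (g' & Jg & d & Hd & E).
    apply (jet_ext n (fun k => c (S k)) _ g' _ d); auto. intros h Hh. rewrite E, Ec by auto.
    field. apply Cmod_gt_0; lra. }
  exists (fill (c 1%nat) (fun z => w z * / z)).
  assert (H : smooth_on_disc (fill (c 1%nat) (fun z => w z * / z))).
  { apply (fill_smooth 3 (fun k => c (S k))); auto. intros z Hz Nz. apply smooth_mult; auto.
    apply smooth_inv; auto. apply smooth_id. }
  split; auto. split. intros n; now apply (fill_jet n (fun k => c (S k))). split. apply fill_0.
  apply schwarz_bound; auto. intros z Hz Nz. rewrite fill_n0 by auto.
  assert (0 < Cmod z)%R by now apply Cmod_gt_0.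
  rewrite Cmod_mult, Cmod_inv by auto.
  replace (Cmod z * (Cmod (w z) * / Cmod z))%R with (Cmod (w z)) by (field; lra).
  specialize (Hb z Hz). unfold in_disc in Hb. lra.
Qed.

Lemma schwarz_c1 w c : schwarz w c -> (Cmod (c 1%nat) <= 1)%R.
Proof.
  intros H. destruct (schwarz_quotient w c H) as (g & _ & _ & E & Hb).
  rewrite <- E. apply Hb. unfold in_disc. rewrite Cmod_0. lra.
Qed.

Lemma schwarz_c2 w c : schwarz w c -> (Cmod (c 2%nat) <= 1 - Cmod (c 1%nat) ^ 2)%R.
Proof.
  intros H. destruct (schwarz_quotient w c H) as (g & Hg & Hj & E & Hb).
  now apply (schwarz_pick g (fun k => c (S k)) 4).
Qed.

Lemma conj_real x y : 1 - Cconj (x, y) * (x, y) = RtoC (1 - Cmod (x, y) ^ 2).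
Proof. rewrite Cmod_sqr. unfold RtoC, Cconj, Cminus, Cplus, Copp, Cmult; simpl. f_equal; ring. Qed.

(** The Schur parametrization is applied to [t w], [t < 1], where no denominator
    vanishes; the functional depends continuously on [t]. *)
Lemma schwarz_c3 w c (mu nu M : R) : schwarz w c ->
  (forall a b d : C, (Cmod a <= 1)%R -> (Cmod b <= 1)%R -> (Cmod d <= 1)%R ->
     let u := RtoC (1 - Cmod a ^ 2) in
     let v := RtoC (1 - Cmod b ^ 2) in
     (Cmod (u * (v * d - Cconj a * b ^ 2) + mu * a * (u * b) + nu * a ^ 3) <= M)%R) ->
  (Cmod (c 3%nat + mu * c 1%nat * c 2%nat + nu * c 1%nat ^ 3) <= M)%R.
Proof.
  intros H HM. destruct (schwarz_quotient w c H) as (g & Hg & Hj & E & Hb).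
  assert (D0 : in_disc 0) by (unfold in_disc; rewrite Cmod_0; lra).
  apply (limit_one _ _ (Cmod (c 3%nat) + 2 * Cmod (mu * c 1%nat * c 2%nat) + 3 * Cmod (nu * c 1%nat ^ 3))%R).
  intros t Ht.
  assert (Ct : Cmod (RtoC t) = t) by (apply Cmod_Rpos; lra).
  destruct (schur_step (fun z => RtoC t * g z) (fun k => RtoC t * c (S k)) 4 t) as (h & s & Hh & Js & H0 & Hs & E1 & E2); try lia; try lra.
  - intros z Hz. apply smooth_mult; auto. apply smooth_const.
  - now apply (jet_scal 5 _ (fun k => c (S k))).
  - now rewrite E.
  - intros z Hz. rewrite Cmod_mult, Ct. specialize (Hb z Hz). nra.
  - assert (SP := schwarz_pick h s 4 ltac:(lia) Hh Js H0 Hs).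
    assert (B0 : (Cmod (s O) <= 1)%R) by (rewrite <- H0; now apply Hs).
    set (a := RtoC t * c 1%nat) in *. set (b := s O) in *.
    assert (A1 : (Cmod a <= 1)%R).
    { unfold a. rewrite Cmod_mult, Ct. assert (X := schwarz_c1 w c H). assert (Y := Cmod_ge_0 (c 1%nat)). nra. }
    assert (exists d, (Cmod d <= 1)%R /\ s 1%nat = RtoC (1 - Cmod b ^ 2) * d) as (d & Hd & Ed).
    { destruct (Req_dec (1 - Cmod b ^ 2) 0) as [Z|N].
      - exists 0. rewrite Cmod_0. split. lra. rewrite Cmult_0_r. apply Cmod_eq_0.
        assert (X := Cmod_ge_0 (s 1%nat)). lra.
      - assert (P : (0 < 1 - Cmod b ^ 2)%R). { assert (X := Cmod_ge_0 (s 1%nat)). lra. }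
        exists (s 1%nat / RtoC (1 - Cmod b ^ 2)).
        assert (RtoC (1 - Cmod b ^ 2) <> 0). { intros X. apply RtoC_inj in X. lra. }
        split. rewrite Cmod_div, (Cmod_Rpos (1 - Cmod b ^ 2)) by (auto; lra).
        apply Rmult_le_reg_r with (1 - Cmod b ^ 2)%R; auto. unfold Rdiv.
        rewrite Rmult_assoc, Rinv_l, Rmult_1_r by lra. lra.
        field. auto. }
    specialize (HM a b d A1 B0 Hd). cbv zeta in HM.
    assert (Ea : 1 - Cconj a * a = RtoC (1 - Cmod a ^ 2)) by (destruct a; apply conj_real).
    rewrite Ea in E1, E2.
    set (u := RtoC (1 - Cmod a ^ 2)) in *. set (v := RtoC (1 - Cmod b ^ 2)) in *.
    assert (K : u * (v * d - Cconj a * b ^ 2) + mu * a * (u * b) + nu * a ^ 3 =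
       RtoC t * c 3%nat + RtoC t ^ 2 * (mu * c 1%nat * c 2%nat) + RtoC t ^ 3 * (nu * c 1%nat ^ 3)).
    { rewrite E2, Ed. replace (RtoC t ^ 2 * (mu * c 1%nat * c 2%nat)) with (mu * (RtoC t * c 1%nat) * (RtoC t * c 2%nat)) by ring.
      rewrite E1. fold a. replace (RtoC t ^ 3 * (nu * c 1%nat ^ 3)) with (nu * (RtoC t * c 1%nat) ^ 3) by ring. fold a. ring. }
    rewrite K in HM.
    set (x := c 3%nat) in *. set (y := mu * c 1%nat * c 2%nat) in *. set (z := nu * c 1%nat ^ 3) in *.
    replace (x + y + z) with ((RtoC t * x + RtoC t ^ 2 * y + RtoC t ^ 3 * z) +
       (RtoC (1 - t) * x + (RtoC (1 - t ^ 2) * y + RtoC (1 - t ^ 3) * z))).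
    2:{ rewrite !RtoC_minus, !RtoC_pow. ring. }
    eapply Rle_trans. apply Cmod_triangle. apply Rplus_le_compat; auto.
    eapply Rle_trans. apply Cmod_triangle. rewrite Cmod_mult.
    assert (T2 : (0 <= 1 - t ^ 2 <= 2 * (1 - t))%R) by nra.
    assert (T3 : (0 <= 1 - t ^ 3 <= 3 * (1 - t))%R).
    { assert (0 <= (1 - t) ^ 2 * (2 + t))%R by nra.
      assert (0 <= (1 - t) * (1 + t + t ^ 2))%R by nra. nra. }
    assert (Cmod (RtoC (1 - t ^ 2) * y + RtoC (1 - t ^ 3) * z) <= 2 * (1 - t) * Cmod y + 3 * (1 - t) * Cmod z)%R.
    { eapply Rle_trans. apply Cmod_triangle. rewrite !Cmod_mult, !Cmod_Rpos by lra.
      apply Rplus_le_compat; apply Rmult_le_compat_r; try apply Cmod_ge_0; lra. }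
    rewrite Cmod_Rpos by lra. lra.
Qed.

Local Open Scope R_scope.
(** * The extremal problem for the third coefficient *)

Lemma le_of_sqr x y : 0 <= y -> x ^ 2 <= y ^ 2 -> x <= y.
Proof. intros Hy H. apply Rnot_lt_le. intros L. nra. Qed.

(** The quadratic in [x] is largest at [x = 1] or at its vertex. The vertex value
    is [1 + a^2 h a] with [h] affine and increasing; it is at most 1 or increases
    up to the point where the vertex reaches [x = 1]. *)
Lemma real_angle_bound m nu M a x : 0 <= m -> nu <= m ^ 2 / 4 -> 1 <= M ->
  (forall t, 0 <= t <= 1 -> (m + 1) * t - (m + 1 + nu) * t ^ 3 <= M) ->
  0 <= a <= 1 -> 0 <= x <= 1 ->
  (1 - a ^ 2) * (1 - x ^ 2) + a * ((1 - a ^ 2) * (m * x + x ^ 2) - nu * a ^ 2) <= M.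
Proof.
  intros Hm Hnu HM Ht Ha Hx.
  set (u := 1 - a ^ 2). assert (Hu : 0 <= u) by (unfold u; nra).
  destruct (Rle_dec (2 * (1 - a)) (m * a)) as [L|L].
  - apply Rle_trans with ((m + 1) * a - (m + 1 + nu) * a ^ 3); auto.
    assert (0 <= (1 - x) * (m * a - (1 - a) * (1 + x))).
    { apply Rmult_le_pos. lra. assert ((1 - a) * (1 + x) <= (1 - a) * 2) by (apply Rmult_le_compat_l; lra). lra. }
    assert (0 <= u * ((1 - x) * (m * a - (1 - a) * (1 + x)))) by (apply Rmult_le_pos; auto).
    unfold u in *. nra.
  - apply Rnot_le_lt in L.
    assert (Ha1 : 0 < 1 - a) by nra.
    set (h := fun a => m ^ 2 / 4 - 1 + a * (m ^ 2 / 4 - nu)).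
    assert (E : u * (1 - x ^ 2) + a * (u * (m * x + x ^ 2) - nu * a ^ 2) <= 1 + a ^ 2 * h a).
    { assert (0 <= (1 + a) * ((1 - a) * x - m * a / 2) ^ 2).
      { apply Rmult_le_pos. lra. apply pow2_ge_0. }
      unfold u, h in *. nra. }
    eapply Rle_trans. apply E.
    destruct (Rle_dec (h a) 0) as [N|P].
    { assert (0 <= a ^ 2) by apply pow2_ge_0. nra. }
    apply Rnot_le_lt in P.
    set (b := 2 / (m + 2)).
    assert (Eb : m * b = 2 - 2 * b) by (unfold b; field; lra).
    assert (Hb0 : 0 < b) by (unfold b; apply Rdiv_lt_0_compat; lra).
    assert (Hab : a <= b).
    { apply Rmult_le_reg_r with (m + 2). lra. nra. }
    assert (Hb1 : b <= 1) by nra.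
    assert (Hh : h a <= h b) by (unfold h; nra).
    specialize (Ht b ltac:(lra)).
    assert (Eh : 1 + b ^ 2 * h b = (m + 1) * b - (m + 1 + nu) * b ^ 3).
    { unfold h. replace (1 + b ^ 2 * (m ^ 2 / 4 - 1 + b * (m ^ 2 / 4 - nu))) with
        (1 - b ^ 2 + (1 + b) * (m * b) ^ 2 / 4 - nu * b ^ 3) by field.
      replace ((m + 1) * b - (m + 1 + nu) * b ^ 3) with ((m * b + b) * (1 - b ^ 2) - nu * b ^ 3) by ring.
      rewrite Eb. field. }
    assert (a ^ 2 * h a <= b ^ 2 * h b).
    { apply Rmult_le_compat; try lra. apply pow2_ge_0. apply pow_incr; lra. }
    lra.
Qed.

(** Maximum over the angle: the difference of the two sides is [u] times the square of
    [m (u x^2 - r) + 4 r y]. *)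
Lemma envelope m r u x y : 0 <= u ->
  4 * r * (u ^ 2 * m ^ 2 * x ^ 2 + (u * x ^ 2 + r) ^ 2 - 2 * u * m * y * (u * x ^ 2 - r) - 4 * u * r * y ^ 2)
   <= (u * x ^ 2 + r) ^ 2 * (4 * r + u * m ^ 2).
Proof.
  intros Hu.
  assert (H : 0 <= u * (m * (u * x ^ 2 - r) + 4 * r * y) ^ 2) by (apply Rmult_le_pos; auto; apply pow2_ge_0).
  nra.
Qed.

(** Where the optimal angle becomes real the envelope touches the real value. *)
Lemma envelope_eq m r u x : m * (u * x ^ 2 - r) = 4 * r * x ->
  (u * x ^ 2 + r) ^ 2 * (4 * r + u * m ^ 2) = 4 * r * (u * m * x + u * x ^ 2 - r) ^ 2.
Proof.
  intros H.
  replace ((u * x ^ 2 + r) ^ 2 * (4 * r + u * m ^ 2)) with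
    (4 * r * (u * m * x + u * x ^ 2 - r) ^ 2 + u * (m * (u * x ^ 2 - r) - 4 * r * x) ^ 2) by ring.
  rewrite H. ring.
Qed.

(** The cubic [(n - k t)^2 (1 + j t)] increases up to [v] if its slope at [v] is
    nonnegative. *)
Lemma cubic_mono n k j u v : u <= v -> 0 <= j -> 0 <= n - k * v -> 0 <= 1 + j * v ->
  0 <= k -> 2 * k * (1 + j * v) <= j * (n - k * v) ->
  (n - k * u) ^ 2 * (1 + j * u) <= (n - k * v) ^ 2 * (1 + j * v).
Proof.
  intros Huv Hj HX HY Hk H.
  set (d := v - u). assert (Hd : 0 <= d) by (unfold d; lra).
  set (X := n - k * v) in *. set (Y := 1 + j * v) in *.
  replace (n - k * u) with (X + k * d) by (unfold X, d; ring).
  replace (1 + j * u) with (Y - j * d) by (unfold Y, d; ring).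
  assert (0 <= d * X * (j * X - 2 * k * Y)) by (repeat apply Rmult_le_pos; lra).
  assert (0 <= k * Y) by (apply Rmult_le_pos; auto).
  assert (0 <= k * d ^ 2 * (2 * (j * X) - k * Y)).
  { apply Rmult_le_pos; [|lra]. apply Rmult_le_pos; auto. apply pow2_ge_0. }
  assert (0 <= j * k ^ 2 * d ^ 3).
  { apply Rmult_le_pos; [apply Rmult_le_pos; auto; apply pow2_ge_0|now apply pow_le]. }
  nra.
Qed.

(** Bound of the envelope on [x = 1]: it increases up to the point where the
    optimal angle becomes real, and there it agrees with the real formula. *)
(** At [x = 1] the envelope, as a function of [u = 1 - a^2], is the square root of a
    cubic that increases up to the point [v] where the optimal angle becomes real;
    there it equals the real value, which is at most [M]. *)
Lemma envelope_one m nu M a : 0 <= m -> 0 < nu -> nu <= m ^ 2 / 4 ->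
  (forall t, 0 <= t <= 1 -> (m + 1) * t - (m + 1 + nu) * t ^ 3 <= M) ->
  nu <= 1 \/ nu * (m ^ 2 + 2 * m + 4) <= 2 * m * (m + 1) ->
  0 <= a <= 1 -> m * (1 - a ^ 2 - nu * a ^ 2) <= 4 * (nu * a ^ 2) ->
  (1 - a ^ 2 + nu * a ^ 2) ^ 2 * (4 * nu * a ^ 2 + (1 - a ^ 2) * m ^ 2) <= 4 * nu * M ^ 2.
Proof.
  intros Hm Hnu Hnm Ht Hc Ha Hr.
  assert (Hm0 : 0 < m) by nra.
  set (den := m * (1 + nu) + 4 * nu).
  assert (Hden : 0 < den) by (unfold den; nra).
  set (v := nu * (m + 4) / den).
  assert (Ev : v * den = nu * (m + 4)) by (unfold v; field; lra).
  assert (Hv0 : 0 < v) by (unfold v; apply Rdiv_lt_0_compat; nra).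
  assert (Hv1 : v <= 1).
  { apply Rmult_le_reg_r with den; auto. rewrite Ev. unfold den. nra. }
  set (u := 1 - a ^ 2).
  assert (Huv : u <= v).
  { apply Rmult_le_reg_r with den; auto. rewrite Ev. unfold den, u. nra. }
  assert (Hu : 0 <= u) by (unfold u; nra).
  set (b := sqrt (1 - v)).
  assert (Eb : b ^ 2 = 1 - v) by (apply pow2_sqrt; lra).
  assert (Hb : 0 <= b) by apply sqrt_pos.
  assert (Hb1 : b <= 1) by nra.
  assert (HR := Ht b ltac:(lra)).
  set (r := nu * b ^ 2).
  assert (Er : m * (v * 1 ^ 2 - r) = 4 * r * 1).
  { unfold r. rewrite Eb. unfold den in Ev. lra. }
  assert (Eq := envelope_eq m r v 1 Er).
  assert (Hr0 : 0 <= r) by (unfold r; nra).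
  assert (Hvr : 0 <= v - r) by nra.
  assert (HRM : (b * (v * m + v - r)) ^ 2 <= M ^ 2).
  { apply pow_incr. split. apply Rmult_le_pos; nra.
    replace v with (1 - b ^ 2) by lra. unfold r. lra. }
  assert (Top : (nu - (nu - 1) * v) ^ 2 * (4 * nu + (m ^ 2 - 4 * nu) * v) <= 4 * nu * M ^ 2).
  { replace ((nu - (nu - 1) * v) ^ 2 * (4 * nu + (m ^ 2 - 4 * nu) * v)) with
      ((v * 1 ^ 2 + r) ^ 2 * (4 * r + v * m ^ 2)).
    2:{ unfold r. rewrite Eb. ring. }
    rewrite Eq.
    replace (4 * r * (v * m * 1 + v * 1 ^ 2 - r) ^ 2) with (4 * nu * (b * (v * m + v - r)) ^ 2) by (unfold r; ring).
    apply Rmult_le_compat_l; lra. }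
  apply Rle_trans with ((nu - (nu - 1) * u) ^ 2 * (4 * nu + (m ^ 2 - 4 * nu) * u)).
  { right. unfold u. ring. }
  eapply Rle_trans; [|apply Top].
  destruct (Rle_dec nu 1) as [L|L].
  - apply Rmult_le_compat. apply pow2_ge_0. nra. apply pow_incr. nra. nra.
  - apply Rnot_le_lt in L. destruct Hc as [Hc|Hc]; [lra|].
    set (j := (m ^ 2 - 4 * nu) / (4 * nu)).
    assert (Ej : 4 * nu * j = m ^ 2 - 4 * nu) by (unfold j; field; lra).
    assert (Hj : 0 <= j) by nra.
    rewrite <- Ej.
    replace ((nu - (nu - 1) * u) ^ 2 * (4 * nu + 4 * nu * j * u)) with
      (4 * nu * ((nu - (nu - 1) * u) ^ 2 * (1 + j * u))) by ring.
    replace ((nu - (nu - 1) * v) ^ 2 * (4 * nu + 4 * nu * j * v)) with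
      (4 * nu * ((nu - (nu - 1) * v) ^ 2 * (1 + j * v))) by ring.
    apply Rmult_le_compat_l. lra.
    apply cubic_mono; auto; try nra.
    (* Nonnegative slope of the cubic at [v]: clearing denominators, this is the
       upper bound on [nu] times [2 nu (m + 2)]. *)
    apply Rmult_le_reg_l with (4 * nu * den). nra.
    assert (F : 0 <= den * (4 * nu * j) * nu - 2 * (nu - 1) * 4 * nu * den - 3 * (4 * nu * j) * (nu - 1) * (v * den)).
    { rewrite Ej, Ev. unfold den.
      assert (K : (m * (1 + nu) + 4 * nu) * (m ^ 2 - 4 * nu) * nu - 2 * (nu - 1) * 4 * nu * (m * (1 + nu) + 4 * nu) -
        3 * (m ^ 2 - 4 * nu) * (nu - 1) * (nu * (m + 4)) = nu * ((m+2)* (2 * m * (m+1) - nu * (m ^ 2 + 2 * m + 4)) * 2)) by ring.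
      rewrite K. apply Rmult_le_pos; [lra|]. nra. }
    nra.
Qed.

(** Squared modulus of [u (m b - b^2) + r] for complex [b] with [|b| = x] and real
    part [y], when [u], [m], [r] are real. *)
Definition modsq (m r u x y : R) : R :=
  u ^ 2 * m ^ 2 * x ^ 2 + (u * x ^ 2 + r) ^ 2 - 2 * u * m * y * (u * x ^ 2 - r) - 4 * u * r * y ^ 2.

(** The sign of [m (u z^2 - r) - 4 r z] decides whether the maximum over the angle is
    at a real point; the radius [z] is where this changes. *)
Lemma tangent_radius m r u x : 0 < m -> 0 < r -> 0 <= x <= 1 -> m * (u * x ^ 2 - r) <= 4 * x * r ->
  4 * r <= m * (u - r) -> exists z, x <= z <= 1 /\ m * (u * z ^ 2 - r) = 4 * r * z.
Proof.
  intros Hm Hr Hx H0 H1.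
  set (P := fun z => m * (u * z ^ 2 - r) - 4 * r * z).
  destruct (IVT_cor P x 1) as (z & Hz & E).
  - unfold P; reg.
  - lra.
  - unfold P. assert (m * (u * x ^ 2 - r) - 4 * r * x <= 0) by lra.
    assert (0 <= m * (u * 1 ^ 2 - r) - 4 * r * 1) by lra. nra.
  - exists z. split; auto. unfold P in E. lra.
Qed.

(** Outside the real regime [a W] is at most [(u x^2 + r) S] with [S >= 1], so the
    bound increases with [x]; move [x] up to 1 or to the radius where the real
    regime starts. *)
Lemma schur_bound m nu M a x y W : 0 <= m -> nu <= m ^ 2 / 4 -> 1 <= M ->
  (forall t, 0 <= t <= 1 -> (m + 1) * t - (m + 1 + nu) * t ^ 3 <= M) ->
  nu <= 1 \/ nu * (m ^ 2 + 2 * m + 4) <= 2 * m * (m + 1) ->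
  0 <= a <= 1 -> 0 <= x <= 1 -> -x <= y <= x -> 0 <= W ->
  W ^ 2 = modsq m (nu * a ^ 2) (1 - a ^ 2) x y ->
  (1 - a ^ 2) * (1 - x ^ 2) + a * W <= M.
Proof.
  intros Hm Hnu HM Ht Hc Ha Hx Hy HW EW.
  assert (RF := fun x => real_angle_bound m nu M a x Hm Hnu HM Ht Ha).
  set (u := 1 - a ^ 2) in *. set (r := nu * a ^ 2) in *.
  assert (Hu : 0 <= u) by (unfold u; nra).
  set (q := u * x ^ 2).
  assert (Hq : 0 <= q) by (apply Rmult_le_pos; auto; apply pow2_ge_0).
  assert (Hum : 0 <= u * m) by (apply Rmult_le_pos; auto).
  destruct (Req_dec a 0) as [A0|A0].
  { assert (u <= 1) by (unfold u; nra). rewrite A0 at 1.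
    assert (0 <= x ^ 2) by apply pow2_ge_0. nra. }
  destruct (classic (r <= 0 \/ 4 * x * r <= m * (q - r))) as [C|C].
  - (* The maximum over the angle is at the real point [y = - x]. *)
    assert (Hqr : 0 <= q - r).
    { destruct C as [C|C]; [lra|]. apply Rnot_lt_le. intros N.
      assert (0 < r) by lra.
      assert (m * (q - r) <= 0) by nra. assert (0 <= x * r) by (apply Rmult_le_pos; lra).
      assert (x = 0) by nra. subst x. unfold q in *.
      assert (m = 0) by nra. subst m. unfold r in *. nra. }
    assert (HWle : W <= u * m * x + q - r).
    { apply le_of_sqr. nra. rewrite EW. unfold modsq. fold q.
      assert (0 <= u * (x + y) * (m * (q - r) - 2 * r * (x - y))).
      { apply Rmult_le_pos. apply Rmult_le_pos; lra. destruct C as [C|C].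
        assert (0 <= m * (q - r)) by (apply Rmult_le_pos; auto).
        assert (0 <= - r * (x - y)) by (apply Rmult_le_pos; lra). lra.
        destruct (Rle_dec r 0).
        assert (0 <= m * (q - r)) by (apply Rmult_le_pos; auto).
        assert (0 <= - r * (x - y)) by (apply Rmult_le_pos; lra). lra.
        assert (r * (x - y) <= r * (2 * x)) by (apply Rmult_le_compat_l; lra). lra. }
      replace ((u * m * x + q - r) ^ 2) with (u ^ 2 * m ^ 2 * x ^ 2 + (q + r) ^ 2 - 2 * u * m * y * (q - r) - 4 * u * r * y ^ 2
         + 2 * (u * (x + y) * (m * (q - r) - 2 * r * (x - y)))).
      lra. unfold q. ring. }
    eapply Rle_trans; [|apply (RF x Hx)]. unfold q in *.
    apply Rplus_le_compat_l, Rmult_le_compat_l; lra.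
  - assert (Hr : 0 < r) by (apply Rnot_le_lt; tauto).
    assert (C2 : m * (q - r) < 4 * x * r) by (apply Rnot_le_lt; tauto).
    assert (Hnu0 : 0 < nu). { unfold r in Hr. assert (0 < a ^ 2) by nra. nra. }
    assert (Hm0 : 0 < m) by nra.
    set (S := sqrt (a ^ 2 + u * m ^ 2 / (4 * nu))).
    assert (HS0 : 0 <= u * m ^ 2 / (4 * nu)).
    { apply Rmult_le_pos. apply Rmult_le_pos; auto; apply pow2_ge_0. left; apply Rinv_0_lt_compat; lra. }
    assert (ES : S ^ 2 = a ^ 2 + u * m ^ 2 / (4 * nu)) by (apply pow2_sqrt; nra).
    assert (ES4 : 4 * nu * S ^ 2 = 4 * r + u * m ^ 2) by (rewrite ES; unfold r; field; lra).
    assert (HSp : 0 <= S) by apply sqrt_pos.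
    assert (HS1 : 1 <= S).
    { apply le_of_sqr; auto. apply Rmult_le_reg_l with (4 * nu). lra. rewrite ES4. unfold r, u in *. nra. }
    assert (HWS : a * W <= (q + r) * S).
    { apply le_of_sqr. nra. apply Rmult_le_reg_l with (4 * nu). lra.
      replace (4 * nu * ((q + r) * S) ^ 2) with ((q + r) ^ 2 * (4 * nu * S ^ 2)) by ring.
      rewrite ES4. replace (4 * nu * (a * W) ^ 2) with (4 * r * W ^ 2) by (unfold r; ring).
      rewrite EW. now apply envelope. }
    assert (Hmono : forall z, x <= z -> u * (1 - x ^ 2) + a * W <= u * (1 - z ^ 2) + (u * z ^ 2 + r) * S).
    { intros z Hz. assert (0 <= u * (z ^ 2 - x ^ 2)) by (apply Rmult_le_pos; nra).
      unfold q in *. nra. }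
    destruct (Rle_dec (4 * r) (m * (u - r))) as [D|D].
    + destruct (tangent_radius m r u x) as (z & Hz & Ez); auto. unfold q in C2; lra.
      eapply Rle_trans. apply (Hmono z); lra.
      eapply Rle_trans; [|apply (RF z); lra]. apply Rplus_le_compat_l.
      assert (Hzr : 0 <= u * z ^ 2 - r). { assert (0 <= 4 * r * z) by nra. nra. }
      apply le_of_sqr. apply Rmult_le_pos; nra.
      apply Rmult_le_reg_l with (4 * nu). lra.
      replace (4 * nu * ((u * z ^ 2 + r) * S) ^ 2) with ((u * z ^ 2 + r) ^ 2 * (4 * nu * S ^ 2)) by ring.
      rewrite ES4, (envelope_eq m r u z Ez). right. unfold r. ring.
    + eapply Rle_trans. apply (Hmono 1); lra.
      replace (u * (1 - 1 ^ 2) + (u * 1 ^ 2 + r) * S) with ((u + r) * S) by ring.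
      apply le_of_sqr. lra. apply Rmult_le_reg_l with (4 * nu). lra.
      replace (4 * nu * ((u + r) * S) ^ 2) with ((u + r) ^ 2 * (4 * nu * S ^ 2)) by ring.
      rewrite ES4. unfold r, u.
      replace (4 * (nu * a ^ 2)) with (4 * nu * a ^ 2) by ring.
      apply envelope_one; auto. apply Rnot_le_lt in D. unfold u, r in D. lra.
Qed.

(** The factor [S = sqrt (a^2 + u m^2 / (4 nu))] is at most [1 + (nu - 1) u / nu],
    because [m^2 + 8 <= 12 nu]. The product with [nu - (nu - 1) u] is then
    [nu - ((nu - 1) u)^2 / nu]. *)
Lemma schur_bound_large m nu a x y W : 0 <= m -> nu <= m ^ 2 / 4 -> m ^ 2 + 8 <= 12 * nu ->
  0 <= a <= 1 -> 0 <= x <= 1 -> 0 <= W ->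
  W ^ 2 = modsq m (nu * a ^ 2) (1 - a ^ 2) x y ->
  (1 - a ^ 2) * (1 - x ^ 2) + a * W <= nu.
Proof.
  intros Hm Hnu H12 Ha Hx HW EW.
  set (u := 1 - a ^ 2) in *. set (r := nu * a ^ 2) in *.
  assert (Hu : 0 <= u <= 1) by (unfold u; nra).
  assert (Hn1 : 1 <= nu) by lra.
  assert (Hr : 0 <= r) by (unfold r; nra).
  set (q := u * x ^ 2).
  assert (Hq : 0 <= q) by (apply Rmult_le_pos; [lra|apply pow2_ge_0]).
  set (T := 1 + (nu - 1) * u / nu).
  assert (ET : nu * T = nu + (nu - 1) * u) by (unfold T; field; lra).
  assert (HT1 : 1 <= T). { apply Rmult_le_reg_l with nu. lra. rewrite ET. nra. }
  assert (HST : 4 * r + u * m ^ 2 <= 4 * nu * T ^ 2).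
  { apply Rmult_le_reg_l with nu. lra.
    replace (nu * (4 * nu * T ^ 2)) with (4 * (nu * T) ^ 2) by ring. rewrite ET.
    assert (0 <= ((nu - 1) * u) ^ 2) by apply pow2_ge_0.
    assert (u * m ^ 2 <= u * (12 * nu - 8)) by (apply Rmult_le_compat_l; lra).
    unfold r, u in *. nra. }
  assert (HWT : a * W <= (q + r) * T).
  { apply le_of_sqr. nra. apply Rmult_le_reg_l with (4 * nu). lra.
    replace (4 * nu * (a * W) ^ 2) with (4 * r * W ^ 2) by (unfold r; ring).
    rewrite EW. eapply Rle_trans. apply envelope; lra.
    replace (4 * nu * ((q + r) * T) ^ 2) with ((q + r) ^ 2 * (4 * nu * T ^ 2)) by ring.
    apply Rmult_le_compat_l; auto. apply pow2_ge_0. }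
  assert (Hx1 : 0 <= u * (1 - x ^ 2)) by (apply Rmult_le_pos; nra).
  assert (u * (1 - x ^ 2) + a * W <= (u + r) * T) by (unfold q in *; nra).
  eapply Rle_trans. apply H.
  apply Rmult_le_reg_l with nu. lra.
  replace (nu * ((u + r) * T)) with ((u + r) * (nu * T)) by ring. rewrite ET.
  replace (u + r) with (nu - (nu - 1) * u) by (unfold u, r; ring).
  assert (0 <= ((nu - 1) * u) ^ 2) by apply pow2_ge_0. nra.
Qed.

Local Open Scope C_scope.

Lemma unit_phase (a : C) : exists e : C, Cmod e = 1%R /\ a = RtoC (Cmod a) * e.
Proof.
  destruct (excluded_middle_informative (a = 0)) as [->|N].
  - exists 1. rewrite Cmod_0, Cmod_1. split; auto. ring.
  - exists (a / RtoC (Cmod a)). assert (P : (0 < Cmod a)%R) by now apply Cmod_gt_0.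
    assert (RtoC (Cmod a) <> 0). { intros E; apply RtoC_inj in E; lra. }
    split. rewrite Cmod_div, Cmod_R, Rabs_pos_eq by (auto; lra). field; lra. field; auto.
Qed.

(** Multiplying [b] by the square of the conjugate phase of [a] removes that phase,
    and only [|a|], [|b|] and the real part of the rotated [b] remain. *)
Lemma schur_functional (mu nu M : R) :
  (forall a x y W : R, (0 <= a <= 1)%R -> (0 <= x <= 1)%R -> (-x <= y <= x)%R -> (0 <= W)%R ->
     (W ^ 2 = modsq (Rabs mu) (nu * a ^ 2) (1 - a ^ 2) x y)%R ->
    ((1 - a ^ 2) * (1 - x ^ 2) + a * W <= M)%R) ->
  forall a b d : C, (Cmod a <= 1)%R -> (Cmod b <= 1)%R -> (Cmod d <= 1)%R ->
     let u := RtoC (1 - Cmod a ^ 2) in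
     let v := RtoC (1 - Cmod b ^ 2) in
     (Cmod (u * (v * d - Cconj a * b ^ 2) + mu * a * (u * b) + nu * a ^ 3) <= M)%R.
Proof.
  intros HM a b d Ha Hb Hd u v.
  destruct (unit_phase a) as (e & He & Ea).
  set (A := Cmod a) in *. set (x := Cmod b) in *.
  assert (A0 : (0 <= A)%R) by apply Cmod_ge_0. assert (X0 : (0 <= x)%R) by apply Cmod_ge_0.
  set (beta := b * (Cconj e) ^ 2).
  assert (Ee : e * Cconj e = 1).
  { rewrite <- Cmod2_conj, He. now rewrite RtoC_pow, Cpow_1_l. }
  assert (Ce : Cmod (Cconj e) = 1%R) by now rewrite Cmod_conj.
  assert (Hbeta : Cmod beta = x).
  { unfold beta. rewrite Cmod_mult, Cmod_pow, Ce. fold x. ring. }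
  set (w := u * (mu * beta - beta ^ 2) + nu * A ^ 2).
  assert (Ew : u * (v * d - Cconj a * b ^ 2) + mu * a * (u * b) + nu * a ^ 3 =
       u * v * d + A * e ^ 3 * w).
  { rewrite Ea. rewrite Cmult_conj.
    replace (Cconj (RtoC A)) with (RtoC A) by (unfold RtoC, Cconj; simpl; f_equal; ring).
    assert (Eb : b = beta * e ^ 2).
    { unfold beta. transitivity (b * (e * Cconj e) ^ 2). rewrite Ee; ring. ring. }
    rewrite Eb. unfold w.
    transitivity (u * v * d + A * e ^ 3 * (u * (mu * beta - (e * Cconj e) * beta ^ 2) + nu * A ^ 2)).
    ring. rewrite Ee. ring. }
  rewrite Ew. eapply Rle_trans. apply Cmod_triangle.
  assert (HA2 : (0 <= 1 - A ^ 2)%R) by nra. assert (Hx2 : (0 <= 1 - x ^ 2)%R) by nra.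
  assert (B1 : (Cmod (u * v * d) <= (1 - A ^ 2) * (1 - x ^ 2))%R).
  { rewrite !Cmod_mult. unfold u, v. rewrite !Cmod_Rpos by auto.
    assert (0 <= (1 - A ^ 2) * (1 - x ^ 2))%R by (apply Rmult_le_pos; auto).
    assert (D0 := Cmod_ge_0 d). nra. }
  assert (B2 : (Cmod (A * e ^ 3 * w) = A * Cmod w)%R).
  { rewrite !Cmod_mult, Cmod_pow, He, Cmod_Rpos by auto. ring. }
  rewrite B2.
  assert (Hre : (Rabs (Re beta) <= x)%R) by (rewrite <- Hbeta; apply re_le_Cmod).
  apply Rabs_le_between in Hre.
  assert (Eq : forall s : R, (s = Re beta \/ s = - Re beta)%R -> (Rabs mu * s = mu * Re beta)%R ->
     (Cmod w ^ 2 = modsq (Rabs mu) (nu * A ^ 2) (1 - A ^ 2) x s)%R).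
  { intros s Hs E. unfold modsq.
    replace (2 * (1 - A ^ 2) * Rabs mu * s * ((1 - A ^ 2) * x ^ 2 - nu * A ^ 2))%R with
       (2 * (1 - A ^ 2) * (mu * Re beta) * ((1 - A ^ 2) * x ^ 2 - nu * A ^ 2))%R by (rewrite <- E; ring).
    replace (s ^ 2)%R with (Re beta ^ 2)%R by (destruct Hs as [->| ->]; ring).
    rewrite pow2_abs. rewrite <- Hbeta, !Cmod2_alt. unfold w, u.
    destruct beta as [p q]. clearbody A. clear. simpl. ring. }
  eapply Rle_trans. apply Rplus_le_compat_r. apply B1.
  destruct (Rle_dec 0 mu) as [P|P].
  - apply (HM A x (Re beta)); try lra. apply Cmod_ge_0. apply Eq; auto. now rewrite Rabs_pos_eq.
  - apply (HM A x (- Re beta)%R); try lra. apply Cmod_ge_0. apply Eq; auto.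
    rewrite Rabs_left by lra. ring.
Qed.

(** * Complex power series *)

Lemma Cext (x y : C) : Re x = Re y -> Im x = Im y -> x = y.
Proof. destruct x, y; simpl; intros -> ->; auto. Qed.

Lemma im_le_Cmod (c : C) : (Rabs (Im c) <= Cmod c)%R.
Proof. eapply Rle_trans; [apply Rmax_r|apply Rmax_Cmod]. Qed.

Definition summable (u : nat -> C) : Prop := ex_series (fun n => Cmod (u n)).

Definition csum (u : nat -> C) : C :=
  (Series (fun n => Re (u n)), Series (fun n => Im (u n))).

Lemma summable_le u (v : nat -> R) : (forall n, (Cmod (u n) <= v n)%R) -> ex_series v -> summable u.
Proof.
  intros H Hv. apply (ex_series_le (V := R_CompleteNormedModule) _ v); auto.
  intros n. change (Rabs (Cmod (u n)) <= v n)%R. rewrite Rabs_pos_eq; auto. apply Cmod_ge_0.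
Qed.

Lemma summable_re u : summable u -> ex_series (fun n => Rabs (Re (u n))).
Proof.
  intros H. apply (ex_series_le (V := R_CompleteNormedModule) _ (fun n => Cmod (u n))); auto.
  intros n. change (Rabs (Rabs (Re (u n))) <= Cmod (u n))%R. rewrite Rabs_Rabsolu. apply re_le_Cmod.
Qed.

Lemma summable_im u : summable u -> ex_series (fun n => Rabs (Im (u n))).
Proof.
  intros H. apply (ex_series_le (V := R_CompleteNormedModule) _ (fun n => Cmod (u n))); auto.
  intros n. change (Rabs (Rabs (Im (u n))) <= Cmod (u n))%R. rewrite Rabs_Rabsolu. apply im_le_Cmod.
Qed.

Lemma csum_ext u v : (forall n, u n = v n) -> csum u = csum v.
Proof. intros H. unfold csum. f_equal; apply Series_ext; intros n; now rewrite H. Qed.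

Lemma summable_scal c u : summable u -> summable (fun n => c * u n).
Proof.
  intros H. apply (summable_le _ (fun n => Cmod c * Cmod (u n))%R).
  intros n. rewrite Cmod_mult. lra. now apply (ex_series_scal_l (V := R_NormedModule)).
Qed.

Lemma csum_plus u v : summable u -> summable v -> csum (fun n => u n + v n) = csum u + csum v.
Proof.
  intros H H'. apply Cext; simpl; rewrite <- Series_plus; auto using ex_series_Rabs, summable_re, summable_im.
Qed.

Lemma csum_scal c u : summable u -> csum (fun n => c * u n) = c * csum u.
Proof.
  intros H.
  assert (Hr := ex_series_Rabs _ (summable_re u H)). assert (Hi := ex_series_Rabs _ (summable_im u H)).
  destruct c as [x y].
  assert (Sc : forall (k : R) v, ex_series v -> ex_series (fun n => k * v n)%R).
  { intros k v Hv. now apply (ex_series_scal_l (V := R_NormedModule)). }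
  apply Cext; unfold csum; simpl; rewrite <- !Series_scal_l.
  - rewrite <- Series_minus; auto.
  - rewrite <- Series_plus; auto.
Qed.

Lemma csum_S u : summable u -> csum u = u O + csum (fun n => u (S n)).
Proof.
  intros H. apply Cext; simpl; rewrite Series_incr_1; auto using ex_series_Rabs, summable_re, summable_im.
Qed.

(** Tested against the conjugate of the sum, this is the real inequality. *)
Lemma csum_bound u : summable u -> (Cmod (csum u) <= Series (fun n => Cmod (u n)))%R.
Proof.
  intros H. set (l := csum u).
  destruct (Req_dec (Cmod l) 0) as [Z|N].
  - rewrite Z. rewrite <- (Rmult_0_l (Series (fun _ => 0%R))), <- Series_scal_l.
    apply Series_le; auto. intros n. rewrite Rmult_0_l. split. lra. apply Cmod_ge_0.
  - assert (P : (0 < Cmod l)%R) by (assert (X := Cmod_ge_0 l); lra).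
    apply Rmult_le_reg_l with (Cmod l); auto.
    assert (E : (Cmod l * Cmod l = Series (fun n => Re (Cconj l * u n)))%R).
    { assert (E1 : Cconj l * l = csum (fun n => Cconj l * u n)) by (symmetry; now apply csum_scal).
      transitivity (Re (Cconj l * l)); [|now rewrite E1].
      replace (Cmod l * Cmod l)%R with (Cmod l ^ 2)%R by ring. rewrite Cmod2_alt.
      simpl. unfold Re, Im. ring. }
    rewrite E, <- Series_scal_l.
    assert (Hs : ex_series (fun n => Rabs (Re (Cconj l * u n)))) by (apply summable_re; now apply summable_scal).
    eapply Rle_trans. apply Rle_abs. eapply Rle_trans. now apply Series_Rabs.
    apply Series_le.
    + intros n. split. apply Rabs_pos. eapply Rle_trans. apply re_le_Cmod.
      rewrite Cmod_mult, Cmod_conj. lra.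
    + now apply (ex_series_scal_l (V := R_NormedModule)).
Qed.

Fixpoint psm (u : nat -> C) (n : nat) : C :=
  match n with O => u O | S m => psm u m + u (S m) end.

Lemma psm_sum_n (u : nat -> C) n : sum_n u n = psm u n.
Proof. induction n. now rewrite sum_O. rewrite sum_Sn, IHn. reflexivity. Qed.

Lemma psm_re u n : Re (psm u n) = sum_n (fun k => Re (u k)) n.
Proof. induction n. now rewrite sum_O. rewrite sum_Sn, <- IHn. reflexivity. Qed.

Lemma psm_im u n : Im (psm u n) = sum_n (fun k => Im (u k)) n.
Proof. induction n. now rewrite sum_O. rewrite sum_Sn, <- IHn. reflexivity. Qed.

Lemma is_series_ball {K : AbsRing} {V : NormedModule K} (u : nat -> V) (l : V) :
  is_series u l <-> forall eps : posreal, eventually (fun n => ball l eps (sum_n u n)).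
Proof. unfold is_series. apply filterlim_locally. Qed.

Lemma is_series_csum u : summable u -> is_series u (csum u).
Proof.
  intros H.
  assert (Hr := Series_correct _ (ex_series_Rabs _ (summable_re u H))).
  assert (Hi := Series_correct _ (ex_series_Rabs _ (summable_im u H))).
  apply is_series_ball. intros eps.
  generalize (filter_and _ _ (proj1 (is_series_ball _ _) Hr eps) (proj1 (is_series_ball _ _) Hi eps)).
  apply filter_imp. intros n [A B].
  rewrite psm_sum_n. rewrite <- psm_re in A. rewrite <- psm_im in B. split; [exact A|exact B].
Qed.

Lemma is_series_parts (u : nat -> C) (l : C) : is_series u l ->
  is_series (fun n => Re (u n)) (Re l) /\ is_series (fun n => Im (u n)) (Im l).
Proof.
  intros H. split; apply is_series_ball; intros eps;
  generalize (proj1 (is_series_ball _ _) H eps); apply filter_imp;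
  intros n [A B]; rewrite psm_sum_n in A, B.
  - rewrite <- psm_re. exact A.
  - rewrite <- psm_im. exact B.
Qed.

Lemma is_series_csum_unique (u : nat -> C) (l : C) : is_series u l -> csum u = l.
Proof. intros H. apply is_series_parts in H. apply Cext; now apply is_series_unique. Qed.

Definition rad (a : nat -> C) (r : R) : Prop :=
  forall s : R, (0 <= s < r)%R -> ex_series (fun n => Cmod (a n) * s ^ n)%R.

Definition psum (a : nat -> C) (z : C) : C := csum (fun n => a n * z ^ n).

Lemma Cmod_term (a : nat -> C) z n : Cmod (a n * z ^ n) = (Cmod (a n) * Cmod z ^ n)%R.
Proof. now rewrite Cmod_mult, Cmod_pow. Qed.

Lemma rad_summable a r z : rad a r -> (Cmod z < r)%R -> summable (fun n => a n * z ^ n).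
Proof.
  intros H Hz. apply (summable_le _ (fun n => Cmod (a n) * Cmod z ^ n)%R).
  intros n; rewrite Cmod_term; lra. apply H. split; auto. apply Cmod_ge_0.
Qed.

Lemma pseries_term (a : nat -> C) (z : C) n : scal (pow_n z n) (a n) = a n * z ^ n.
Proof.
  assert (E : pow_n z n = z ^ n).
  { induction n; simpl; [reflexivity|]. now rewrite IHn. }
  rewrite E. apply Cmult_comm.
Qed.

Lemma is_pseries_series (a : nat -> C) (z l : C) : is_pseries a z l <-> is_series (fun n => a n * z ^ n) l.
Proof.
  split; apply is_series_ext; intros n; [|symmetry]; apply pseries_term.
Qed.

Lemma is_pseries_psum a r z : rad a r -> (Cmod z < r)%R -> is_pseries a z (psum a z).
Proof.
  intros H Hz. apply is_pseries_series, is_series_csum. now apply (rad_summable a r).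
Qed.

Lemma psum_unique (a : nat -> C) (z l : C) : is_pseries a z l -> psum a z = l.
Proof. intros H. exact (is_series_csum_unique _ _ (proj1 (is_pseries_series a z l) H)). Qed.

Lemma geom_bound (q : R) n : (0 <= q < 1)%R -> (INR (S n) * q ^ n * (1 - q) <= 1)%R.
Proof.
  intros Hq. assert (INR (S n) * q ^ n * (1 - q) <= 1 - q ^ (S n))%R.
  { induction n. simpl. lra. rewrite S_INR.
    assert (0 <= q ^ S n)%R by (apply pow_le; lra).
    assert (q * (INR (S n) * q ^ n * (1 - q)) <= q * (1 - q ^ S n))%R by (apply Rmult_le_compat_l; lra).
    change (q ^ S (S n))%R with (q * q ^ S n)%R.
    assert (E : ((INR (S n) + 1) * q ^ S n * (1 - q) = q * (INR (S n) * q ^ n * (1 - q)) + q ^ S n * (1 - q))%R) by (simpl pow; ring).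
    rewrite E. assert (q ^ S n <= 1)%R by (rewrite <- (pow1 (S n)); apply pow_incr; lra).
    assert (q ^ S n * (1 - q) <= 1 * (1 - q))%R by (apply Rmult_le_compat_r; lra). lra. }
  assert (0 <= q ^ S n)%R by (apply pow_le; lra). lra.
Qed.

(** Comparison with a geometric series between two radii. *)
Lemma rad_of_bound a r : (forall s, (0 < s < r)%R -> exists K, forall n, (Cmod (a n) * s ^ n <= K)%R) -> rad a r.
Proof.
  intros H s Hs. set (t := ((s + r) / 2)%R).
  destruct (H t ltac:(unfold t; lra)) as (K & HK).
  assert (Ht : (0 < t)%R) by (unfold t; lra).
  assert (Hq : (0 <= s / t < 1)%R).
  { split. apply Rmult_le_pos. lra. left; now apply Rinv_0_lt_compat.
    apply Rmult_lt_reg_r with t; auto. unfold Rdiv. rewrite Rmult_assoc, Rinv_l by lra. unfold t; lra. }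
  apply (ex_series_le (V := R_CompleteNormedModule) _ (fun n => K * (s / t) ^ n)%R).
  - intros n. change (Rabs (Cmod (a n) * s ^ n) <= K * (s / t) ^ n)%R.
    rewrite Rabs_pos_eq. 2:{ apply Rmult_le_pos. apply Cmod_ge_0. apply pow_le; lra. }
    replace (s ^ n)%R with (t ^ n * (s / t) ^ n)%R.
    + rewrite <- Rmult_assoc. apply Rmult_le_compat_r; auto. apply pow_le; lra.
    + rewrite <- Rpow_mult_distr. f_equal. field. lra.
  - apply (ex_series_scal_l (V := R_NormedModule)). apply ex_series_geom. rewrite Rabs_pos_eq; lra.
Qed.

Lemma series_terms_bounded (u : nat -> R) : ex_series u -> exists K, (0 <= K)%R /\ forall n, (Rabs (u n) <= K)%R.
Proof.
  intros H. apply ex_series_lim_0 in H.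
  apply is_lim_seq_Reals in H.
  destruct (maj_by_pos u) as (K & HK & HK2). exists 0%R. exact H.
  exists K. split. lra. auto.
Qed.

Lemma rad_bound a r s : rad a r -> (0 <= s < r)%R -> exists K, (0 <= K)%R /\ forall n, (Cmod (a n) * s ^ n <= K)%R.
Proof.
  intros H Hs. destruct (series_terms_bounded _ (H s Hs)) as (K & HK & B). exists K. split; auto.
  intros n. eapply Rle_trans. apply Rle_abs. apply B.
Qed.

Lemma rad_of_is_pseries a r (f : C -> C) : (forall z, (Cmod z < r)%R -> is_pseries a z (f z)) -> rad a r.
Proof.
  intros H. apply rad_of_bound. intros s Hs.
  assert (Cs : Cmod (RtoC s) = s) by (apply Cmod_Rpos; lra).
  specialize (H (RtoC s) ltac:(lra)).
  apply (proj1 (is_pseries_series _ _ _)) in H.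
  apply is_series_parts in H. destruct H as [H1 H2].
  destruct (series_terms_bounded _ (ex_intro _ _ H1)) as (K1 & _ & B1).
  destruct (series_terms_bounded _ (ex_intro _ _ H2)) as (K2 & _ & B2).
  exists (K1 + K2)%R. intros n. rewrite <- Cs, <- Cmod_term.
  rewrite (surjective_pairing (a n * RtoC s ^ n)).
  eapply Rle_trans. apply Cmod_le_Rabs. apply Rplus_le_compat; auto.
Qed.

Lemma rad_le a r s : (s <= r)%R -> rad a r -> rad a s.
Proof. intros Hs H t Ht. apply H. lra. Qed.

Definition tail (a : nat -> C) (n : nat) : C := a (S n).
Definition dcoef (a : nat -> C) (n : nat) : C := RtoC (INR (S n)) * a (S n).

Lemma rad_dcoef a r : rad a r -> rad (dcoef a) r.
Proof.
  intros H. apply rad_of_bound. intros s Hs. set (t := ((s + r) / 2)%R).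
  assert (Ht : (s < t < r)%R) by (unfold t; lra).
  destruct (rad_bound a r t H ltac:(lra)) as (K & HK & B).
  assert (Hq : (0 <= s / t < 1)%R).
  { split. apply Rmult_le_pos. lra. left; apply Rinv_0_lt_compat; lra.
    apply Rmult_lt_reg_r with t. lra. unfold Rdiv. rewrite Rmult_assoc, Rinv_l by lra. lra. }
  exists (/ (1 - s / t) * (K / t))%R. intros n. unfold dcoef.
  rewrite Cmod_mult, Cmod_Rpos by apply pos_INR.
  replace (s ^ n)%R with ((s / t) ^ n * t ^ n)%R by (rewrite <- Rpow_mult_distr; f_equal; field; lra).
  replace (INR (S n) * Cmod (a (S n)) * ((s / t) ^ n * t ^ n))%R with
    ((INR (S n) * (s / t) ^ n) * (Cmod (a (S n)) * t ^ S n / t))%R by (simpl; field; lra).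
  apply Rmult_le_compat.
  - apply Rmult_le_pos. apply pos_INR. apply pow_le; lra.
  - apply Rmult_le_pos. apply Rmult_le_pos. apply Cmod_ge_0. apply pow_le; lra. left; apply Rinv_0_lt_compat; lra.
  - apply Rmult_le_reg_r with (1 - s / t)%R. lra. rewrite Rinv_l by lra. now apply geom_bound.
  - apply Rmult_le_compat_r. left; apply Rinv_0_lt_compat; lra. apply B.
Qed.

Lemma rad_tail a r : rad a r -> rad (tail a) r.
Proof.
  intros H. apply rad_of_bound. intros s Hs.
  destruct (rad_bound a r s H ltac:(lra)) as (K & HK & B). exists (K / s)%R. intros n.
  apply Rmult_le_reg_r with s. lra. replace (K / s * s)%R with K by (field; lra).
  specialize (B (S n)). simpl in B. unfold tail. lra.
Qed.

Lemma rad_scal c a r : rad a r -> rad (fun n => c * a n) r.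
Proof.
  intros H. apply rad_of_bound. intros s Hs.
  destruct (rad_bound a r s H ltac:(lra)) as (K & HK & B). exists (Cmod c * K)%R. intros n.
  rewrite Cmod_mult, Rmult_assoc. apply Rmult_le_compat_l; auto. apply Cmod_ge_0.
Qed.

Definition icoef (a : nat -> C) (n : nat) : C :=
  match n with O => 0 | S m => / RtoC (INR (S m)) * a m end.

Lemma INR_S_neq0 n : RtoC (INR (S n)) <> 0.
Proof. intros E. apply RtoC_inj in E. now apply (not_0_INR (S n)). Qed.

Lemma rad_icoef a r : rad a r -> rad (icoef a) r.
Proof.
  intros H. apply rad_of_bound. intros s Hs.
  destruct (rad_bound a r s H ltac:(lra)) as (K & HK & B). exists (s * K)%R. intros [|n]; cbn [icoef].
  - rewrite Cmod_0, Rmult_0_l. nra.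
  - rewrite Cmod_mult, Cmod_inv, (Cmod_Rpos _ (pos_INR _)) by apply INR_S_neq0.
    specialize (B n). assert (1 <= INR (S n))%R. { rewrite S_INR. assert (X := pos_INR n). lra. }
    assert (/ INR (S n) <= 1)%R. { rewrite <- Rinv_1. apply Rinv_le_contravar; lra. }
    assert (0 < / INR (S n))%R by (apply Rinv_0_lt_compat; lra).
    replace (/ INR (S n) * Cmod (a n) * s ^ S n)%R with (/ INR (S n) * (s * (Cmod (a n) * s ^ n)))%R by (simpl; ring).
    assert (0 <= Cmod (a n) * s ^ n)%R. { apply Rmult_le_pos. apply Cmod_ge_0. apply pow_le; lra. }
    assert (0 <= s * (Cmod (a n) * s ^ n) <= s * K)%R.
    { split. apply Rmult_le_pos; lra. apply Rmult_le_compat_l; lra. }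
    set (T := (s * (Cmod (a n) * s ^ n))%R) in *. nra.
Qed.

Lemma dcoef_icoef a n : dcoef (icoef a) n = a n.
Proof. unfold dcoef, icoef. field. apply INR_S_neq0. Qed.

Lemma psum_S a r z : rad a r -> (Cmod z < r)%R -> psum a z = a O + z * psum (tail a) z.
Proof.
  intros H Hz. unfold psum. rewrite csum_S by now apply (rad_summable a r).
  rewrite <- csum_scal by (apply (rad_summable (tail a) r); auto; now apply rad_tail).
  f_equal. simpl. ring. apply csum_ext. intros n. unfold tail. simpl. ring.
Qed.

Lemma psum_0 a r : (0 < r)%R -> rad a r -> psum a 0 = a O.
Proof. intros Hr H. rewrite (psum_S a r); auto. ring. now rewrite Cmod_0. Qed.

Lemma psum_ext a b z : (forall n, a n = b n) -> psum a z = psum b z.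
Proof. intros H. apply csum_ext. intros n; now rewrite H. Qed.

Lemma psum_scal c a r z : rad a r -> (Cmod z < r)%R -> psum (fun n => c * a n) z = c * psum a z.
Proof.
  intros H Hz. unfold psum. rewrite <- csum_scal by now apply (rad_summable a r).
  apply csum_ext. intros n; ring.
Qed.

Lemma psum_plus a b r z : rad a r -> rad b r -> (Cmod z < r)%R -> psum (fun n => a n + b n) z = psum a z + psum b z.
Proof.
  intros H H' Hz. unfold psum. rewrite <- csum_plus by (now apply (rad_summable _ r)).
  apply csum_ext. intros n; ring.
Qed.

Lemma psum_bounded a r s : rad a r -> (0 < s < r)%R ->
  exists K, forall z, (Cmod z <= s)%R -> (Cmod (psum a z) <= K)%R.
Proof.
  intros H Hs. exists (Series (fun n => Cmod (a n) * s ^ n)%R). intros z Hz.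
  eapply Rle_trans. apply csum_bound. apply (rad_summable a r); auto. lra.
  apply Series_le. intros n. split. apply Cmod_ge_0. rewrite Cmod_term.
  apply Rmult_le_compat_l. apply Cmod_ge_0. apply pow_incr. split; auto. apply Cmod_ge_0.
  apply H; lra.
Qed.

Lemma psum_jet n a r : (0 < r)%R -> rad a r -> jet n a (psum a).
Proof.
  intros Hr. revert a; induction n as [|n IH]; intros a H.
  - destruct (psum_bounded a r (r / 2) H ltac:(lra)) as (K & HK).
    exists K, (r / 2)%R. split. lra. intros h Hh. apply HK. lra.
  - exists (psum (tail a)). split. apply (IH (tail a)), rad_tail, H.
    exists r. split; auto. intros h Hh. apply (psum_S a r); auto. lra.
Qed.

(** ** Cauchy products *)

Lemma sum_head (f : nat -> R) n : (sum_f_R0 f (S n) = f O + sum_f_R0 (fun k => f (S k)) n)%R.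
Proof. now rewrite decomp_sum by lia. Qed.

Lemma conv_re p q n : Re (conv p q n) =
  (sum_f_R0 (fun k => Re (p k) * Re (q (n - k)%nat)) n - sum_f_R0 (fun k => Im (p k) * Im (q (n - k)%nat)) n)%R.
Proof.
  revert p; induction n as [|n IH]; intros p. reflexivity.
  rewrite !sum_head. cbn [conv Nat.sub].
  change (Re (p O * q (S n) + conv (fun k => p (S k)) q n)) with (Re (p O * q (S n)) + Re (conv (fun k => p (S k)) q n))%R.
  rewrite IH. simpl. unfold Re, Im. lra.
Qed.

Lemma conv_im p q n : Im (conv p q n) =
  (sum_f_R0 (fun k => Re (p k) * Im (q (n - k)%nat)) n + sum_f_R0 (fun k => Im (p k) * Re (q (n - k)%nat)) n)%R.
Proof.
  revert p; induction n as [|n IH]; intros p. reflexivity.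
  rewrite !sum_head. cbn [conv Nat.sub].
  change (Im (p O * q (S n) + conv (fun k => p (S k)) q n)) with (Im (p O * q (S n)) + Im (conv (fun k => p (S k)) q n))%R.
  rewrite IH. simpl. unfold Re, Im. lra.
Qed.

Lemma conv_ext p p' q q' n : (forall k, (k <= n)%nat -> p k = p' k) -> (forall k, (k <= n)%nat -> q k = q' k) ->
  conv p q n = conv p' q' n.
Proof.
  revert p p'; induction n as [|n IH]; intros p p' H H'; simpl.
  - now rewrite H, H' by lia.
  - rewrite H, H' by lia. f_equal. apply IH; intros k Hk; [apply H|apply H']; lia.
Qed.

Lemma conv_scal_l c p q n : conv (fun k => c * p k) q n = c * conv p q n.
Proof.
  revert p; induction n as [|n IH]; intros p; simpl.
  - ring.
  - rewrite (IH (fun k => p (S k))). ring.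
Qed.

Lemma conv_pow p q z n : conv (fun k => p k * z ^ k) (fun k => q k * z ^ k) n = conv p q n * z ^ n.
Proof.
  revert p; induction n as [|n IH]; intros p; cbn [conv].
  - simpl. ring.
  - rewrite (conv_ext (fun k => p (S k) * z ^ S k) (fun k => z * (p (S k) * z ^ k)) _ (fun k => q k * z ^ k) n)
      by (intros k _; simpl; ring).
    rewrite conv_scal_l, (IH (fun k => p (S k))). simpl. ring.
Qed.

(** Mertens' theorem for the four real products of real and imaginary parts. *)
Lemma csum_conv u v : summable u -> summable v -> csum (conv u v) = csum u * csum v.
Proof.
  intros Hu Hv.
  assert (Ur := summable_re u Hu). assert (Ui := summable_im u Hu).
  assert (Vr := summable_re v Hv). assert (Vi := summable_im v Hv).
  assert (M : forall a b : nat -> R, ex_series (fun n => Rabs (a n)) -> ex_series (fun n => Rabs (b n)) ->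
     is_series (fun n => sum_f_R0 (fun k => a k * b (n - k)%nat)%R n) (Series a * Series b)%R).
  { intros a b Ha Hb. apply is_series_mult; auto; apply Series_correct, ex_series_Rabs; auto. }
  apply Cext; apply is_series_unique.
  - apply is_series_ext with (2 := is_series_minus _ _ _ _ (M _ _ Ur Vr) (M _ _ Ui Vi)).
    intros n. symmetry. apply conv_re.
  - apply is_series_ext with (2 := is_series_plus _ _ _ _ (M _ _ Ur Vi) (M _ _ Ui Vr)).
    intros n. symmetry. apply conv_im.
Qed.

Lemma psum_conv a b r z : rad a r -> rad b r -> (Cmod z < r)%R -> psum (conv a b) z = psum a z * psum b z.
Proof.
  intros Ha Hb Hz. unfold psum. rewrite <- csum_conv by (now apply (rad_summable _ r)).
  apply csum_ext. intros n. symmetry. apply conv_pow.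
Qed.

Local Open Scope R_scope.
(** ** Recentering *)

(** Exchange of summation for a lower triangular array: the error after [K] columns
    only involves rows beyond [K], which are dominated by the tail of [A]. *)
Lemma fubini_triangle (u : nat -> nat -> R) (A : nat -> R) : ex_series A ->
  (forall n K, sum_f_R0 (fun k => Rabs (u n k)) K <= A n) ->
  (forall n k, (n < k)%nat -> u n k = 0) ->
  is_series (fun k => Series (fun n => u n k)) (Series (fun n => sum_f_R0 (u n) n)).
Proof.
  intros HA Hu H0.
  assert (Ab : forall n K, Rabs (sum_f_R0 (u n) K) <= A n).
  { intros n K. eapply Rle_trans. apply Rsum_abs. apply Hu. }
  assert (Ak : forall n k, Rabs (u n k) <= A n).
  { intros n k. eapply Rle_trans; [|apply (Hu n k)]. destruct k; simpl. lra.
    assert (0 <= sum_f_R0 (fun j => Rabs (u n j)) k) by (apply cond_pos_sum; intros; apply Rabs_pos). lra. }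
  assert (Ex : forall v : nat -> R, (forall n, Rabs (v n) <= A n) -> ex_series v).
  { intros v Hv. apply (ex_series_le (V := R_CompleteNormedModule) v A); auto. }
  assert (Ps : forall K, sum_f_R0 (fun k => Series (fun n => u n k)) K = Series (fun n => sum_f_R0 (u n) K)).
  { induction K as [|K IH]; simpl; auto. rewrite IH, <- Series_plus; auto. }
  apply is_series_Reals. intros eps Heps.
  assert (HA2 := Series_correct A HA). apply is_series_Reals in HA2.
  destruct (HA2 (eps / 3) ltac:(lra)) as (N & HN). exists N. intros K HK.
  specialize (HN K HK). unfold R_dist in *. rewrite Ps.
  set (d := fun n => sum_f_R0 (u n) K - sum_f_R0 (u n) n).
  assert (Hz : forall n m, sum_f_R0 (u n) (n + m) = sum_f_R0 (u n) n).
  { induction m. now rewrite Nat.add_0_r. rewrite Nat.add_succ_r. simpl. rewrite IHm, H0 by lia. lra. }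
  assert (Hd0 : forall n, (n <= K)%nat -> d n = 0).
  { intros n Hn. unfold d. replace K with (n + (K - n))%nat by lia. rewrite Hz. lra. }
  assert (Hd : forall n, Rabs (d n) <= 2 * A n).
  { intros n. unfold d. unfold Rminus. eapply Rle_trans. apply Rabs_triang. rewrite Rabs_Ropp.
    assert (X := Ab n K). assert (Y := Ab n n). lra. }
  rewrite <- Series_minus by auto. fold d.
  assert (HdA : ex_series (fun n => Rabs (d n))).
  { apply (ex_series_le (V := R_CompleteNormedModule) _ (fun n => 2 * A n)).
    intros n. change (Rabs (Rabs (d n)) <= 2 * A n). now rewrite Rabs_Rabsolu.
    now apply (ex_series_scal_l (V := R_NormedModule)). }
  eapply Rle_lt_trans. now apply Series_Rabs.
  rewrite (Series_incr_n_aux _ (S K)) by (intros n Hn; rewrite Hd0 by lia; apply Rabs_R0).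
  assert (HAs : ex_series (fun k => A (S K + k)%nat)) by now apply ex_series_incr_n.
  assert (Series (fun k => Rabs (d (S K + k)%nat)) <= 2 * Series (fun k => A (S K + k)%nat)).
  { rewrite <- Series_scal_l. apply Series_le. intros n; split; auto. apply Rabs_pos.
    now apply (ex_series_scal_l (V := R_NormedModule) 2 (fun k => A (S K + k)%nat)). }
  assert (Et := Series_incr_n A (S K) ltac:(lia) HA). simpl Nat.pred in Et.
  apply Rabs_def2 in HN. lra.
Qed.

Local Open Scope C_scope.

(** The coefficients of [(z + h) ^ n] as a polynomial in [h], by the Pascal
    recurrence, which suits the inductions below better than binomials. *)
Fixpoint tc (z : C) (n : nat) : nat -> C :=
  match n with O => cst 1 | S m => fun k => z * tc z m k + shift (tc z m) k end.

Lemma tc_gt z n k : (n < k)%nat -> tc z n k = 0.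
Proof.
  revert k; induction n as [|n IH]; intros k Hk; destruct k as [|k]; try lia; simpl; auto.
  rewrite !IH by lia. ring.
Qed.

Lemma tc_0 z n : tc z n 0 = z ^ n.
Proof. induction n as [|n IH]; simpl; auto. rewrite IH. ring. Qed.

Lemma tc_1 z n : tc z (S n) 1 = RtoC (INR (S n)) * z ^ n.
Proof.
  induction n as [|n IH]. simpl. ring.
  change (tc z (S (S n)) 1) with (z * tc z (S n) 1 + tc z (S n) 0).
  rewrite IH, tc_0, (S_INR (S n)), RtoC_plus. simpl Cpow. ring.
Qed.

Lemma tc_sum z h n : psm (fun k => tc z n k * h ^ k) n = (z + h) ^ n.
Proof.
  assert (S1 : forall t K, psm (fun k => shift t k * h ^ k) (S K) = h * psm (fun k => t k * h ^ k) K).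
  { intros t; induction K as [|K IH]; [simpl; ring|].
    change (psm (fun k => shift t k * h ^ k) (S K) + t (S K) * (h * h ^ S K) = h * (psm (fun k => t k * h ^ k) K + t (S K) * h ^ S K)).
    rewrite IH. ring. }
  assert (S2 : forall (f g : nat -> C) K, psm (fun k => (z * f k + g k) * h ^ k) K = z * psm (fun k => f k * h ^ k) K + psm (fun k => g k * h ^ k) K).
  { intros f g; induction K as [|K IH]; simpl. ring. rewrite IH. ring. }
  induction n as [|n IH]. simpl. ring.
  cbn [tc]. rewrite S2, S1, IH. simpl psm. rewrite IH, tc_gt by lia. simpl. ring.
Qed.

Lemma psm_scal c u n : psm (fun k => c * u k) n = c * psm u n.
Proof. induction n as [|n IH]; simpl; auto. rewrite IH. ring. Qed.

Lemma psm_ext u v n : (forall k, u k = v k) -> psm u n = psm v n.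
Proof. intros H. induction n as [|n IH]; simpl; auto. now rewrite IH, H. Qed.

Lemma tc_abs z s n K : (0 <= s)%R -> (sum_f_R0 (fun k => Cmod (tc z n k) * s ^ k) K <= (Cmod z + s) ^ n)%R.
Proof.
  intros Hs. assert (Hz := Cmod_ge_0 z). revert K; induction n as [|n IH]; intros K.
  - right. induction K; cbn [tc cst sum_f_R0] in *. rewrite Cmod_1; simpl; ring.
    rewrite IHK, Cmod_0. simpl; ring.
  - assert (S1 : (sum_f_R0 (fun k => Cmod (shift (tc z n) k) * s ^ k) K <= s * (Cmod z + s) ^ n)%R).
    { destruct K as [|K].
      - simpl. rewrite Cmod_0, Rmult_0_l. apply Rmult_le_pos; auto. apply pow_le. lra.
      - rewrite sum_head. simpl shift. rewrite Cmod_0, Rmult_0_l, Rplus_0_l.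
        apply Rle_trans with (s * sum_f_R0 (fun k => Cmod (tc z n k) * s ^ k) K)%R.
        + right. rewrite scal_sum. apply sum_eq. intros i _. simpl. ring.
        + apply Rmult_le_compat_l; auto. }
    assert (S2 : (sum_f_R0 (fun k => Cmod (tc z (S n) k) * s ^ k) K <=
       Cmod z * sum_f_R0 (fun k => Cmod (tc z n k) * s ^ k) K + sum_f_R0 (fun k => Cmod (shift (tc z n) k) * s ^ k) K)%R).
    { rewrite scal_sum, <- sum_plus. apply sum_Rle. intros k _. cbn [tc].
      assert (0 <= s ^ k)%R by now apply pow_le.
      assert (Cmod (z * tc z n k + shift (tc z n) k) <= Cmod z * Cmod (tc z n k) + Cmod (shift (tc z n) k))%R.
      { rewrite <- Cmod_mult. apply Cmod_triangle. }
      nra. }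
    specialize (IH K). change ((Cmod z + s) ^ S n)%R with ((Cmod z + s) * (Cmod z + s) ^ n)%R.
    assert (Cmod z * sum_f_R0 (fun k => Cmod (tc z n k) * s ^ k) K <= Cmod z * (Cmod z + s) ^ n)%R by (apply Rmult_le_compat_l; auto).
    lra.
Qed.

Definition recenter (a : nat -> C) (z : C) (k : nat) : C := csum (fun n => a n * tc z n k).

Section Recenter.
Variables (a : nat -> C) (r : R) (z : C).
Hypothesis (Ha : rad a r) (Hz : (Cmod z < r)%R).

Let majorant (s : R) (n : nat) : R := (Cmod (a n) * (Cmod z + s) ^ n)%R.

Lemma majorant_ex s : (0 <= s < r - Cmod z)%R -> ex_series (majorant s).
Proof. intros Hs. apply Ha. assert (X := Cmod_ge_0 z). lra. Qed.

Lemma recenter_terms s n K : (0 <= s)%R ->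
  (sum_f_R0 (fun k => Cmod (a n * tc z n k) * s ^ k) K <= majorant s n)%R.
Proof.
  intros Hs. unfold majorant. apply Rle_trans with (Cmod (a n) * sum_f_R0 (fun k => Cmod (tc z n k) * s ^ k) K)%R.
  - right. rewrite scal_sum. apply sum_eq. intros k _. rewrite Cmod_mult. ring.
  - apply Rmult_le_compat_l. apply Cmod_ge_0. now apply tc_abs.
Qed.

Lemma recenter_term s n k : (0 <= s)%R -> (Cmod (a n * tc z n k) * s ^ k <= majorant s n)%R.
Proof.
  intros Hs. eapply Rle_trans; [|apply (recenter_terms s n k Hs)]. destruct k; simpl. lra.
  assert (0 <= sum_f_R0 (fun j => Cmod (a n * tc z n j) * s ^ j) k)%R.
  { apply cond_pos_sum. intros j. apply Rmult_le_pos. apply Cmod_ge_0. now apply pow_le. }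
  lra.
Qed.

Lemma recenter_summable k : summable (fun n => a n * tc z n k).
Proof.
  set (s := ((r - Cmod z) / 2)%R). assert (Hs : (0 < s < r - Cmod z)%R) by (unfold s; lra).
  apply (summable_le _ (fun n => / s ^ k * majorant s n)%R).
  - intros n. assert (P : (0 < s ^ k)%R) by (apply pow_lt; lra).
    apply Rmult_le_reg_l with (s ^ k)%R; auto. rewrite <- Rmult_assoc, Rinv_r, Rmult_1_l, Rmult_comm by lra.
    apply recenter_term; lra.
  - apply (ex_series_scal_l (V := R_NormedModule)). apply majorant_ex; lra.
Qed.

Lemma rad_recenter : rad (recenter a z) (r - Cmod z).
Proof.
  apply rad_of_bound. intros s Hs. exists (Series (majorant s)). intros k.
  assert (P : (0 <= s ^ k)%R) by (apply pow_le; lra).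
  unfold recenter. eapply Rle_trans. apply Rmult_le_compat_r; auto. apply csum_bound, recenter_summable.
  rewrite <- Series_scal_r. apply Series_le.
  - intros n. split. apply Rmult_le_pos; auto. apply Cmod_ge_0. apply recenter_term; lra.
  - apply majorant_ex; lra.
Qed.

(** Exchange of summation in the expansion of [(z + h) ^ n]. *)
Lemma psum_recenter h : (Cmod h < r - Cmod z)%R -> psum (recenter a z) h = psum a (z + h).
Proof.
  intros Hh. set (s := Cmod h) in *. assert (Hs : (0 <= s)%R) by apply Cmod_ge_0.
  set (u := fun n k => a n * tc z n k * h ^ k).
  assert (U : forall n K, (sum_f_R0 (fun k => Cmod (u n k)) K <= majorant s n)%R).
  { intros n K. eapply Rle_trans; [|apply (recenter_terms s n K Hs)]. right. apply sum_eq. intros k _.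
    unfold u. now rewrite Cmod_mult, Cmod_pow. }
  assert (U0 : forall n k, (n < k)%nat -> u n k = 0).
  { intros n k Hk. unfold u. rewrite tc_gt by auto. ring. }
  assert (Us : forall n, psm (u n) n = a n * (z + h) ^ n).
  { intros n. rewrite <- tc_sum, <- psm_scal. apply psm_ext. intros k. unfold u. ring. }
  assert (Uk : forall k, csum (fun n => u n k) = recenter a z k * h ^ k).
  { intros k. unfold recenter. rewrite Cmult_comm, <- csum_scal by apply recenter_summable.
    apply csum_ext. intros n. unfold u. ring. }
  assert (E := majorant_ex s (conj Hs Hh)).
  unfold psum. rewrite <- (csum_ext _ _ Uk), <- (csum_ext _ _ Us).
  apply Cext; apply is_series_unique.
  - apply is_series_ext with (fun k => Series (fun n => Re (u n k))). reflexivity.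
    replace (Re (csum (fun n => psm (u n) n))) with (Series (fun n => sum_f_R0 (fun k => Re (u n k)) n)).
    + apply (fubini_triangle _ (majorant s)); auto.
      * intros n K. eapply Rle_trans; [|apply (U n K)]. apply sum_Rle. intros k _. apply re_le_Cmod.
      * intros n k Hk. now rewrite U0.
    + apply Series_ext. intros n. now rewrite psm_re, sum_n_Reals.
  - apply is_series_ext with (fun k => Series (fun n => Im (u n k))). reflexivity.
    replace (Im (csum (fun n => psm (u n) n))) with (Series (fun n => sum_f_R0 (fun k => Im (u n k)) n)).
    + apply (fubini_triangle _ (majorant s)); auto.
      * intros n K. eapply Rle_trans; [|apply (U n K)]. apply sum_Rle. intros k _. apply im_le_Cmod.
      * intros n k Hk. now rewrite U0.
    + apply Series_ext. intros n. now rewrite psm_im, sum_n_Reals.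
Qed.

Lemma recenter_1 : recenter a z 1 = psum (dcoef a) z.
Proof.
  unfold recenter. rewrite csum_S by apply recenter_summable.
  replace (a O * tc z 0 1) with (RtoC 0) by (simpl; ring). rewrite Cplus_0_l.
  apply csum_ext. intros n. rewrite tc_1. unfold dcoef. ring.
Qed.

End Recenter.

Lemma psum_analytic_at a r z : rad a r -> (Cmod z < r)%R -> analytic_at (psum a) z.
Proof.
  intros Ha Hz. exists (recenter a z), (r - Cmod z)%R. split. lra. intros y Hy.
  replace (psum a y) with (psum (recenter a z) (y - z)).
  - apply (is_pseries_psum _ (r - Cmod z)); auto. now apply rad_recenter.
  - rewrite (psum_recenter a r) by auto. f_equal. ring.
Qed.

(** ** Complex derivatives *)

(** Power series have derivatives with a quadratic error, and this form is stable
    under products and composition with plain estimates. *)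
Definition cder (f : C -> C) (z l : C) : Prop :=
  exists K d : R, (0 < d)%R /\ (0 <= K)%R /\
    forall h, (Cmod h < d)%R -> (Cmod (f (z + h)%C - f z - l * h) <= K * Cmod h ^ 2)%R.

Lemma psum_cder a r z : rad a r -> (Cmod z < r)%R -> cder (psum a) z (psum (dcoef a) z).
Proof.
  intros Ha Hz. set (b := recenter a z). assert (Hb : rad b (r - Cmod z)) by now apply rad_recenter.
  set (R0 := (r - Cmod z)%R) in *.
  assert (Hb2 := rad_tail _ _ (rad_tail _ _ Hb)).
  destruct (psum_bounded _ _ (R0 / 2) Hb2) as (K & HK). unfold R0; lra.
  exists (Rabs K), (R0 / 2)%R. split. unfold R0; lra. split. apply Rabs_pos. intros h Hh.
  assert (E : psum a (z + h) = b O + h * (b 1%nat + h * psum (tail (tail b)) h)).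
  { rewrite <- (psum_recenter a r z) by (auto; unfold R0 in *; lra). fold b.
    rewrite (psum_S b R0) by (auto; unfold R0 in *; lra).
    rewrite (psum_S (tail b) R0) by (now apply rad_tail || (unfold R0 in *; lra)). reflexivity. }
  assert (E0 : psum a z = b O).
  { replace z with (z + 0) at 1 by ring. rewrite <- (psum_recenter a r z); auto.
    apply (psum_0 _ R0); auto. unfold R0; lra. rewrite Cmod_0; lra. }
  rewrite E, E0, <- (recenter_1 a r z Ha Hz). fold b.
  replace (b O + h * (b 1%nat + h * psum (tail (tail b)) h) - b O - b 1%nat * h) with (psum (tail (tail b)) h * h ^ 2) by ring.
  rewrite Cmod_mult, Cmod_pow. apply Rmult_le_compat_r. apply pow2_ge_0.
  eapply Rle_trans. apply HK; lra. apply Rle_abs.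
Qed.

Lemma cder_ext f g z l d : (0 < d)%R -> (forall h, (Cmod h < d)%R -> f (z + h)%C = g (z + h)%C) -> cder f z l -> cder g z l.
Proof.
  intros Hd E (K & e & He & HK & H). exists K, (Rmin d e). split. now apply Rmin_pos. split; auto.
  intros h Hh. assert (Rmin d e <= d)%R by apply Rmin_l. assert (Rmin d e <= e)%R by apply Rmin_r.
  rewrite <- E by lra. replace (g z) with (f z). apply H; lra.
  assert (X := E 0). rewrite Cplus_0_r in X. apply X. now rewrite Cmod_0.
Qed.

(** Reduces the uniqueness of derivatives to that of expansions. *)
Lemma cder_jet f z l : cder f z l ->
  jet 2 (fun k => match k with O => f z | S O => l | _ => 0 end) (fun h => f (z + h)%C).
Proof.
  intros (K & d & Hd & HK & H).
  exists (fun h => (f (z + h)%C - f z) / h). split.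
  - exists (fun h => (f (z + h)%C - f z - l * h) / h ^ 2). split.
    + exists K, d. split; auto. intros h Hh. assert (N : h <> 0) by (apply Cmod_gt_0; lra).
      rewrite Cmod_div, Cmod_pow by now apply Cpow_nz.
      apply Rmult_le_reg_r with (Cmod h ^ 2)%R. apply pow_lt; lra. unfold Rdiv.
      rewrite Rmult_assoc, Rinv_l, Rmult_1_r by (apply pow_nonzero; lra). apply H; lra.
    + exists d. split; auto. intros h Hh. assert (N : h <> 0) by (apply Cmod_gt_0; lra). field. auto.
  - exists d. split; auto. intros h Hh. assert (N : h <> 0) by (apply Cmod_gt_0; lra). field. auto.
Qed.

Lemma cder_unique f z l l' : cder f z l -> cder f z l' -> l = l'.
Proof.
  intros H H'. apply cder_jet in H. apply cder_jet in H'.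
  exact (jet_unique 2 _ _ _ H H' 1%nat ltac:(lia)).
Qed.

Lemma cder_is_derive f z l : cder f z l -> C_derive f z = l.
Proof.
  intros (K & d & Hd & HK & H). apply is_C_derive_unique.
  split. apply is_linear_scal_l.
  intros x Hx eps. apply (is_filter_lim_locally_unique (V := AbsRing_NormedModule C_AbsRing)) in Hx. subst x.
  assert (P : (0 < Rmin d (eps / (K + 1)))%R).
  { apply Rmin_pos; auto. apply Rdiv_lt_0_compat. apply cond_pos. lra. }
  apply (locally_le_locally_norm (V := AbsRing_NormedModule C_AbsRing) z). exists (mkposreal _ P). intros y Hy.
  change (Cmod (y - z) < Rmin d (eps / (K + 1)))%R in Hy.
  change (Cmod (f y - f z - (y - z) * l) <= eps * Cmod (y - z))%R.
  assert (Y1 : (Cmod (y - z) < d)%R) by (eapply Rlt_le_trans; [apply Hy|apply Rmin_l]).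
  assert (Y2 : (Cmod (y - z) < eps / (K + 1))%R) by (eapply Rlt_le_trans; [apply Hy|apply Rmin_r]).
  assert (Ey : z + (y - z) = y) by (change (z + (y - z) = y); generalize (y : C); intros v; ring).
  specialize (H (y - z) Y1). rewrite Ey in H.
  rewrite (Cmult_comm (y - z)). eapply Rle_trans. apply H.
  assert (Y0 := Cmod_ge_0 (y - z)).
  replace (K * Cmod (y - z) ^ 2)%R with (K * Cmod (y - z) * Cmod (y - z))%R by ring.
  apply Rmult_le_compat_r; auto.
  assert (Cmod (y - z) * (K + 1) <= eps)%R.
  { apply Rle_trans with (eps / (K + 1) * (K + 1))%R. apply Rmult_le_compat_r; lra. right; field; lra. }
  nra.
Qed.

Lemma cder_bounded f z l : cder f z l -> exists L d, (0 < d)%R /\ (0 <= L)%R /\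
  forall h, (Cmod h < d)%R -> (Cmod (f (z + h)%C - f z) <= L * Cmod h)%R.
Proof.
  intros (K & d & Hd & HK & H). exists (Cmod l + K)%R, (Rmin d 1). split. apply Rmin_pos; lra.
  assert (X := Cmod_ge_0 l). split. lra. intros h Hh.
  assert (Rmin d 1 <= d)%R by apply Rmin_l. assert (Rmin d 1 <= 1)%R by apply Rmin_r.
  specialize (H h ltac:(lra)). assert (Y := Cmod_ge_0 h).
  replace (f (z + h)%C - f z) with (l * h + (f (z + h)%C - f z - l * h)) by ring.
  eapply Rle_trans. apply Cmod_triangle. rewrite Cmod_mult.
  assert (K * Cmod h ^ 2 <= K * Cmod h)%R by (apply Rmult_le_compat_l; nra). lra.
Qed.

Lemma cder_mult f g z l m : cder f z l -> cder g z m -> cder (fun x => f x * g x) z (l * g z + f z * m).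
Proof.
  intros Hf Hg. destruct (cder_bounded _ _ _ Hf) as (L & d1 & Hd1 & HL & H1).
  destruct (cder_bounded _ _ _ Hg) as (M & d2 & Hd2 & HM & H2).
  destruct Hf as (K & d3 & Hd3 & HK & H3). destruct Hg as (K' & d4 & Hd4 & HK' & H4).
  set (D := Rmin (Rmin d1 d2) (Rmin d3 d4)).
  exists (L * M + Cmod (f z) * K' + Cmod (g z) * K)%R, D.
  assert (F0 := Cmod_ge_0 (f z)). assert (G0 := Cmod_ge_0 (g z)).
  split. unfold D; repeat apply Rmin_pos; auto. split. nra.
  intros h Hh. assert (D <= Rmin d1 d2)%R by apply Rmin_l. assert (D <= Rmin d3 d4)%R by apply Rmin_r.
  assert (X1 := Rmin_l d1 d2). assert (X2 := Rmin_r d1 d2). assert (X3 := Rmin_l d3 d4). assert (X4 := Rmin_r d3 d4).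
  specialize (H1 h ltac:(lra)). specialize (H2 h ltac:(lra)). specialize (H3 h ltac:(lra)). specialize (H4 h ltac:(lra)).
  replace (f (z + h)%C * g (z + h)%C - f z * g z - (l * g z + f z * m) * h) with
   ((f (z + h)%C - f z) * (g (z + h)%C - g z) + (f z * (g (z + h)%C - g z - m * h) + g z * (f (z + h)%C - f z - l * h))) by ring.
  assert (Y := Cmod_ge_0 h).
  eapply Rle_trans. apply Cmod_triangle. rewrite Cmod_mult.
  assert (Cmod (f (z + h)%C - f z) * Cmod (g (z + h)%C - g z) <= (L * Cmod h) * (M * Cmod h))%R.
  { apply Rmult_le_compat; auto; apply Cmod_ge_0. }
  assert (Cmod (f z * (g (z + h)%C - g z - m * h) + g z * (f (z + h)%C - f z - l * h)) <=
    Cmod (f z) * (K' * Cmod h ^ 2) + Cmod (g z) * (K * Cmod h ^ 2))%R.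
  { eapply Rle_trans. apply Cmod_triangle. rewrite !Cmod_mult. apply Rplus_le_compat; apply Rmult_le_compat_l; auto. }
  lra.
Qed.

Lemma cder_comp f g z l m : cder f z l -> cder g (f z) m -> cder (fun x => g (f x)) z (m * l).
Proof.
  intros Hf Hg. destruct (cder_bounded _ _ _ Hf) as (L & d1 & Hd1 & HL & H1).
  destruct Hf as (K & d3 & Hd3 & HK & H3). destruct Hg as (K' & d4 & Hd4 & HK' & H4).
  assert (HL1 : (0 < d4 / (L + 1))%R) by (apply Rdiv_lt_0_compat; lra).
  set (D := Rmin (Rmin d1 d3) (d4 / (L + 1))).
  assert (M0 := Cmod_ge_0 m).
  exists (K' * L ^ 2 + Cmod m * K)%R, D.
  split. unfold D; repeat apply Rmin_pos; auto. split. nra.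
  intros h Hh. assert (D <= Rmin d1 d3)%R by apply Rmin_l. assert (D <= d4 / (L + 1))%R by apply Rmin_r.
  assert (X1 := Rmin_l d1 d3). assert (X2 := Rmin_r d1 d3).
  specialize (H1 h ltac:(lra)). specialize (H3 h ltac:(lra)). assert (Y := Cmod_ge_0 h).
  set (k := f (z + h)%C - f z) in *.
  assert (Hk : (Cmod k < d4)%R).
  { eapply Rle_lt_trans. apply H1. assert (Cmod h * (L + 1) < d4)%R.
    { apply Rlt_le_trans with (d4 / (L + 1) * (L + 1))%R. apply Rmult_lt_compat_r; lra. right; field; lra. }
    lra. }
  specialize (H4 k Hk). replace (f z + k) with (f (z + h)%C) in H4 by (unfold k; ring).
  replace (g (f (z + h)%C) - g (f z) - m * l * h) with
    ((g (f (z + h)%C) - g (f z) - m * k) + m * (k - l * h)) by ring.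
  eapply Rle_trans. apply Cmod_triangle. rewrite Cmod_mult.
  assert (Cmod k ^ 2 <= (L * Cmod h) ^ 2)%R by (apply pow_incr; split; auto; apply Cmod_ge_0).
  assert (K' * Cmod k ^ 2 <= K' * (L * Cmod h) ^ 2)%R by (apply Rmult_le_compat_l; auto).
  assert (Cmod m * Cmod (k - l * h) <= Cmod m * (K * Cmod h ^ 2))%R by (apply Rmult_le_compat_l; auto).
  nra.
Qed.

(** On each ray the real and imaginary parts have zero derivative. *)
Lemma cder_0_constant G r : (forall z, (Cmod z < r)%R -> cder G z 0) -> forall z, (Cmod z < r)%R -> G z = G 0.
Proof.
  intros H z Hz.
  assert (D : forall (P : C -> R), (forall c d, P (c - d)%C = P c - P d)%R -> (forall c, Rabs (P c) <= Cmod c)%R ->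
     P (G z) = P (G 0)).
  { intros P Pm Pb.
    replace (G z) with (G (RtoC 1 * z)) by (f_equal; ring).
    replace (G 0) with (G (RtoC 0 * z)) by (f_equal; ring).
    symmetry. apply (eq_is_derive (V := R_NormedModule) (fun t => P (G (RtoC t * z)))); [|lra].
    intros t Ht. apply is_derive_Reals. intros eps Heps.
    destruct (H (RtoC t * z)) as (K & d & Hd & HK & HG).
    { rewrite Cmod_mult, Cmod_Rpos by lra. assert (X := Cmod_ge_0 z). nra. }
    assert (Z0 := Cmod_ge_0 z). set (B := (K * Cmod z ^ 2 + Cmod z + 1)%R).
    assert (HB : (1 <= B)%R). { unfold B. assert (0 <= K * Cmod z ^ 2)%R by (apply Rmult_le_pos; auto; apply pow2_ge_0). lra. }
    assert (Hdel : (0 < Rmin (d / B) (eps / B))%R) by (apply Rmin_pos; apply Rdiv_lt_0_compat; lra).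
    exists (mkposreal _ Hdel). intros s Hs0 Hs. simpl in Hs.
    assert (S1 : (Rabs s < d / B)%R) by (eapply Rlt_le_trans; [apply Hs|apply Rmin_l]).
    assert (S2 : (Rabs s < eps / B)%R) by (eapply Rlt_le_trans; [apply Hs|apply Rmin_r]).
    assert (S3 : (Rabs s * B < d)%R).
    { apply Rlt_le_trans with (d / B * B)%R. apply Rmult_lt_compat_r; lra. right; field; lra. }
    assert (S4 : (Rabs s * B < eps)%R).
    { apply Rlt_le_trans with (eps / B * B)%R. apply Rmult_lt_compat_r; lra. right; field; lra. }
    assert (As := Rabs_pos s). assert (As0 : (0 < Rabs s)%R) by now apply Rabs_pos_lt.
    assert (Kz : (0 <= K * Cmod z ^ 2)%R) by (apply Rmult_le_pos; auto; apply pow2_ge_0).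
    specialize (HG (RtoC s * z)). rewrite Cmod_mult, Cmod_R in HG.
    specialize (HG ltac:(unfold B in *; nra)).
    replace (G (RtoC t * z + RtoC s * z) - G (RtoC t * z) - 0 * (RtoC s * z)) with
      (G (RtoC (t + s) * z) - G (RtoC t * z)) in HG.
    2:{ rewrite RtoC_plus. replace ((RtoC t + RtoC s) * z) with (RtoC t * z + RtoC s * z) by ring. ring. }
    rewrite Rminus_0_r, <- Pm. unfold Rdiv. rewrite Rabs_mult, Rabs_inv.
    apply Rmult_lt_reg_r with (Rabs s); auto. rewrite Rmult_assoc, Rinv_l, Rmult_1_r by lra.
    eapply Rle_lt_trans. apply Pb. eapply Rle_lt_trans. apply HG.
    replace (K * (Rabs s * Cmod z) ^ 2)%R with (Rabs s * (K * Cmod z ^ 2) * Rabs s)%R by ring.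
    apply Rmult_lt_compat_r; auto. unfold B in S4. nra. }
  apply Cext; apply D.
  - intros [? ?] [? ?]; simpl; ring.
  - apply re_le_Cmod.
  - intros [? ?] [? ?]; simpl; ring.
  - apply im_le_Cmod.
Qed.

(** * The complex exponential *)

Lemma Cexp_add z w : Cexp (z + w) = Cexp z * Cexp w.
Proof.
  destruct z as [x y], w as [x' y']. unfold Cexp, Cmult, Cplus; simpl.
  rewrite exp_plus, cos_plus, sin_plus. f_equal; ring.
Qed.

Lemma Cexp_0 : Cexp 0 = 1.
Proof. unfold Cexp; simpl. rewrite exp_0, cos_0, sin_0. apply Cext; simpl; ring. Qed.

Lemma Cexp_opp z : Cexp (- z) * Cexp z = 1.
Proof. rewrite <- Cexp_add, <- Cexp_0. f_equal. ring. Qed.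

Lemma exp_second_order x : (Rabs x <= 1 / 2)%R -> (0 <= exp x - 1 - x <= 2 * x ^ 2)%R.
Proof.
  intros Hx. apply Rabs_le_between in Hx.
  assert (H1 := exp_ineq1_le x). assert (H2 := exp_ineq1_le (- x)).
  rewrite exp_Ropp in H2. assert (P := exp_pos x).
  assert (exp x * (1 - x) <= 1)%R.
  { apply Rle_trans with (exp x * / exp x)%R. apply Rmult_le_compat_l; lra. right; field; lra. }
  split. lra. nra.
Qed.

Lemma sin_le_abs y : (Rabs (sin y) <= Rabs y)%R.
Proof.
  destruct (Rle_dec 0 y) as [P|P].
  - destruct (Req_dec y 0) as [->|N]. rewrite sin_0; lra.
    rewrite (Rabs_pos_eq y) by lra. apply Rabs_le. split.
    + destruct (Rle_dec y PI). assert (0 <= sin y)%R by (apply sin_ge_0; lra). lra.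
      assert (X := SIN_bound y). assert (Y := PI2_1). lra.
    + left. apply sin_lt_x. lra.
  - rewrite <- Rabs_Ropp, <- sin_neg, <- (Rabs_Ropp y). set (x := (- y)%R).
    assert (0 < x)%R by (unfold x; lra). rewrite (Rabs_pos_eq x) by lra. apply Rabs_le. split.
    + destruct (Rle_dec x PI). assert (0 <= sin x)%R by (apply sin_ge_0; lra). lra.
      assert (X := SIN_bound x). assert (Y := PI2_1). lra.
    + left. apply sin_lt_x. lra.
Qed.

Lemma cos_second_order y : (0 <= 1 - cos y <= y ^ 2 / 2)%R.
Proof.
  assert (E : cos y = (1 - 2 * sin (y / 2) * sin (y / 2))%R).
  { replace y with (2 * (y / 2))%R at 1 by field. apply cos_2a_sin. }
  assert (H := sin_le_abs (y / 2)). apply (Rsqr_le_abs_1) in H. unfold Rsqr in H.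
  rewrite E. split. nra. nra.
Qed.

Lemma sin_second_order y : (Rabs y <= 1 / 2)%R -> (Rabs (sin y - y) <= y ^ 2)%R.
Proof.
  assert (Main : forall x, (0 <= x <= 1 / 2)%R -> (0 <= x - sin x <= x ^ 2)%R).
  { intros x Hx. split. assert (X := sin_le_abs x). apply Rabs_le_between in X. rewrite Rabs_pos_eq in X by lra. lra.
    destruct (pre_sin_bound x 0) as [H _]; try lra.
    unfold sin_approx, sin_term in H. simpl in H. nra. }
  intros Hy. apply Rabs_le_between in Hy. destruct (Rle_dec 0 y) as [P|P].
  - destruct (Main y); try lra. rewrite Rabs_left1 by lra. lra.
  - destruct (Main (- y)%R); try lra. rewrite sin_neg in *. rewrite Rabs_pos_eq by lra. nra.
Qed.

Lemma Cexp_second_order h : (Cmod h < 1 / 2)%R -> (Cmod (Cexp h - 1 - h) <= 8 * Cmod h ^ 2)%R.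
Proof.
  intros Hh. assert (Hx := re_le_Cmod h). assert (Hy := im_le_Cmod h). rewrite Cmod2_alt.
  destruct h as [x y]. simpl Re in *. simpl Im in *.
  assert (E := exp_second_order x ltac:(lra)). assert (Cs := cos_second_order y).
  assert (Sn := sin_second_order y ltac:(lra)). assert (Sa := sin_le_abs y).
  assert (X2 : (Rabs x ^ 2 = x ^ 2)%R) by apply pow2_abs. assert (Y2 : (Rabs y ^ 2 = y ^ 2)%R) by apply pow2_abs.
  assert (Ax := Rabs_pos x). assert (Ay := Rabs_pos y).
  replace (Cexp (x, y) - 1 - (x, y)) with ((exp x * cos y - 1 - x)%R, (exp x * sin y - y)%R).
  2:{ unfold Cexp. apply Cext; simpl; ring. }
  eapply Rle_trans. apply Cmod_le_Rabs.
  assert (B1 : (Rabs (exp x * cos y - 1 - x) <= 2 * x ^ 2 + y ^ 2)%R).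
  { replace (exp x * cos y - 1 - x)%R with ((exp x - 1 - x) * cos y - (1 + x) * (1 - cos y))%R by ring.
    apply Rabs_le_between in Hx. assert (HC := COS_bound y).
    assert (X : (Rabs x <= 1/2)%R) by (apply Rabs_le; lra).
    assert (- (2 * x ^ 2) <= (exp x - 1 - x) * cos y <= 2 * x ^ 2)%R by (split; nra).
    assert (0 <= (1 + x) * (1 - cos y) <= y ^ 2)%R by (split; nra).
    apply Rabs_le. lra. }
  assert (B2 : (Rabs (exp x * sin y - y) <= 2 * Rabs x * Rabs y + y ^ 2)%R).
  { replace (exp x * sin y - y)%R with ((exp x - 1) * sin y + (sin y - y))%R by ring.
    eapply Rle_trans. apply Rabs_triang. apply Rplus_le_compat; auto. rewrite Rabs_mult.
    apply Rmult_le_compat; try apply Rabs_pos; auto.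
    apply Rabs_le_between in Hx.
    replace (exp x - 1)%R with (x + (exp x - 1 - x))%R by ring. eapply Rle_trans. apply Rabs_triang.
    rewrite (Rabs_pos_eq (exp x - 1 - x)) by lra.
    assert (Rabs x <= 1 / 2)%R by (apply Rabs_le; lra). nra. }
  nra.
Qed.

Lemma Cexp_cder z : cder Cexp z (Cexp z).
Proof.
  exists (8 * Cmod (Cexp z))%R, (1 / 2)%R. assert (X := Cmod_ge_0 (Cexp z)). split. lra. split. lra.
  intros h Hh. rewrite Cexp_add.
  replace (Cexp z * Cexp h - Cexp z - Cexp z * h) with (Cexp z * (Cexp h - 1 - h)) by ring.
  rewrite Cmod_mult. assert (Y := Cexp_second_order h Hh).
  assert (Cmod (Cexp z) * Cmod (Cexp h - 1 - h) <= Cmod (Cexp z) * (8 * Cmod h ^ 2))%R by (apply Rmult_le_compat_l; auto).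
  lra.
Qed.

(** * First order linear equations *)

(** [p exp (- int q)] has zero derivative. *)
Lemma exp_integral p q r : (0 < r)%R -> rad p r -> rad q r -> p O = 1 ->
  (forall z, (Cmod z < r)%R -> psum (dcoef p) z = psum q z * psum p z) ->
  forall z, (Cmod z < r)%R -> psum p z = Cexp (psum (icoef q) z).
Proof.
  intros Hr Hp Hq H0 Hde z Hz.
  assert (Hi := rad_icoef q r Hq).
  set (L := psum (fun n => - (1) * icoef q n)).
  assert (HL : forall y, (Cmod y < r)%R -> L y = - psum (icoef q) y).
  { intros y Hy. unfold L. rewrite (psum_scal _ _ r) by auto. ring. }
  assert (DL : forall y, (Cmod y < r)%R -> cder L y (- psum q y)).
  { intros y Hy. unfold L. replace (- psum q y) with (psum (dcoef (fun n => - (1) * icoef q n)) y).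
    apply (psum_cder _ r); auto. now apply rad_scal.
    rewrite (psum_ext _ (fun n => - (1) * q n)). rewrite (psum_scal _ _ r) by auto. ring.
    intros n. rewrite <- (dcoef_icoef q n). unfold dcoef. ring. }
  assert (G : forall y, (Cmod y < r)%R -> psum p y * Cexp (L y) = psum p 0 * Cexp (L 0)).
  { apply (cder_0_constant (fun y => psum p y * Cexp (L y))). intros y Hy.
    replace (RtoC 0) with (psum (dcoef p) y * Cexp (L y) + psum p y * (Cexp (L y) * - psum q y)).
    - apply (cder_mult (psum p) (fun y => Cexp (L y))). now apply (psum_cder _ r). exact (cder_comp L Cexp y _ _ (DL y Hy) (Cexp_cder _)).
    - rewrite Hde by auto. ring. }
  specialize (G z Hz). rewrite !HL in G by (auto; rewrite Cmod_0; lra).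
  rewrite !(psum_0 _ r) in G by auto. cbn [icoef] in G. rewrite H0 in G.
  replace (- RtoC 0) with (RtoC 0) in G by ring. rewrite Cexp_0, Cmult_1_l in G.
  rewrite <- (Cmult_1_l (Cexp _)), <- G, <- Cmult_assoc, Cexp_opp. ring.
Qed.

(** Iterates freeze the first [n] values and extend them by one; the diagonal is the
    solution. *)
Lemma course_of_values (x0 : C) (Phi : (nat -> C) -> nat -> C) :
  (forall p q n, (forall k, (k <= n)%nat -> p k = q k) -> Phi p n = Phi q n) ->
  exists q, q O = x0 /\ forall n, q (S n) = Phi q n.
Proof.
  intros HP.
  set (s := fix s n := match n with O => fun _ => x0 | S m => fun k => if Nat.leb k m then s m k else Phi (s m) m end).
  assert (H : forall m k, (k <= m)%nat -> s m k = s k k).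
  { induction m as [|m IH]; intros k Hk. now replace k with O by lia.
    destruct (Nat.eq_dec k (S m)) as [->|N]; auto.
    rewrite <- (IH k) by lia. simpl. replace (Nat.leb k m) with true; auto.
    symmetry. apply Nat.leb_le. lia. }
  exists (fun n => s n n). split; auto. intros n.
  cbn [s]. replace (Nat.leb (S n) n) with false by (symmetry; apply Nat.leb_gt; lia).
  apply HP. intros k Hk. now apply H.
Qed.

Lemma conv_bound p q n s M : (0 <= s)%R -> (forall k, (k <= n)%nat -> (Cmod (q k) * s ^ k <= M)%R) ->
  (Cmod (conv p q n) * s ^ n <= M * sum_f_R0 (fun k => Cmod (p k) * s ^ k) n)%R.
Proof.
  intros Hs Hq. revert p; induction n as [|n IH]; intros p.
  - simpl. rewrite Cmod_mult. specialize (Hq O ltac:(lia)). simpl in Hq. assert (X := Cmod_ge_0 (p O)). nra.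
  - rewrite sum_head. cbn [conv].
    specialize (IH ltac:(intros k Hk; apply Hq; lia) (fun k => p (S k))).
    assert (E : sum_f_R0 (fun k => Cmod (p (S k)) * s ^ S k)%R n = (s * sum_f_R0 (fun k => Cmod (p (S k)) * s ^ k) n)%R).
    { rewrite scal_sum. apply sum_eq. intros i _. simpl. ring. }
    rewrite E. specialize (Hq (S n) ltac:(lia)).
    assert (P : (0 <= s ^ S n)%R) by now apply pow_le.
    eapply Rle_trans. apply Rmult_le_compat_r; auto. apply Cmod_triangle.
    rewrite Cmod_mult, Rmult_plus_distr_r, Rmult_plus_distr_l. apply Rplus_le_compat.
    + rewrite Rmult_assoc. assert (X := Cmod_ge_0 (p O)).
      apply Rle_trans with (Cmod (p O) * M)%R. apply Rmult_le_compat_l; auto. simpl; lra.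
    + change (s ^ S n)%R with (s * s ^ n)%R.
      replace (Cmod (conv (fun k => p (S k)) q n) * (s * s ^ n))%R with (s * (Cmod (conv (fun k => p (S k)) q n) * s ^ n))%R by ring.
      eapply Rle_trans. apply Rmult_le_compat_l; auto. apply IH. right. ring.
Qed.

Lemma partial_le_Series (u : nat -> R) n : (forall k, (0 <= u k)%R) -> ex_series u -> (sum_f_R0 u n <= Series u)%R.
Proof.
  intros Hu Hs. rewrite (Series_incr_n u (S n)) by (auto; lia). simpl Nat.pred.
  assert (0 <= Series (fun k => u (S n + k)%nat))%R.
  { rewrite <- (Rmult_0_l (Series (fun _ => 0%R))), <- Series_scal_l. apply Series_le.
    intros k. rewrite Rmult_0_l. split. lra. apply Hu. now apply ex_series_incr_n. }
  lra.
Qed.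

Lemma finite_bound (u : nat -> R) N : exists M, (0 <= M)%R /\ forall k, (k <= N)%nat -> (u k <= M)%R.
Proof.
  induction N as [|N (M & HM & H)].
  - exists (Rabs (u O)). split. apply Rabs_pos. intros k Hk. replace k with O by lia. apply Rle_abs.
  - exists (Rmax M (u (S N))). split. eapply Rle_trans; [apply HM|apply Rmax_l].
    intros k Hk. destruct (Nat.eq_dec k (S N)) as [->|]. apply Rmax_r.
    eapply Rle_trans; [apply H; lia|apply Rmax_l].
Qed.

(** For [s < r] the recurrence [(n + 1) p_{n+1} = conv q p n] does not increase
    the maximum of [|p_k| s^k] once [n + 1 >= s * sum |q_k| s^k]. *)
Lemma linear_ode q r : rad q r -> exists p : nat -> C, p O = 1 /\ rad p r /\ forall n, dcoef p n = conv q p n.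
Proof.
  intros Hq.
  destruct (course_of_values 1 (fun p n => / RtoC (INR (S n)) * conv q p n)) as (p & H0 & HS).
  { intros p p' n H. f_equal. apply conv_ext; auto. }
  exists p. split; auto. split.
  - apply rad_of_bound. intros s Hs.
    set (S0 := Series (fun n => Cmod (q n) * s ^ n)%R).
    assert (Hpos : forall k, (0 <= Cmod (q k) * s ^ k)%R).
    { intros k. apply Rmult_le_pos. apply Cmod_ge_0. apply pow_le; lra. }
    assert (Hpart : forall n, (0 <= sum_f_R0 (fun k => Cmod (q k) * s ^ k) n <= S0)%R).
    { intros n. split. now apply cond_pos_sum. apply partial_le_Series; auto. apply Hq; lra. }
    assert (HS0 : (0 <= S0)%R) by (assert (X := Hpart O); lra).
    destruct (nfloor_ex (s * S0)) as (N & HN). { apply Rmult_le_pos; lra. }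
    destruct (finite_bound (fun k => Cmod (p k) * s ^ k)%R N) as (M & HM & HMk).
    exists M.
    assert (All : forall n k, (k <= n)%nat -> (Cmod (p k) * s ^ k <= M)%R).
    { induction n as [|n IH]; intros k Hk.
      - apply HMk; lia.
      - destruct (Compare_dec.le_lt_dec k N) as [L|L]; [now apply HMk|].
        destruct (Nat.eq_dec k (S n)) as [->|]; [|apply IH; lia].
        assert (B := conv_bound q p n s M ltac:(lra) IH).
        assert (HI : (s * S0 <= INR (S n))%R).
        { apply Rle_trans with (INR N + 1)%R. lra. rewrite <- S_INR. apply le_INR. lia. }
        assert (Pn : (0 < INR (S n))%R) by (apply lt_0_INR; lia).
        rewrite HS, Cmod_mult, Cmod_inv, (Cmod_Rpos (INR (S n))) by (lra || apply INR_S_neq0).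
        apply Rmult_le_reg_l with (INR (S n)); auto. rewrite <- !Rmult_assoc, Rinv_r, Rmult_1_l by lra.
        change (s ^ S n)%R with (s * s ^ n)%R.
        assert (HP := Hpart n). set (Q := sum_f_R0 (fun k => Cmod (q k) * s ^ k)%R n) in *.
        assert (M * Q <= M * S0)%R by (apply Rmult_le_compat_l; lra).
        assert (s * (Cmod (conv q p n) * s ^ n) <= s * (M * S0))%R by (apply Rmult_le_compat_l; lra).
        assert (M * (s * S0) <= M * INR (S n))%R by (apply Rmult_le_compat_l; lra).
        lra. }
    intros n. apply (All n n). lia.
  - intros n. unfold dcoef. rewrite HS. field. apply INR_S_neq0.
Qed.

(** On a disc so small that the non-constant terms of [F] sum to at most 1/2, the
    recurrence for the quotient keeps the bound [2 K]. *)
Lemma series_quotient F G r : (0 < r)%R -> rad F r -> rad G r -> F O = 1 ->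
  exists q s, (0 < s <= r)%R /\ rad q s /\ forall n, conv F q n = G n.
Proof.
  intros Hr HF HG F0.
  destruct (course_of_values (G O) (fun q n => G (S n) - conv (tail F) q n)) as (q & H0 & HS).
  { intros p p' n H. now rewrite (conv_ext (tail F) (tail F) p p' n). }
  set (t := (r / 2)%R). assert (HF' := rad_tail _ _ HF).
  set (S0 := Series (fun n => Cmod (tail F n) * t ^ n)%R).
  assert (Hpos : forall s k, (0 <= s)%R -> (0 <= Cmod (tail F k) * s ^ k)%R).
  { intros s k Hs. apply Rmult_le_pos. apply Cmod_ge_0. now apply pow_le. }
  assert (HS0 : (0 <= S0)%R).
  { eapply Rle_trans; [|apply (partial_le_Series _ O)]. simpl. apply (Hpos t O). unfold t; lra.
    intros k; apply Hpos; unfold t; lra. apply HF'. unfold t; lra. }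
  set (s := Rmin t (/ (2 * (S0 + 1)))).
  assert (Hs : (0 < s)%R). { apply Rmin_pos. unfold t; lra. apply Rinv_0_lt_compat; lra. }
  assert (Hst : (s <= t)%R) by apply Rmin_l.
  assert (Hs2 : (s * S0 <= 1 / 2)%R).
  { assert (s * (2 * (S0 + 1)) <= 1)%R.
    { apply Rle_trans with (/ (2 * (S0 + 1)) * (2 * (S0 + 1)))%R. apply Rmult_le_compat_r. lra. apply Rmin_r. right; field; lra. }
    nra. }
  destruct (rad_bound G r s HG) as (K & HK & BK). unfold t in *; lra.
  assert (All : forall n k, (k <= n)%nat -> (Cmod (q k) * s ^ k <= 2 * K)%R).
  { induction n as [|n IH]; intros k Hk.
    - replace k with O by lia. rewrite H0. specialize (BK O). lra.
    - destruct (Nat.eq_dec k (S n)) as [->|]; [|apply IH; lia].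
      assert (B := conv_bound (tail F) q n s (2 * K) ltac:(lra) IH).
      set (T := sum_f_R0 (fun k => Cmod (tail F k) * s ^ k)%R n) in *.
      assert (HT : (T <= S0)%R).
      { eapply Rle_trans; [|apply (partial_le_Series _ n)]. apply sum_Rle. intros i _.
        apply Rmult_le_compat_l. apply Cmod_ge_0. apply pow_incr; lra.
        intros i; apply Hpos; unfold t; lra. apply HF'. unfold t; lra. }
      assert (K * T <= K * S0)%R by (apply Rmult_le_compat_l; lra).
      assert (s * (Cmod (conv (tail F) q n) * s ^ n) <= s * (2 * (K * S0)))%R by (apply Rmult_le_compat_l; lra).
      assert (K * (s * S0) <= K * (1 / 2))%R by (apply Rmult_le_compat_l; lra).
      specialize (BK (S n)). rewrite HS.
      assert (Cmod (G (S n) - conv (tail F) q n) <= Cmod (G (S n)) + Cmod (conv (tail F) q n))%R.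
      { unfold Cminus. rewrite <- (Cmod_opp (conv _ _ _)). apply Cmod_triangle. }
      assert (P : (0 <= s ^ S n)%R) by (apply pow_le; lra).
      eapply Rle_trans. apply Rmult_le_compat_r; [auto|apply H3].
      rewrite Rmult_plus_distr_r. change (s ^ S n)%R with (s * s ^ n)%R in *. lra. }
  exists q, s. split. unfold t in *; lra. split.
  - apply rad_of_bound. intros x Hx. exists (2 * K)%R. intros n.
    eapply Rle_trans; [|apply (All n n); lia]. apply Rmult_le_compat_l. apply Cmod_ge_0. apply pow_incr; lra.
  - intros [|n]; simpl; rewrite F0. rewrite H0; ring. rewrite HS. unfold tail. ring.
Qed.

Lemma log_exists a : rad a 1 -> a O = 0 -> a 1%nat = 1 -> exists g, log_coefficients (psum a) g.
Proof.
  intros Ha H0 H1.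
  destruct (series_quotient (tail a) (dcoef (tail a)) 1) as (q & s & Hs & Hq & E); auto; try lra.
  now apply rad_tail. now apply rad_dcoef, rad_tail.
  exists (fun n => / 2 * icoef q n), (psum (icoef q)), s.
  assert (Hi := rad_icoef q s Hq). split. lra. split. exact (psum_0 _ s (proj1 Hs) Hi).
  assert (Hat : rad (tail a) s) by (apply (rad_le _ 1); [lra|now apply rad_tail]).
  split.
  - intros z Nz Hz. rewrite <- (exp_integral (tail a) q s); auto; try lra.
    + rewrite (psum_S a 1) by (auto; lra). rewrite H0. field. auto.
    + intros y Hy. rewrite (psum_ext _ _ y (fun n => eq_sym (E n))).
      rewrite (psum_conv _ _ s); auto. ring.
  - intros z Hz. replace (psum (icoef q) z) with
      (psum (fun n : nat => match n with O => 0 | S _ => 2 * (/ 2 * icoef q n) end) z).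
    + apply (is_pseries_psum _ s); auto. intros t Ht. apply (ex_series_ext (V := R_NormedModule)) with (2 := Hi t Ht).
      intros [|n]; auto. f_equal. f_equal. field.
    + apply psum_ext. intros [|n]; auto. field.
Qed.

(** * Coefficient formulas *)

Lemma analytic_expand f z : analytic_at f z -> exists a r, (0 < r)%R /\ rad a r /\
   forall h, (Cmod h < r)%R -> f (z + h) = psum a h.
Proof.
  intros (a & r & Hr & H).
  assert (H' : forall h, (Cmod h < r)%R -> is_pseries a h (f (z + h))).
  { intros h Hh. replace h with (z + h - z) at 1 by ring. apply H. now replace (z + h - z) with h by ring. }
  exists a, r. split; auto. split. now apply (rad_of_is_pseries _ _ (fun h => f (z + h))).
  intros h Hh. symmetry. now apply psum_unique, H'.
Qed.

Lemma analytic_smooth f z : analytic_at f z -> smooth_at f z.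
Proof.
  intros H. destruct (analytic_expand f z H) as (a & r & Hr & Ha & E).
  exists a. split.
  - apply (jet_ext 3 a a (psum a) _ r); auto. intros h Hh. symmetry. apply E. lra. now apply (psum_jet _ _ r).
  - specialize (E 0). rewrite Cplus_0_r in E. rewrite E by (rewrite Cmod_0; lra). now apply (psum_0 _ r).
Qed.

Lemma analytic_schwarz w : analytic_on_disc w -> (forall z, in_disc z -> in_disc (w z)) -> w 0 = 0 ->
  exists c, schwarz w c.
Proof.
  intros Hw Hd H0. assert (D0 : in_disc 0) by (unfold in_disc; rewrite Cmod_0; lra).
  destruct (analytic_expand w 0 (Hw 0 D0)) as (c & r & Hr & Hc & E).
  exists c. split; [|split; [|split; [|split]]]; auto.
  - intros z Hz. apply analytic_smooth, Hw, Hz.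
  - intros n. apply (jet_ext n c c (psum c) _ r); auto. intros h Hh. specialize (E h ltac:(lra)).
    now rewrite Cplus_0_l in E. now apply (psum_jet _ _ r).
  - specialize (E 0). rewrite Cplus_0_r, H0, (psum_0 _ r) in E by auto. symmetry. apply E. now rewrite Cmod_0.
Qed.

Lemma psum_C_derive f a r z : rad a r -> (Cmod z < r)%R -> (forall y, (Cmod y < r)%R -> f y = psum a y) ->
  C_derive f z = psum (dcoef a) z.
Proof.
  intros Ha Hz E. apply cder_is_derive. apply (cder_ext (psum a) f z _ (r - Cmod z)). lra.
  - intros h Hh. symmetry. apply E. eapply Rle_lt_trans. apply Cmod_triangle. lra.
  - now apply (psum_cder _ r).
Qed.

(** Logarithmic differentiation, [L' F = F'] for [F = f(z)/z]: both sides are the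
    derivative of [exp L = F], which holds off the origin. *)
Lemma log_relation a r f g : (0 < r)%R -> rad a r -> (forall z, (Cmod z < r)%R -> f z = psum a z) -> a O = 0 ->
  log_coefficients f g ->
  let l := fun n : nat => match n return C with O => 0 | S _ => 2 * g n end in
  forall n, conv (tail a) (dcoef l) n = dcoef (tail a) n.
Proof.
  intros Hr Ha Ef a0 (L & s & Hs & L0 & HE & HL) l n.
  assert (Hl : rad l s) by now apply (rad_of_is_pseries _ _ L).
  assert (EL : forall z, (Cmod z < s)%R -> L z = psum l z) by (intros z Hz; symmetry; now apply psum_unique, HL).
  assert (Hat := rad_tail _ _ Ha).
  set (m := Rmin r s). assert (Hm : (0 < m)%R) by now apply Rmin_pos.
  assert (Hmr : (m <= r)%R) by apply Rmin_l. assert (Hms : (m <= s)%R) by apply Rmin_r.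
  assert (EF : forall z : C, z <> 0 -> (Cmod z < m)%R -> Cexp (psum l z) = psum (tail a) z).
  { intros z Nz Hz. rewrite <- EL, HE, Ef, (psum_S a r), a0 by (auto; lra). field. auto. }
  apply (jet_unique (S n) _ _ (psum (dcoef (tail a)))); auto.
  2: now apply (psum_jet _ _ r), rad_dcoef.
  apply (jet_ext (S n) (conv (tail a) (dcoef l)) _ (fun z => psum (tail a) z * psum (dcoef l) z) _ m); auto.
  2:{ apply jet_mult. now apply (psum_jet _ _ r). now apply (psum_jet _ _ s), rad_dcoef. }
  intros z Hz. assert (Nz : z <> 0) by (apply Cmod_gt_0; lra).
  rewrite <- EF by (auto; lra).
  apply (cder_unique (psum (tail a)) z).
  - apply (cder_ext (fun y => Cexp (psum l y)) _ z _ (Rmin (Cmod z) (m - Cmod z))).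
    + apply Rmin_pos; lra.
    + intros h Hh. assert (X := Rmin_l (Cmod z) (m - Cmod z)). assert (Y := Rmin_r (Cmod z) (m - Cmod z)).
      apply EF. intros E0. assert (h = - z). { transitivity (z + h - z). ring. rewrite E0. ring. }
      subst h. rewrite Cmod_opp in Hh. lra.
      eapply Rle_lt_trans. apply Cmod_triangle. lra.
    + apply (cder_comp (psum l) Cexp). apply (psum_cder _ s); auto. lra. apply Cexp_cder.
  - apply (psum_cder _ r); auto. lra.
Qed.

Lemma disc_denominator (B : R) (x : C) : (-1 <= B <= 1)%R -> in_disc x -> 1 + B * x <> 0.
Proof.
  intros HB Hx E0. unfold in_disc in Hx.
  assert (M : Cmod (RtoC B * x) = 1%R).
  { replace (RtoC B * x) with (- (1)). apply Cmod_m1. transitivity (- (1) + 0). ring. rewrite <- E0. ring. }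
  rewrite Cmod_mult, Cmod_R in M.
  assert (Rabs B <= 1)%R by (apply Rabs_le; lra). assert (X := Cmod_ge_0 x). assert (Y := Rabs_pos B). nra.
Qed.

(** Coefficients of [z f'' (1 + B w) = (A - B) w f']. *)
Lemma janowski_relation (A B : R) a r f w c : (0 < r <= 1)%R -> rad a r -> (forall z, (Cmod z < r)%R -> f z = psum a z) ->
  (-1 <= B <= 1)%R -> schwarz w c ->
  (forall z, in_disc z -> C_derive f z <> 0) ->
  (forall z, in_disc z -> 1 + z * C_derive (C_derive f) z / C_derive f z = (1 + A * w z) / (1 + B * w z)) ->
  forall n, conv (shift (dcoef (dcoef a))) (fun k => cst 1 k + B * c k) n = RtoC (A - B) * conv c (dcoef a) n.
Proof.
  intros Hr Ha Ef HB (Hw & Hj & Hd & w0 & c0) Hf' HE n.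
  assert (Ha1 := rad_dcoef _ _ Ha). assert (Ha2 := rad_dcoef _ _ Ha1).
  assert (E1 : forall z, (Cmod z < r)%R -> C_derive f z = psum (dcoef a) z).
  { intros z Hz. now apply (psum_C_derive f a r). }
  assert (E2 : forall z, (Cmod z < r)%R -> C_derive (C_derive f) z = psum (dcoef (dcoef a)) z).
  { intros z Hz. now apply (psum_C_derive (C_derive f) (dcoef a) r). }
  apply (jet_unique (S n) (conv (shift (dcoef (dcoef a))) (fun k => cst 1 k + B * c k)) (fun n => RtoC (A - B) * conv c (dcoef a) n)
     (fun z => z * psum (dcoef (dcoef a)) z * (1 + B * w z))); auto.
  - apply jet_mult. now apply jet_down, jet_shift, (psum_jet _ _ r).
    apply (jet_plus (S n) (cst 1) (fun k => B * c k)). apply jet_const. now apply jet_scal.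
  - apply (jet_ext (S n) (fun n => RtoC (A - B) * conv c (dcoef a) n) _ (fun z => RtoC (A - B) * (w z * psum (dcoef a) z)) _ r); auto. lra.
    + intros z Hz. assert (Dz : in_disc z) by (unfold in_disc; lra).
      specialize (HE z Dz). specialize (Hf' z Dz). rewrite E1, E2 in * by lra.
      assert (N := disc_denominator B (w z) HB (Hd z Dz)).
      set (u := psum (dcoef a) z) in *. set (v := psum (dcoef (dcoef a)) z) in *.
      assert (E3 : z * v * (1 + B * w z) = ((1 + A * w z) / (1 + B * w z) - 1) * u * (1 + B * w z)).
      { rewrite <- HE. field. auto. }
      rewrite E3, RtoC_minus. field. auto.
    + apply (jet_scal (S n) _ (conv c (dcoef a))). apply jet_mult; auto. now apply (psum_jet _ _ r).
Qed.

Definition gamma_formulas (A B : R) (g c : nat -> C) : Prop :=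
  g 1%nat = RtoC ((A - B) / 4) * c 1%nat /\
  g 2%nat = RtoC ((A - B) / 12) * (c 2%nat + RtoC ((A - 5 * B) / 4) * c 1%nat ^ 2) /\
  g 3%nat = RtoC ((A - B) / 24) * (c 3%nat + RtoC (1 / 2 * (A - 5 * B)) * c 1%nat * c 2%nat
              + RtoC (1 / 2 * (3 * B ^ 2 - A * B)) * c 1%nat ^ 3).

Lemma gamma_of_schwarz (A B : R) f g w c : (-1 <= B <= 1)%R -> class_A f -> schwarz w c ->
  (forall z, in_disc z -> C_derive f z <> 0) ->
  (forall z, in_disc z -> 1 + z * C_derive (C_derive f) z / C_derive f z = (1 + A * w z) / (1 + B * w z)) ->
  log_coefficients f g -> gamma_formulas A B g c.
Proof.
  intros HB (Hf & f0 & f1) Hw Hf' HE Hg.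
  assert (D0 : in_disc 0) by (unfold in_disc; rewrite Cmod_0; lra).
  destruct (analytic_expand f 0 (Hf 0 D0)) as (a & r' & Hr' & Ha' & Ef').
  set (r := Rmin r' 1). assert (Hr : (0 < r)%R) by (apply Rmin_pos; lra).
  assert (Hr1 : (r <= r')%R) by apply Rmin_l. assert (Hr2 : (r <= 1)%R) by apply Rmin_r.
  assert (Ha : rad a r) by now apply (rad_le _ r').
  assert (Ef : forall z, (Cmod z < r)%R -> f z = psum a z).
  { intros z Hz. rewrite <- Ef' by lra. f_equal. ring. }
  assert (M0 : (Cmod 0 < r)%R) by (rewrite Cmod_0; lra).
  assert (a0 : a O = 0). { rewrite <- (psum_0 a r), <- Ef by auto. auto. }
  assert (a1 : a 1%nat = 1).
  { rewrite (psum_C_derive f a r) in f1 by auto. rewrite (psum_0 _ r) in f1 by (auto; now apply rad_dcoef).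
    rewrite <- f1. unfold dcoef. simpl. ring. }
  assert (Lr := log_relation a r f g Hr Ha Ef a0 Hg).
  assert (Jr := janowski_relation A B a r f w c (conj Hr Hr2) Ha Ef HB Hw Hf' HE).
  destruct Hw as (_ & _ & _ & _ & c0).
  assert (L1 := Lr 0%nat). assert (L2 := Lr 1%nat). assert (L3 := Lr 2%nat).
  assert (J1 := Jr 1%nat). assert (J2 := Jr 2%nat). assert (J3 := Jr 3%nat).
  unfold tail, dcoef, cst, shift in *. cbn [conv] in *.
  rewrite c0, a1 in *.
  assert (I1 : RtoC (INR 1) = 1) by reflexivity.
  assert (I2 : RtoC (INR 2) = 1 + 1) by (apply Cext; simpl; ring).
  assert (I3 : RtoC (INR 3) = 1 + 1 + 1) by (apply Cext; simpl; ring).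
  assert (I4 : RtoC (INR 4) = 1 + 1 + 1 + 1) by (apply Cext; simpl; ring).
  assert (I2' : RtoC 2 = 1 + 1) by (apply Cext; simpl; ring).
  rewrite I1, I2, I3, ?I4, ?I2', ?RtoC_minus in *.
  clear - L1 L2 L3 J1 J2 J3.
  set (a2 := a 2%nat) in *. set (a3 := a 3%nat) in *. set (a4 := a 4%nat) in *.
  set (c1 := c 1%nat) in *. set (c2 := c 2%nat) in *. set (c3 := c 3%nat) in *.
  set (g1 := g 1%nat) in *. set (g2 := g 2%nat) in *. set (g3 := g 3%nat) in *.
  set (D := RtoC A - RtoC B) in *.
  assert (N2 : 1 + 1 <> 0) by (intros E; apply (f_equal Re) in E; simpl in E; lra).
  assert (N3 : 1 + 1 + 1 <> 0) by (intros E; apply (f_equal Re) in E; simpl in E; lra).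
  assert (Dv : forall k x y : C, k <> 0 -> k * x = y -> x = y / k) by (intros k x y Nk <-; field; auto).
  assert (A2 : a2 = D * c1 / (1 + 1)).
  { apply Dv; auto. transitivity (0 * (0 + B * c1) + 1 * ((1 + 1) * a2) * (1 + B * 0)). ring. rewrite J1. ring. }
  assert (A3 : a3 = (D * (c1 * ((1 + 1) * a2) + c2) - (1 + 1) * a2 * B * c1) / ((1 + 1) * (1 + 1 + 1))).
  { apply Dv. now apply Cmult_neq_0.
    transitivity ((0 * (0 + B * c2) + (1 * ((1 + 1) * a2) * (0 + B * c1) + (1 + 1) * ((1 + 1 + 1) * a3) * (1 + B * 0)))
      - (1 + 1) * a2 * B * c1). ring. rewrite J2. ring. }
  assert (A4 : a4 = (D * (c1 * ((1 + 1 + 1) * a3) + (c2 * ((1 + 1) * a2) + c3)) - (1 + 1) * a2 * B * c2 - (1 + 1) * (1 + 1 + 1) * a3 * B * c1)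
     / ((1 + 1 + 1) * ((1 + 1) * (1 + 1)))).
  { apply Dv. repeat apply Cmult_neq_0; auto.
    transitivity ((0 * (0 + B * c3) + (1 * ((1 + 1) * a2) * (0 + B * c2) + ((1 + 1) * ((1 + 1 + 1) * a3) * (0 + B * c1) +
      (1 + 1 + 1) * ((1 + 1 + 1 + 1) * a4) * (1 + B * 0)))) - (1 + 1) * a2 * B * c2 - (1 + 1) * (1 + 1 + 1) * a3 * B * c1).
    ring. rewrite J3. ring. }
  assert (G1 : g1 = a2 / (1 + 1)).
  { apply Dv; auto. transitivity (1 * (1 * ((1 + 1) * g1))). ring. rewrite L1. ring. }
  assert (G2 : g2 = ((1 + 1) * a3 - a2 * ((1 + 1) * g1)) / ((1 + 1) * (1 + 1))).
  { apply Dv. now apply Cmult_neq_0.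
    transitivity ((1 * ((1 + 1) * ((1 + 1) * g2)) + a2 * (1 * ((1 + 1) * g1))) - a2 * ((1 + 1) * g1)). ring. rewrite L2. ring. }
  assert (G3 : g3 = ((1 + 1 + 1) * a4 - a2 * ((1 + 1) * ((1 + 1) * g2)) - a3 * ((1 + 1) * g1)) / ((1 + 1 + 1) * (1 + 1))).
  { apply Dv. now apply Cmult_neq_0.
    transitivity (1 * ((1 + 1 + 1) * ((1 + 1) * g3)) + (a2 * ((1 + 1) * ((1 + 1) * g2)) + a3 * (1 * ((1 + 1) * g1)))
       - a2 * ((1 + 1) * ((1 + 1) * g2)) - a3 * ((1 + 1) * g1)). ring. rewrite L3. ring. }
  assert (K4 : RtoC ((A - B) / 4) = D / ((1 + 1) * (1 + 1))).
  { apply Dv. now apply Cmult_neq_0. unfold D. apply Cext; simpl; field. }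
  assert (K12 : RtoC ((A - B) / 12) = D / ((1 + 1) * (1 + 1) * (1 + 1 + 1))).
  { apply Dv. repeat apply Cmult_neq_0; auto. unfold D. apply Cext; simpl; field. }
  assert (K24 : RtoC ((A - B) / 24) = D / ((1 + 1) * (1 + 1) * (1 + 1) * (1 + 1 + 1))).
  { apply Dv. repeat apply Cmult_neq_0; auto. unfold D. apply Cext; simpl; field. }
  assert (K5 : RtoC ((A - 5 * B) / 4) = (D - (1 + 1) * (1 + 1) * B) / ((1 + 1) * (1 + 1))).
  { apply Dv. repeat apply Cmult_neq_0; auto. unfold D. apply Cext; simpl; field. }
  assert (Km : RtoC (1 / 2 * (A - 5 * B)) = (D - (1 + 1) * (1 + 1) * B) / (1 + 1)).
  { apply Dv; auto. unfold D. apply Cext; simpl; field. }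
  assert (Kn : RtoC (1 / 2 * (3 * B ^ 2 - A * B)) = B * ((1 + 1) * B - D) / (1 + 1)).
  { apply Dv; auto. unfold D. apply Cext; simpl; field. }
  unfold gamma_formulas. fold g1 g2 g3 c1 c2 c3. rewrite K4, K12, K24, K5, Km, Kn.
  assert (F1 : g1 = D / ((1 + 1) * (1 + 1)) * c1) by (rewrite G1, A2; field; auto).
  split; [exact F1|].
  split; [rewrite G2, F1, A3, A2; field; auto|].
  rewrite G3, A4, G2, F1, A3, A2. field.
Qed.

(** * Extremal functions *)

Lemma psum_analytic a : rad a 1 -> analytic_on_disc (psum a).
Proof. intros Ha z Hz. now apply (psum_analytic_at a 1). Qed.

Lemma psum_schwarz c : rad c 1 -> c O = 0 -> (forall z, in_disc z -> in_disc (psum c z)) -> schwarz (psum c) c.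
Proof.
  intros Hc c0 Hd. split; [|split; [|split; [|split]]]; auto.
  - intros z Hz. apply analytic_smooth, psum_analytic; auto.
  - intros n. apply (psum_jet _ _ 1); auto. lra.
  - rewrite (psum_0 _ 1); auto. lra.
Qed.

(** Take [f' = exp (int q)]: then [z f'' / f' = z q = (A-B) w / (1 + B w)], and [f']
    has no zero. *)
Lemma janowski_exists (A B : R) c q : (-1 <= B)%R -> (B < A)%R -> (A <= 1)%R ->
  rad c 1 -> c O = 0 -> (forall z, in_disc z -> in_disc (psum c z)) -> rad q 1 ->
  (forall z, in_disc z -> z * psum q z * (1 + B * psum c z) = RtoC (A - B) * psum c z) ->
  exists f g, janowski_convex A B f /\ log_coefficients f g /\ gamma_formulas A B g c.
Proof.
  intros HB HAB HA Hc c0 Hd Hq E.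
  destruct (linear_ode q 1 Hq) as (p & p0 & Hp & Ep).
  set (a := icoef p). assert (Ha : rad a 1) by now apply rad_icoef.
  assert (D0 : in_disc 0) by (unfold in_disc; rewrite Cmod_0; lra).
  assert (Hdp : forall z, in_disc z -> psum (dcoef p) z = psum q z * psum p z).
  { intros z Hz. rewrite (psum_ext _ _ z Ep). now apply (psum_conv _ _ 1). }
  assert (Hexp := exp_integral p q 1 ltac:(lra) Hp Hq p0 Hdp).
  assert (F1 : forall z, in_disc z -> C_derive (psum a) z = psum p z).
  { intros z Hz. rewrite (psum_C_derive (psum a) a 1) by auto. apply psum_ext. intros n. apply dcoef_icoef. }
  assert (F2 : forall z, in_disc z -> C_derive (C_derive (psum a)) z = psum q z * psum p z).
  { intros z Hz. rewrite (psum_C_derive _ p 1) by auto. auto. }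
  assert (Np : forall z, in_disc z -> psum p z <> 0).
  { intros z Hz E0. rewrite Hexp in E0 by exact Hz. assert (X := Cexp_opp (psum (icoef q) z)).
    rewrite E0, Cmult_0_r in X. apply (f_equal Re) in X. simpl in X. lra. }
  assert (CA : class_A (psum a)).
  { split. now apply psum_analytic. split. now apply (psum_0 a 1 ltac:(lra)).
    rewrite F1 by auto. now rewrite (psum_0 p 1) by (auto; lra). }
  assert (Nf : forall z, in_disc z -> C_derive (psum a) z <> 0).
  { intros z Hz. rewrite F1; auto. }
  assert (Su : forall z, in_disc z -> 1 + z * C_derive (C_derive (psum a)) z / C_derive (psum a) z =
     (1 + A * psum c z) / (1 + B * psum c z)).
  { intros z Hz. rewrite F1, F2 by auto. specialize (Np z Hz).
    assert (N := disc_denominator B _ ltac:(lra) (Hd z Hz)). specialize (E z Hz).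
    transitivity (1 + z * psum q z * (1 + B * psum c z) / (1 + B * psum c z)). field. auto.
    rewrite E, RtoC_minus. field. auto. }
  assert (Sw := psum_schwarz c Hc c0 Hd).
  destruct (log_exists a Ha eq_refl) as (g & Hg).
  { unfold a, icoef. rewrite p0. apply Cext; simpl; field. }
  exists (psum a), g. split; [|split]; auto.
  - split; auto. split; auto. exists (psum c). split. now apply psum_analytic. split; auto.
    split; auto. destruct Sw as (_ & _ & _ & X & _). exact X.
  - apply (gamma_of_schwarz A B (psum a) g (psum c) c); auto. lra.
Qed.

Lemma rad_bounded a K : (forall n, (Cmod (a n) <= K)%R) -> rad a 1.
Proof.
  intros H. apply rad_of_bound. intros s Hs. exists K. intros n.
  assert (0 <= s ^ n <= 1)%R. { split. apply pow_le; lra. rewrite <- (pow1 n). apply pow_incr; lra. }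
  specialize (H n). assert (X := Cmod_ge_0 (a n)). nra.
Qed.

Lemma rad_one : rad (cst 1) 1.
Proof. apply (rad_bounded _ 1). intros [|n]; simpl; rewrite ?Cmod_1, ?Cmod_0; lra. Qed.

Lemma psum_one z : in_disc z -> psum (cst 1) z = 1.
Proof.
  intros Hz. rewrite (psum_S _ 1) by (auto using rad_one).
  rewrite (psum_ext _ (fun n => 0 * cst 1 n)) by (intros n; unfold tail; simpl; ring).
  rewrite (psum_scal _ _ 1) by (auto using rad_one). simpl. ring.
Qed.

Lemma rad_shift a r : rad a r -> rad (shift a) r.
Proof.
  intros Ha. apply rad_of_bound. intros s Hs. destruct (rad_bound a r s Ha ltac:(lra)) as (K & HK & B).
  exists (s * K)%R. intros [|n]; cbn [shift].
  - rewrite Cmod_0, Rmult_0_l. apply Rmult_le_pos; lra.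
  - specialize (B n). simpl pow. replace (Cmod (a n) * (s * s ^ n))%R with (s * (Cmod (a n) * s ^ n))%R by ring.
    apply Rmult_le_compat_l; lra.
Qed.

Lemma rad_plus a b r : rad a r -> rad b r -> rad (fun n => a n + b n) r.
Proof.
  intros Ha Hb. apply rad_of_bound. intros s Hs.
  destruct (rad_bound a r s Ha ltac:(lra)) as (K & _ & B). destruct (rad_bound b r s Hb ltac:(lra)) as (K' & _ & B').
  exists (K + K')%R. intros n. specialize (B n). specialize (B' n).
  assert (P : (0 <= s ^ n)%R) by (apply pow_le; lra). assert (X := Cmod_triangle (a n) (b n)). nra.
Qed.

Lemma psum_shift a r z : rad a r -> (Cmod z < r)%R -> psum (shift a) z = z * psum a z.
Proof.
  intros Ha Hz. rewrite (psum_S (shift a) r) by (auto; now apply rad_shift).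
  cbn [shift]. rewrite Cplus_0_l. reflexivity.
Qed.

(** Two consecutive coefficients of [1 / (1 + al (1 + be) z + be z^2)]. *)
Fixpoint quad (al be : R) (n : nat) : R * R :=
  match n with
  | O => (1, - (al * (1 + be)))%R
  | S m => let (x, y) := quad al be m in (y, - (al * (1 + be)) * y - be * x)%R
  end.

(** The energy [x^2 + 2 al x y + y^2] does not increase: one step lowers it by
    [(1 - be^2) (x + al y)^2]. It bounds [y + al x], hence linear growth, including
    the degenerate case [al = 1]. *)
Lemma quad_bound al be n : (0 <= al <= 1)%R -> (-1 <= be <= 1)%R ->
  let (x, y) := quad al be n in
  (x ^ 2 + 2 * al * x * y + y ^ 2 <= 1)%R /\ (Rabs x <= INR (S n))%R.
Proof.
  intros Ha Hb.
  assert (St : forall x y : R, (x ^ 2 + 2 * al * x * y + y ^ 2 <= 1)%R -> (Rabs (y + al * x) <= 1)%R).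
  { intros x y H. assert (0 <= (1 - al ^ 2) * x ^ 2)%R by (apply Rmult_le_pos; [nra|apply pow2_ge_0]).
    apply Rabs_le. nra. }
  induction n as [|n IH].
  - simpl. split.
    + assert (0 <= al ^ 2 * (1 - be ^ 2))%R by (apply Rmult_le_pos; nra). nra.
    + rewrite Rabs_R1; lra.
  - cbn [quad]. destruct (quad al be n) as [x y]. destruct IH as [V X]. split.
    + assert (0 <= (1 - be ^ 2) * (x + al * y) ^ 2)%R.
      { apply Rmult_le_pos. nra. apply pow2_ge_0. }
      nra.
    + specialize (St x y V). rewrite (S_INR (S n)).
      replace y with ((y + al * x) + - (al * x))%R by ring.
      eapply Rle_trans. apply Rabs_triang. rewrite Rabs_Ropp, Rabs_mult, (Rabs_pos_eq al) by lra.
      assert (Y := Rabs_pos x). nra.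
Qed.

Lemma rad_linear a : (forall n, (Cmod (a n) <= INR (S n))%R) -> rad a 1.
Proof.
  intros H. assert (Ho : rad (dcoef (fun _ => 1)) 1).
  { apply rad_dcoef, (rad_bounded _ 1). intros n. rewrite Cmod_1. lra. }
  intros s Hs. apply (ex_series_le (V := R_CompleteNormedModule) _ (fun n => Cmod (dcoef (fun _ => 1) n) * s ^ n)%R); [|now apply Ho].
  intros n. change (Rabs (Cmod (a n) * s ^ n) <= Cmod (dcoef (fun _ => 1%C) n) * s ^ n)%R.
  assert (P : (0 <= s ^ n)%R) by (apply pow_le; lra).
  rewrite Rabs_pos_eq by (apply Rmult_le_pos; auto; apply Cmod_ge_0).
  apply Rmult_le_compat_r; auto. unfold dcoef. rewrite Cmult_1_r, Cmod_Rpos by apply pos_INR. apply H.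
Qed.

Lemma quad_inverse al be : (0 <= al <= 1)%R -> (-1 <= be <= 1)%R ->
  exists e, rad e 1 /\ forall z, in_disc z -> (1 + RtoC (al * (1 + be)) * z + be * z ^ 2) * psum e z = 1.
Proof.
  intros Ha Hb. set (e := fun n => RtoC (fst (quad al be n))).
  assert (He : rad e 1).
  { apply rad_linear. intros n. unfold e. rewrite Cmod_R. assert (X := quad_bound al be n Ha Hb).
    destruct (quad al be n). apply X. }
  exists e. split; auto. intros z Hz. unfold in_disc in Hz.
  assert (He1 := rad_tail _ _ He). assert (He2 := rad_tail _ _ He1).
  assert (Rec : psum (tail (tail e)) z = - RtoC (al * (1 + be)) * psum (tail e) z + - RtoC be * psum e z).
  { rewrite <- !(psum_scal _ _ 1) by auto. rewrite <- (psum_plus _ _ 1) by (auto using rad_scal).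
    apply psum_ext. intros n. unfold tail, e. cbn [quad]. destruct (quad al be n) as [x y].
    apply Cext; simpl; ring. }
  assert (E1 := psum_S e 1 z He Hz). assert (E2 := psum_S (tail e) 1 z He1 Hz). rewrite Rec in E2.
  assert (e0 : e O = 1) by reflexivity. assert (e1 : tail e O = - RtoC (al * (1 + be))) by (apply Cext; simpl; ring).
  rewrite e0 in E1. rewrite e1 in E2. set (X := psum e z) in *. set (Y := psum (tail e) z) in *.
  assert (E3 : z * Y + RtoC (al * (1 + be)) * z * X + be * z ^ 2 * X = 0).
  { transitivity (z * (Y + RtoC (al * (1 + be)) * (1 + z * Y) + RtoC be * z * X) + RtoC (al * (1 + be)) * z * (X - (1 + z * Y))). ring.
    rewrite <- E1. replace (X - X) with (RtoC 0) by ring. rewrite E2 at 1. rewrite E1. ring. }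
  transitivity (X - z * Y + (z * Y + RtoC (al * (1 + be)) * z * X + be * z ^ 2 * X)). ring.
  rewrite E3, E1. ring.
Qed.

Lemma geometric_inverse (x : R) : (-1 <= x <= 1)%R ->
  let e := fun n : nat => RtoC (x ^ n) in
  rad e 1 /\ forall z, in_disc z -> (1 - x * z) * psum e z = 1.
Proof.
  intros Hx e. assert (He : rad e 1).
  { apply (rad_bounded _ 1). intros n. unfold e. rewrite Cmod_R, <- RPow_abs, <- (pow1 n).
    apply pow_incr. split. apply Rabs_pos. apply Rabs_le; lra. }
  split; auto. intros z Hz.
  assert (E := psum_S e 1 z He Hz).
  rewrite (psum_ext (tail e) (fun n => RtoC x * e n)) in E.
  2:{ intros n. unfold tail, e. rewrite <- RtoC_mult. reflexivity. }
  rewrite (psum_scal _ _ 1) in E by auto. replace (e O) with (RtoC 1) in E by reflexivity.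
  transitivity (psum e z - x * z * psum e z). ring. rewrite E at 1. ring.
Qed.

Lemma blaschke_bound (al : R) (z : C) : (0 <= al <= 1)%R -> in_disc z ->
  (Cmod (z + RtoC al) <= Cmod (1 + RtoC al * z))%R.
Proof.
  intros Ha Hz. unfold in_disc in Hz.
  assert (X := moebius_bound z (- RtoC al) ltac:(lra)).
  rewrite Cmod_opp, Cmod_R, Rabs_pos_eq in X by lra. specialize (X ltac:(lra)).
  replace (z - - RtoC al) with (z + RtoC al) in X by ring.
  replace (1 - Cconj (- RtoC al) * z) with (1 + RtoC al * z) in X. exact X.
  destruct z. apply Cext; simpl; ring.
Qed.

(** The Schwarz function is [w = sg z (z + al) / (1 + al z)]. Here
    [(1 + al z) (1 + B w) = 1 + al (1 + B sg) z + B sg z^2], so [q] is a linear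
    polynomial times the series of [quad_inverse]. *)
Lemma blaschke_attained (A B al sg : R) : (-1 <= B)%R -> (B < A)%R -> (A <= 1)%R ->
  (0 <= al <= 1)%R -> (sg = 1 \/ sg = -1)%R ->
  exists f g c, janowski_convex A B f /\ log_coefficients f g /\ gamma_formulas A B g c /\
    c 1%nat = RtoC (sg * al) /\ c 2%nat = RtoC (sg * (1 - al ^ 2)) /\ c 3%nat = RtoC (- (sg * al * (1 - al ^ 2))).
Proof.
  intros HB HAB HA Hal Hsg.
  destruct (geometric_inverse (- al) ltac:(lra)) as (Hg & Eg).
  set (G := fun n : nat => RtoC ((- al) ^ n)) in *.
  set (c := shift (fun n => RtoC (sg * al) * cst 1 n + shift (fun k => RtoC (sg * (1 - al ^ 2)) * G k) n)).
  assert (Ho := rad_one). assert (Po := psum_one).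
  assert (Hc : rad c 1).
  { apply rad_shift, rad_plus. now apply rad_scal. now apply rad_shift, rad_scal. }
  assert (Ec : forall z, in_disc z -> psum c z = z * (RtoC (sg * al) + z * (RtoC (sg * (1 - al ^ 2)) * psum G z))).
  { intros z Hz. unfold c. rewrite (psum_shift _ 1); auto.
    2:{ apply rad_plus. now apply rad_scal. now apply rad_shift, rad_scal. }
    rewrite (psum_plus _ _ 1); auto. 2: now apply rad_scal. 2: now apply rad_shift, rad_scal.
    rewrite (psum_shift _ 1), !(psum_scal _ _ 1), Po; auto. 2: now apply rad_scal. ring. }
  assert (Ec2 : forall z, in_disc z -> (1 + al * z) * psum c z = sg * z * (z + al)).
  { intros z Hz. rewrite Ec by auto. specialize (Eg z Hz).
    replace (1 - RtoC (- al) * z) with (1 + al * z) in Eg by (rewrite RtoC_opp; ring).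
    transitivity (z * ((1 + al * z) * RtoC (sg * al) + z * RtoC (sg * (1 - al ^ 2)) * ((1 + al * z) * psum G z))). ring.
    rewrite Eg. rewrite !RtoC_mult, RtoC_minus, RtoC_pow. ring. }
  assert (Nd : forall z, in_disc z -> 1 + al * z <> 0) by (intros z; apply disc_denominator; lra).
  assert (Hsg1 : Rabs sg = 1%R) by (destruct Hsg as [->| ->]; [apply Rabs_R1|rewrite Rabs_left; lra]).
  assert (Hd : forall z, in_disc z -> in_disc (psum c z)).
  { intros z Hz. assert (B1 := blaschke_bound al z Hal Hz). assert (N := Nd z Hz).
    assert (P : (0 < Cmod (1 + al * z))%R) by now apply Cmod_gt_0.
    assert (E := f_equal Cmod (Ec2 z Hz)). rewrite !Cmod_mult, Cmod_R, Hsg1 in E. unfold in_disc in *.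
    assert (Z := Cmod_ge_0 z).
    apply Rmult_lt_reg_l with (Cmod (1 + al * z)); auto. rewrite E, Rmult_1_r, Rmult_1_l.
    assert (Y := Cmod_ge_0 (z + al)). nra. }
  assert (Hbe : (-1 <= B * sg <= 1)%R) by (destruct Hsg as [->| ->]; lra).
  destruct (quad_inverse al (B * sg) Hal Hbe) as (e & He & Ee).
  set (q := fun n => RtoC ((A - B) * sg) * (RtoC al * e n + shift e n)).
  assert (Hae : rad (fun n => RtoC al * e n + shift e n) 1).
  { apply rad_plus. now apply rad_scal. now apply rad_shift. }
  destruct (janowski_exists A B c q) as (f & g & H1 & H2 & H3); auto.
  - now apply rad_scal.
  - intros z Hz. unfold q. rewrite (psum_scal _ (fun n => RtoC al * e n + shift e n) 1) by auto.
    rewrite (psum_plus _ _ 1), (psum_shift _ 1), (psum_scal _ _ 1); auto. 2: now apply rad_scal. 2: now apply rad_shift.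
    specialize (Ee z Hz). specialize (Ec2 z Hz). specialize (Nd z Hz).
    set (w := psum c z) in *. set (x := psum e z) in *.
    assert (Ew : w = sg * z * (z + al) / (1 + al * z)) by (rewrite <- Ec2; field; auto).
    assert (Ex : (1 + al * z) * (1 + B * w) * x = 1).
    { rewrite !RtoC_mult, RtoC_plus, RtoC_mult in Ee.
      transitivity ((1 + al * (1 + B * sg) * z + B * sg * z ^ 2) * x); [|exact Ee].
      rewrite Ew. field. auto. }
    transitivity (RtoC ((A - B) * sg) * z * (al + z) * ((1 + al * z) * (1 + B * w) * x) / (1 + al * z)). field; auto.
    rewrite Ex, Ew, RtoC_mult. field. auto.
  - exists f, g, c. split; auto. split; auto. split; auto.
    assert (S2 : (sg * sg = 1)%R) by (destruct Hsg as [->| ->]; ring).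
    unfold c, G. split; [|split]; apply Cext; simpl; ring.
Qed.

(** For [w = z^3] only [c3] survives, and [q = (A-B) z^2 / (1 + B z^3)]. *)
Lemma cube_attained (A B : R) : (-1 <= B)%R -> (B < A)%R -> (A <= 1)%R ->
  exists f g c, janowski_convex A B f /\ log_coefficients f g /\ gamma_formulas A B g c /\
    c 1%nat = 0 /\ c 2%nat = 0 /\ c 3%nat = 1.
Proof.
  intros HB HAB HA.
  set (c := shift (shift (shift (cst 1)))).
  assert (Ho := rad_one). assert (Po := psum_one).
  assert (Hc : rad c 1) by (repeat apply rad_shift; auto).
  assert (Ec : forall z, in_disc z -> psum c z = z ^ 3).
  { intros z Hz. unfold c. rewrite !(psum_shift _ 1), Po; auto using rad_shift. }
  set (e3 := fix e3 n := match n with O => 1%R | 1%nat => 0%R | 2%nat => 0%R | S (S (S m)) => (- B * e3 m)%R end).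
  assert (He3 : forall n, (Rabs (e3 n) <= 1 /\ Rabs (e3 (S n)) <= 1 /\ Rabs (e3 (S (S n))) <= 1)%R).
  { induction n as [|n (I1 & I2 & I3)].
    - simpl. rewrite Rabs_R1, Rabs_R0. lra.
    - split; auto. split; auto. change (e3 (S (S (S n)))) with (- B * e3 n)%R.
      rewrite Rabs_mult, Rabs_Ropp. assert (Rabs B <= 1)%R by (apply Rabs_le; lra).
      assert (X := Rabs_pos B). assert (Y := Rabs_pos (e3 n)). nra. }
  set (e := fun n => RtoC (e3 n)).
  assert (He : rad e 1). { apply (rad_bounded _ 1). intros n. unfold e. rewrite Cmod_R. apply He3. }
  assert (Ee : forall z, in_disc z -> (1 + B * z ^ 3) * psum e z = 1).
  { intros z Hz. unfold in_disc in Hz.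
    assert (He1 := rad_tail _ _ He). assert (He2 := rad_tail _ _ He1).
    assert (E : psum e z = 1 + z ^ 3 * (- RtoC B * psum e z)).
    { assert (E1 := psum_S e 1 z He Hz). assert (E2 := psum_S (tail e) 1 z He1 Hz).
      assert (E3 := psum_S (tail (tail e)) 1 z He2 Hz).
      assert (T : psum (tail (tail (tail e))) z = - RtoC B * psum e z).
      { rewrite <- (psum_scal _ _ 1) by auto. apply psum_ext. intros n. unfold tail, e.
        change (e3 (S (S (S n)))) with (- B * e3 n)%R. now rewrite RtoC_mult, RtoC_opp. }
      rewrite T in E3. rewrite E3 in E2. rewrite E2 in E1. etransitivity; [exact E1|].
      unfold tail, e. simpl e3. ring. }
    transitivity (psum e z + B * z ^ 3 * psum e z). ring. rewrite E at 1. ring. }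
  set (q := fun n => RtoC (A - B) * shift (shift e) n).
  destruct (janowski_exists A B c q) as (f & g & H1 & H2 & H3); auto.
  - intros z Hz. rewrite Ec by auto. unfold in_disc in *. rewrite Cmod_pow.
    assert (X := Cmod_ge_0 z). assert (Cmod z ^ 2 <= 1)%R by nra. simpl in *. nra.
  - apply rad_scal. now repeat apply rad_shift.
  - intros z Hz. unfold q. rewrite (psum_scal _ _ 1), !(psum_shift _ 1), Ec; auto using rad_shift.
    transitivity (RtoC (A - B) * z ^ 3 * ((1 + B * z ^ 3) * psum e z)). simpl; ring. rewrite Ee by auto. ring.
  - exists f, g, c. split; auto.
Qed.

Local Open Scope R_scope.
(** * The sharp bounds *)

Lemma janowski_schwarz A B f g : -1 <= B <= 1 -> janowski_convex A B f -> log_coefficients f g ->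
  exists w c, schwarz w c /\ gamma_formulas A B g c.
Proof.
  intros HB (CA & Nf & w & Hw & Hd & w0 & HE) Hg.
  destruct (analytic_schwarz w Hw Hd w0) as (c & Hc). exists w, c. split; auto.
  now apply (gamma_of_schwarz A B f g w c).
Qed.

Lemma schwarz_c2_bound w c (t : R) : schwarz w c ->
  Cmod (c 2%nat + t * c 1%nat ^ 2)%C <= Rmax 1 (Rabs t).
Proof.
  intros H. assert (H1 := schwarz_c1 w c H). assert (H2 := schwarz_c2 w c H).
  assert (X := Cmod_ge_0 (c 1%nat)).
  eapply Rle_trans. apply Cmod_triangle. rewrite Cmod_mult, Cmod_pow, Cmod_R.
  assert (M1 := Rmax_l 1 (Rabs t)). assert (M2 := Rmax_r 1 (Rabs t)). set (M := Rmax 1 (Rabs t)) in *.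
  assert (0 <= Cmod (c 1%nat) ^ 2 <= 1) by nra. nra.
Qed.

Section Sharp.
Variables A B : R.
Hypotheses (hB : -1 <= B) (hBA : B < A) (hA : A <= 1).
Let mu := 1 / 2 * (A - 5 * B).
Let nu := 1 / 2 * (3 * B ^ 2 - A * B).
Let m := Rabs mu.

(** The difference is [(A - B)^2 / 16]. *)
Lemma nu_le : nu <= m ^ 2 / 4.
Proof. unfold m. rewrite pow2_abs. unfold mu, nu. assert (0 <= (A - B) ^ 2) by apply pow2_ge_0. nra. Qed.

Lemma bound_1 : gamma_bound A B 1 ((A - B) / 4).
Proof.
  intros f g Hf Hg. destruct (janowski_schwarz A B f g) as (w & c & Hw & E & _); auto; [lra|].
  rewrite E, Cmod_mult, Cmod_Rpos by lra. assert (X := schwarz_c1 w c Hw). nra.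
Qed.

Lemma bound_2 : gamma_bound A B 2 ((A - B) / 12 * Rmax 1 (Rabs ((A - 5 * B) / 4))).
Proof.
  intros f g Hf Hg. destruct (janowski_schwarz A B f g) as (w & c & Hw & _ & E & _); auto; [lra|].
  rewrite E, Cmod_mult, Cmod_Rpos by lra. apply Rmult_le_compat_l. lra. now apply (schwarz_c2_bound w).
Qed.

Lemma bound_3 M :
  (forall a x y W : R, 0 <= a <= 1 -> 0 <= x <= 1 -> -x <= y <= x -> 0 <= W ->
     W ^ 2 = modsq m (nu * a ^ 2) (1 - a ^ 2) x y -> (1 - a ^ 2) * (1 - x ^ 2) + a * W <= M) ->
  gamma_bound A B 3 ((A - B) / 24 * M).
Proof.
  intros HM f g Hf Hg. destruct (janowski_schwarz A B f g) as (w & c & Hw & _ & _ & E); auto; [lra|].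
  rewrite E, Cmod_mult, Cmod_Rpos by lra. apply Rmult_le_compat_l. lra.
  apply (schwarz_c3 w c mu nu M Hw). now apply schur_functional.
Qed.

Lemma attained_1 : gamma_attained A B 1 ((A - B) / 4).
Proof.
  destruct (blaschke_attained A B 1 1) as (f & g & c & Hf & Hg & (E & _) & c1 & _); try lra.
  exists f, g. split; [|split]; auto. rewrite E, c1, <- RtoC_mult, Cmod_R, Rabs_pos_eq; lra.
Qed.

Lemma attained_2_small : gamma_attained A B 2 ((A - B) / 12).
Proof.
  destruct (blaschke_attained A B 0 1) as (f & g & c & Hf & Hg & (_ & E & _) & c1 & c2 & _); try lra.
  exists f, g. split; [|split]; auto.
  rewrite E, c1, c2, <- RtoC_pow, <- RtoC_mult, <- RtoC_plus, <- RtoC_mult, Cmod_R, Rabs_pos_eq; lra.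
Qed.

Lemma attained_2_large : gamma_attained A B 2 ((A - B) / 48 * Rabs (A - 5 * B)).
Proof.
  destruct (blaschke_attained A B 1 1) as (f & g & c & Hf & Hg & (_ & E & _) & c1 & c2 & _); try lra.
  exists f, g. split; [|split]; auto.
  rewrite E, c1, c2, <- RtoC_pow, <- RtoC_mult, <- RtoC_plus, <- RtoC_mult, Cmod_R.
  replace ((A - B) / 12 * (1 * (1 - 1 ^ 2) + (A - 5 * B) / 4 * (1 * 1) ^ 2)) with ((A - B) / 48 * (A - 5 * B)) by field.
  rewrite Rabs_mult, (Rabs_pos_eq ((A - B) / 48)); lra.
Qed.

Lemma attained_3_cube : gamma_attained A B 3 ((A - B) / 24).
Proof.
  destruct (cube_attained A B) as (f & g & c & Hf & Hg & (_ & _ & E) & c1 & c2 & c3); try lra.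
  exists f, g. split; [|split]; auto. rewrite E, c1, c2, c3.
  match goal with |- Cmod (?k * ?e)%C = _ => replace e with (RtoC 1) by ring end.
  rewrite Cmult_1_r, Cmod_Rpos; lra.
Qed.

(** With the sign of the Blaschke product opposite to that of [mu], all the terms
    of the functional but the [nu] term add up. *)
Lemma attained_3_blaschke al : 0 <= al <= 1 ->
  gamma_attained A B 3 ((A - B) / 24 * Rabs ((m + 1) * al - (m + 1 + nu) * al ^ 3)).
Proof.
  intros Hal.
  assert (exists sg, (sg = 1 \/ sg = -1) /\ sg * mu = - m) as (sg & Hsg & Em).
  { unfold m. destruct (Rle_dec 0 mu). exists (-1). rewrite Rabs_pos_eq by lra. split; auto; lra.
    exists 1. rewrite Rabs_left by lra. split; auto; lra. }
  destruct (blaschke_attained A B al sg) as (f & g & c & Hf & Hg & (_ & _ & E) & c1 & c2 & c3); auto.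
  exists f, g. split; [|split]; auto. rewrite E, c1, c2, c3.
  fold mu nu. rewrite <- RtoC_pow, <- !RtoC_mult, <- !RtoC_plus, <- RtoC_mult, Cmod_R, Rabs_mult, (Rabs_pos_eq ((A - B) / 24)) by lra.
  f_equal.
  assert (S2 : sg * sg = 1) by (destruct Hsg as [->| ->]; ring).
  replace (- (sg * al * (1 - al ^ 2)) + mu * (sg * al) * (sg * (1 - al ^ 2)) + nu * (sg * al) ^ 3)
    with (- (sg * ((m + 1) * al - (m + 1 + nu) * al ^ 3))).
  - rewrite Rabs_Ropp, Rabs_mult. replace (Rabs sg) with 1. ring.
    destruct Hsg as [->| ->]; [now rewrite Rabs_R1|rewrite Rabs_left; lra].
  - replace (mu * (sg * al) * (sg * (1 - al ^ 2))) with (sg * ((sg * mu) * al * (1 - al ^ 2))) by ring.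
    rewrite Em. replace ((sg * al) ^ 3) with (sg * (sg * sg) * al ^ 3) by ring. rewrite S2. ring.
Qed.

Lemma sharp_2_small : Rabs (A - 5 * B) <= 4 -> gamma_sharp_bound A B 2 ((A - B) / 12).
Proof.
  intros H. split; [|apply attained_2_small].
  intros f g Hf Hg. eapply Rle_trans. now apply (bound_2 f g).
  unfold Rdiv at 2. rewrite Rabs_mult, (Rabs_pos_eq (/ 4)), Rmax_left by lra. lra.
Qed.

Lemma sharp_2_large : Rabs (A - 5 * B) > 4 -> gamma_sharp_bound A B 2 ((A - B) / 48 * Rabs (A - 5 * B)).
Proof.
  intros H. split; [|apply attained_2_large].
  intros f g Hf Hg. eapply Rle_trans. now apply (bound_2 f g).
  unfold Rdiv at 2. rewrite Rabs_mult, (Rabs_pos_eq (/ 4)), Rmax_right by lra. lra.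
Qed.

Lemma sharp_3_cube : D1 mu nu \/ D2 mu nu -> gamma_sharp_bound A B 3 ((A - B) / 24).
Proof.
  intros H. split; [|apply attained_3_cube].
  rewrite <- (Rmult_1_r ((A - B) / 24)). apply bound_3. intros a x y W Ha Hx Hy HW EW.
  assert (Hm : 0 <= m) by apply Rabs_pos.
  apply (schur_bound m nu 1 a x y W); auto; try lra.
  - apply nu_le.
  - intros t Ht. destruct H as [[H1 H2]|[H1 H2]]; fold m in H1.
    + assert (0 <= t ^ 3) by (apply pow_le; lra). assert (m * (t - t ^ 3) <= 1 / 2 * (t - t ^ 3)).
      { apply Rmult_le_compat_r. assert (t ^ 3 = t * t ^ 2) by ring. nra. lra. }
      assert (0 <= (1 - t) ^ 2 * (t + 2)) by (apply Rmult_le_pos; [apply pow2_ge_0|lra]). nra.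
    + fold m in H2. set (P := m + 1) in *.
      assert (0 <= t ^ 3) by (apply pow_le; lra).
      assert (4 / 27 * P ^ 3 * t ^ 3 <= (P + nu) * t ^ 3) by (apply Rmult_le_compat_r; lra).
      assert (0 <= (P * t - 3 / 2) ^ 2 * (P * t + 3)).
      { apply Rmult_le_pos. apply pow2_ge_0. unfold P. nra. }
      nra.
  - left. destruct H as [[_ H]|[_ H]]; lra.
Qed.

Lemma sharp_3_identity : D6 mu nu -> gamma_sharp_bound A B 3 ((A - B) / 48 * Rabs (B * (A - 3 * B))).
Proof.
  intros [H1 H2]. fold m in H1.
  assert (Hn : m ^ 2 + 8 <= 12 * nu) by (unfold m; rewrite pow2_abs; lra).
  assert (Hm : 0 <= m) by apply Rabs_pos.
  assert (E : (A - B) / 48 * Rabs (B * (A - 3 * B)) = (A - B) / 24 * nu).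
  { replace (B * (A - 3 * B)) with (- (2 * nu)) by (unfold nu; field).
    rewrite Rabs_Ropp, Rabs_pos_eq by nra. field. }
  rewrite E. split.
  - apply bound_3. intros a x y W Ha Hx _ HW EW.
    apply (schur_bound_large m nu a x y W); auto. apply nu_le.
  - assert (X := attained_3_blaschke 1 ltac:(lra)).
    replace ((m + 1) * 1 - (m + 1 + nu) * 1 ^ 3) with (- nu) in X by ring.
    rewrite Rabs_Ropp, Rabs_pos_eq in X by nra. exact X.
Qed.

(** Here [M] is the maximum of [P t - Q t^3], attained at [t0 = sqrt (P / (3 Q))],
    with [P = |mu| + 1] and [Q = P + nu]. The
    lower bound on [nu] says [t0 <= 1], and both regions give [27 Q <= 4 P^3], that is
    [1 <= M]. *)
Lemma sharp_3_interior : D8 mu nu \/ D9 mu nu ->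
  gamma_sharp_bound A B 3 ((A - B) / (72 * sqrt 3) *
         (Rpower (Rabs (A - 5 * B) + 2) (3 / 2) /
          sqrt (Rabs (A - 5 * B) + 2 + 3 * B ^ 2 - A * B))).
Proof.
  intros H. assert (Hm : 0 <= m) by apply Rabs_pos.
  set (P := m + 1). set (Q := P + nu).
  assert (HP : 1 <= P) by (unfold P; lra).
  assert (Hnu : - (2 / 3) * P <= nu) by (unfold P; destruct H as [[_ H]|[_ H]]; unfold m; lra).
  assert (HQ : 0 < Q) by (unfold Q; lra).
  assert (HPQ : 27 * Q <= 4 * P ^ 3).
  { destruct H as [[H1 H2]|[H1 H2]]; fold m in H1, H2; fold P in H2.
    - unfold Q. lra.
    - set (K := 2 * m * P / (mu ^ 2 + 2 * m + 4)) in *.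
      assert (E : K * (m ^ 2 + 2 * m + 4) = 2 * m * P).
      { unfold K. rewrite <- (pow2_abs mu). fold m. field. nra. }
      assert (K <= P / 3).
      { apply Rmult_le_reg_r with (m ^ 2 + 2 * m + 4). nra. rewrite E.
        assert (0 <= P * (m - 2) ^ 2) by (apply Rmult_le_pos; [lra|apply pow2_ge_0]). lra. }
      assert (9 <= P ^ 2) by (unfold P; nra).
      assert (P * 9 <= P * P ^ 2) by (apply Rmult_le_compat_l; lra).
      unfold Q. nra. }
  set (t0 := sqrt (P / (3 * Q))).
  assert (Hq0 : 0 < P / (3 * Q)) by (apply Rdiv_lt_0_compat; lra).
  assert (Et : t0 ^ 2 = P / (3 * Q)) by (apply pow2_sqrt; lra).
  assert (EP : P = 3 * Q * t0 ^ 2) by (rewrite Et; field; lra).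
  assert (Ht0 : 0 < t0) by now apply sqrt_lt_R0.
  assert (Ht1 : t0 <= 1).
  { apply le_of_sqr. lra. apply Rmult_le_reg_l with (3 * Q). lra. rewrite <- EP. unfold Q; lra. }
  set (M := 2 / 3 * P * t0).
  assert (HM : 1 <= M).
  { apply le_of_sqr. unfold M; nra. unfold M.
    replace ((2 / 3 * P * t0) ^ 2) with (4 / 9 * P ^ 2 * t0 ^ 2) by field. rewrite Et.
    apply Rmult_le_reg_r with (27 * Q). lra.
    replace (4 / 9 * P ^ 2 * (P / (3 * Q)) * (27 * Q)) with (4 * P ^ 3) by (field; lra). lra. }
  assert (Val : (A - B) / (72 * sqrt 3) * (Rpower (Rabs (A - 5 * B) + 2) (3 / 2) /
          sqrt (Rabs (A - 5 * B) + 2 + 3 * B ^ 2 - A * B)) = (A - B) / 24 * M).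
  { assert (Em : Rabs (A - 5 * B) = 2 * m).
    { unfold m, mu. rewrite Rabs_mult, (Rabs_pos_eq (1 / 2)) by lra. field. }
    rewrite Em.
    replace (2 * m + 2) with (2 * P) by (unfold P; ring).
    replace (2 * P + 3 * B ^ 2 - A * B) with (2 * Q) by (unfold Q, nu; field).
    replace (3 / 2) with (1 + / 2) by field.
    rewrite Rpower_plus, Rpower_1, Rpower_sqrt by lra.
    unfold M, t0. rewrite sqrt_div, !sqrt_mult by lra.
    assert (0 < sqrt 2) by (apply sqrt_lt_R0; lra). assert (0 < sqrt 3) by (apply sqrt_lt_R0; lra).
    assert (0 < sqrt Q) by (apply sqrt_lt_R0; lra). field. lra. }
  rewrite Val. split.
  - apply bound_3. intros a x y W Ha Hx Hy HW EW.
    apply (schur_bound m nu M a x y W); auto.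
    + apply nu_le.
    + intros t Ht. fold P. fold Q. unfold M.
      assert (0 <= Q * ((t - t0) ^ 2 * (t + 2 * t0))).
      { apply Rmult_le_pos. lra. apply Rmult_le_pos. apply pow2_ge_0. lra. }
      rewrite EP. nra.
    + destruct H as [[H1 H2]|[H1 H2]]; fold m in H1, H2.
      * left. fold P in H2.
        assert (0 <= (3 - P) * (2 * P + 3) ^ 2).
        { apply Rmult_le_pos. unfold P; lra. apply pow2_ge_0. }
        nra.
      * right. rewrite <- (pow2_abs mu) in H2. fold m in H2.
        apply Rle_trans with (2 * m * (m + 1) / (m ^ 2 + 2 * m + 4) * (m ^ 2 + 2 * m + 4)).
        apply Rmult_le_compat_r. nra. lra. right. field. nra.
  - assert (X := attained_3_blaschke t0 ltac:(lra)). fold P in X. fold Q in X.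
    replace (P * t0 - Q * t0 ^ 3) with M in X.
    + rewrite Rabs_pos_eq in X by lra. exact X.
    + unfold M. rewrite EP. field.
Qed.

End Sharp.

Theorem theorem2p2 (A B : R) (hB : -1 <= B) (hBA : B < A) (hA : A <= 1) :
  gamma_sharp_bound A B 1 ((A - B) / 4) /\
  (Rabs (A - 5 * B) <= 4 ->
     gamma_sharp_bound A B 2 ((A - B) / 12)) /\
  (Rabs (A - 5 * B) > 4 ->
     gamma_sharp_bound A B 2 ((A - B) / 48 * Rabs (A - 5 * B))) /\
  (let mu := 1 / 2 * (A - 5 * B) in
   let nu := 1 / 2 * (3 * B ^ 2 - A * B) in
   (D1 mu nu \/ D2 mu nu ->
      gamma_sharp_bound A B 3 ((A - B) / 24)) /\
   (D6 mu nu ->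
      gamma_sharp_bound A B 3 ((A - B) / 48 * Rabs (B * (A - 3 * B)))) /\
   (D8 mu nu \/ D9 mu nu ->
      gamma_sharp_bound A B 3
        ((A - B) / (72 * sqrt 3) *
         (Rpower (Rabs (A - 5 * B) + 2) (3 / 2) /
          sqrt (Rabs (A - 5 * B) + 2 + 3 * B ^ 2 - A * B))))).
Proof.
  split; [split; [now apply bound_1|now apply attained_1]|].
  split; [now apply sharp_2_small|]. split; [now apply sharp_2_large|].
  cbv zeta. split; [now apply sharp_3_cube|]. split; [now apply sharp_3_identity|now apply sharp_3_interior].
Qed.
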